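(* Let $\rho>0$, let $u$ be an $L_\rho$-subfunction on $\mathbb T^2_P$, and let $\mathcal H_\rho(u)$ be the maximal open subset of $\mathbb T^2_P$ on which $L_\rho u=0$. If there exists a connected component $M$ of $\mathcal H_\rho(u)$ (with boundary of positive capacity) such that $\rho(M)<\rho$, then $u$ is a minimal $L_\rho$-subfunction.
   Context: Fix $T>1$, $P=\log T$, and $\mathbb T^2_P=\mathbb C/(P\mathbb Z+2\pi i\mathbb Z)$ with coordinate $z=x+iy$. Let $L_\rho=\frac{\partial^2}{\partial x^2}+\frac{\partial^2}{\partial y^2}+2\rho\frac{\partial}{\partial x}+\rho^2$. An $L_\rho$-subfunction on $\mathbb T^2_P$ is a function $u$ of the form $u(z)=V(e^z)e^{-\rho x}$, where $V$ is subharmonic in $\mathbb C$ (not identically $-\infty$) and $V(TZ)=T^\rho V(Z)$ for all $Z$; such $u$ is upper semicontinuous and $L_\rho u\ge0$ in the sense of distributions. An $L_\rho$-subminorant of a function $m$ on $\mathbb T^2_P$ is an $L_\rho$-subfunction $w$ with $w\le m$ on $\mathbb T^2_P$. An $L_\rho$-subfunction $u$ is minimal if, for every $\epsilon>0$, the function $u-\epsilon$ has no $L_\rho$-subminorant on $\mathbb T^2_P$. For a domain $M\subset\mathbb T^2_P$ with boundary of positive logarithmic capacity, $\operatorname{Spec}M$ is the set of $\sigma\in\mathbb C$ for which there is $q\not\equiv0$, bounded on $M$, with $L_\sigma q=0$ in $M$ and boundary value $0$ quasi-everywhere on $\partial M$ (outside a set of zero capacity). $\rho(M)$ is the minimal positive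 point of $\operatorname{Spec}M$, with $\rho(M)=\infty$ if there is none. *)

(* Defs.v *)
From HB Require Import structures.
From mathcomp Require Import all_boot all_order all_algebra generic_quotient.
From mathcomp Require Import all_classical all_reals all_analysis.
From mathcomp Require Import complex.

Set Implicit Arguments.
Unset Strict Implicit.
Unset Printing Implicit Defensive.

Import Order.TTheory GRing.Theory Num.Theory.
Import numFieldTopology.Exports numFieldNormedType.Exports.

Local Open Scope classical_set_scope.
Local Open Scope ring_scope.
Local Open Scope quotient_scope.

Section plane.
Variable R : realType.
Implicit Types (z w : R * R) (f : R * R -> R) (A : set (R * R)).

(* The complex plane is R * R, the point x + iy being (x, y). *)

Definition cexp z : R * R := (expR z.1 * cos z.2, expR z.1 * sin z.2).

Definition euclid_dist z w : R :=
  Num.sqrt ((z.1 - w.1) ^+ 2 + (z.2 - w.2) ^+ 2).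

Definition ddx f : R * R -> R := fun z => 'D_((1, 0) : R * R) f z.
Definition ddy f : R * R -> R := fun z => 'D_((0, 1) : R * R) f z.

(* C^k on A; only meant for open A. *)
Fixpoint Ck (k : nat) A f : Prop :=
  (forall z, A z -> {for z, continuous f}) /\
  if k is k'.+1 then
    (forall z, A z -> derivable f z ((1, 0) : R * R) /\
                      derivable f z ((0, 1) : R * R)) /\
    Ck k' A (ddx f) /\ Ck k' A (ddy f)
  else True.

Definition smooth f : Prop := forall k, Ck k setT f.

Definition Lop (rho : R) f : R * R -> R := fun z =>
  ddx (ddx f) z + ddy (ddy f) z + 2 * rho * ddx f z + rho ^+ 2 * f z.

Definition angles : set R := `[0, 2 * pi]%classic.

Definition circle z (r t : R) : R * R := (z.1 + r * cos t, z.2 + r * sin t).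

(* Values in [-oo, +oo[; the function identically -oo is not excluded here. *)
Definition subharmonic (V : R * R -> \bar R) : Prop :=
  [/\ forall z, (V z < +oo)%E,
      lower_semicontinuous (fun z => - V z)%E &
      forall z (r : R), 0 < r ->
        (V z <= ((2 * pi)^-1)%:E *
          \int[lebesgue_measure]_(t in angles) V (circle z r t))%E].

Definition plane_mT := (measurableTypeR R * measurableTypeR R)%type.

Definition area : set plane_mT -> \bar R :=
  (lebesgue_measure \x lebesgue_measure)%E.

(* log (1 / |z - w|), equal to +oo on the diagonal. *)
Definition log_kernel z w : \bar R := (- lne (euclid_dist z w)%:E)%E.

Definition log_energy (mu : probability plane_mT R) : \bar R :=
  (\int[mu]_z \int[mu]_w log_kernel z w)%E.

(* The supremum runs over the probability measures carried by a compact subset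
   of A; the value 0 is added so that the empty set has capacity 0. *)
Definition log_capacity A : \bar R :=
  ereal_sup (0%E |` [set c | exists (mu : probability plane_mT R) (K : set (R * R)),
    [/\ compact K, K `<=` A, mu K = 1%E & c = expeR (- log_energy mu)]]).

End plane.

Section torus_type.
Variables (R : realType) (P : R).

Definition lattice_rel : rel (R * R) := fun z w =>
  `[< exists m n : int, w.1 - z.1 = m%:~R * P /\ w.2 - z.2 = n%:~R * (2 * pi) >].

Lemma lattice_rel_refl : reflexive lattice_rel.
Proof. by move=> z; apply/asboolP; exists 0, 0; rewrite !subrr !mul0r. Qed.

Lemma lattice_rel_sym : symmetric lattice_rel.
Proof.
suff H z w : lattice_rel z w -> lattice_rel w z by move=> z w; apply/idP/idP; exact: H.
move=> /asboolP[m [n [e1 e2]]]; apply/asboolP; exists (- m), (- n).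
by rewrite !mulrNz !mulNr -e1 -e2 !opprB.
Qed.

Lemma lattice_rel_trans : transitive lattice_rel.
Proof.
move=> w z v /asboolP[m [n [e1 e2]]] /asboolP[m' [n' [e1' e2']]].
apply/asboolP; exists (m' + m), (n' + n).
rewrite !intrD (mulrDl _ _ P) (mulrDl _ _ (2 * pi)) -e1 -e2 -e1' -e2'.
by rewrite !addrA !subrK.
Qed.

Canonical lattice_equiv :=
  EquivRel lattice_rel lattice_rel_refl lattice_rel_sym lattice_rel_trans.

(* C / (P Z + 2 pi i Z) with the quotient topology. *)
Definition torus : topologicalType :=
  quotient_topology {eq_quot lattice_equiv}.

Definition tproj : R * R -> torus :=
  \pi_(quotient_topology {eq_quot lattice_equiv}).

End torus_type.

Section torus_theory.
Variables (R : realType) (T : R).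
Local Notation P := (ln T).
Local Notation tor := (torus P).
Local Notation pr := (@tproj R P).
Implicit Types (rho : R) (u w : tor -> \bar R) (U M E : set tor).

Definition subfunction rho u : Prop :=
  exists V : R * R -> \bar R,
    [/\ subharmonic V,
        exists Z, V Z != -oo%E,
        forall Z, V (T *: Z) = ((T `^ rho)%:E * V Z)%E &
        forall z, u (pr z) = (V (cexp z) * (expR (- rho * z.1))%:E)%E].

Definition subminorant rho (m : tor -> \bar R) w : Prop :=
  subfunction rho w /\ forall p, (w p <= m p)%E.

Definition minimal_subfunction rho u : Prop :=
  subfunction rho u /\
  forall eps : R, 0 < eps ->
    ~ exists w, subminorant rho (fun p => u p - eps%:E)%E w.

Definition test_function U (phi : tor -> R) : Prop :=
  smooth (phi \o pr) /\ closure [set p | phi p != 0] `<=` U.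

Definition fundamental_domain : set (plane_mT R) :=
  `[0, P]%classic `*` @angles R.

(* The formal adjoint of L_rho is L_(- rho). *)
Definition Lop_zero_on rho u U : Prop :=
  forall phi, test_function U phi ->
    (\int[@area R]_(z in fundamental_domain)
       (u (pr z) * (Lop (- rho) (phi \o pr) z)%:E) = 0)%E.

Definition Hset rho u : set tor :=
  \bigcup_(U in [set U | open U /\ Lop_zero_on rho u U]) U.

Definition is_component M U : Prop :=
  exists2 p, U p & M = connected_component U p.

Definition boundary M : set tor := closure M `\` M°.

(* The preimage of E is a countable union of translates of its part in the
   fundamental domain, so whether its capacity vanishes only depends on E. *)
Definition zero_capacity E : Prop := log_capacity (pr @^-1` E) = 0%E.

Definition positive_capacity E : Prop := (0 < log_capacity (pr @^-1` E))%E.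

Definition Csolution (sigma : R[i]) (q : tor -> R[i]) M : Prop :=
  let A := pr @^-1` M in
  let a := fun z => complex.Re (q (pr z)) in
  let b := fun z => complex.Im (q (pr z)) in
  let D (d : (R * R -> R) -> R * R -> R) z := (d a z +i* d b z)%C in
  [/\ Ck 2 A a, Ck 2 A b &
      forall z, A z ->
        D (fun f => ddx (ddx f)) z + D (fun f => ddy (ddy f)) z
          + 2 * sigma * D (@ddx R) z + sigma ^+ 2 * q (pr z) = 0].

Definition Spec M : set R[i] := [set sigma | exists q : tor -> R[i],
  [/\ exists2 p, M p & q p != 0,
      exists B : R, forall p, M p -> Normc.normc (q p) <= B,
      Csolution sigma q M &
      exists2 E : set tor, zero_capacity E &
        forall p, boundary M p -> ~ E p ->
          (Normc.normc (q x) @[x --> within M (nbhs p)] --> (0 : R))]].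

Definition min_positive (S : set R[i]) (s : R) : Prop :=
  [/\ 0 < s, S (s%:C)%C & forall t : R, 0 < t -> S (t%:C)%C -> s <= t].

Definition rho_dom M : \bar R :=
  xget +oo%E [set s%:E | s in min_positive (Spec M)].

End torus_theory.

(* Main.v *)
(* Let w be an L_rho-subminorant of u - eps, coming from V_w as u comes from
   V_u, let s = rho(M) < rho with eigenfunction q, and let A be the preimage of
   M in the plane. For a = +- Re q or +- Im q the function Q = e^(s x) a is
   harmonic on A and bounded by B e^(s x), while V_u (e^z) is harmonic on A and
   V_u (e^z) - V_w (e^z) >= eps e^(rho x). Hence, for delta > 0, the function
   F = Q - delta (V_u (e^z) - V_w (e^z)) is subharmonic on A; as 0 < s < rho, it
   is small for x near -oo and negative for x near +oo. The exceptional part of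
   the boundary has zero capacity, so a small multiple of a potential that is
   very negative there pushes F below 0 near it. The maximum principle bounds F,
   and delta -> 0 gives Q <= 0 wherever V_w (e^z) > -oo, that is, on a dense set.
   Therefore q = 0.

   V_u is harmonic only in the weak sense. It is tested against the cut-off
   logarithms k (ln |e^w - e^z|^2 - l), whose Laplacians are the positive
   weights [wt], supported in annuli around e^z; this turns the equation into
   mean value inequalities. *)

(* Upper semicontinuity of V_u works against the maximum principle: - delta V_u is lower
   semicontinuous, so F need not attain its supremum, and it is an approximate maximum that has to
   be contradicted. No regularity of V_u is established. The weak equation only says that two
   concentric annuli carry the same weighted mean; shrinking one of them and using semicontinuity
   gives an inequality at the centre, opposite in direction to the sub-mean value inequality of V_w.
   These two directions are the ones that V_u - V_w needs.

   Distances are measured by |e^w - e^z|: they are 2 pi i periodic and their logarithms are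
   harmonic, so the angular variable can be kept in a compact window. The factor e^(s x) destroys
   the period P, so the other variable is confined by growth.

   The potential of the exceptional set is an average of finitely many logarithms with poles in that
   set. It is harmonic away from its poles, and averaging keeps its value at a given point of A
   bounded below, however negative it is made near the set. Such poles are found by a compactness
   argument that constructs a measure of finite energy if they do not exist. *)
From HB Require Import structures.
Require Import Defs.
From mathcomp Require Import all_boot all_order all_algebra generic_quotient.
From mathcomp Require Import all_classical all_reals all_analysis.
From mathcomp Require Import complex ring lra measurable_realfun.

Set Implicit Arguments.
Unset Strict Implicit.
Unset Printing Implicit Defensive.

Import Order.TTheory GRing.Theory Num.Theory.
Import numFieldTopology.Exports numFieldNormedType.Exports.

Local Open Scope classical_set_scope.
Local Open Scope ring_scope.

(** * Smooth cut-offs *)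

Section smooth_functions.
Variable R : realType.
Implicit Types (x y : R) (z w : R * R).

(* The factors x^-m make the span of this family stable under differentiation. *)
Definition flat (m : nat) x : R := if 0 < x then x^-1 ^+ m * expR (- x^-1) else 0.

Lemma flat_ge0 m x : 0 <= flat m x.
Proof.
rewrite /flat; case: ifPn => // x0.
by rewrite mulr_ge0 ?expR_ge0// exprn_ge0// invr_ge0 ltW.
Qed.

Lemma flat_gt0 m x : 0 < x -> 0 < flat m x.
Proof. by move=> x0; rewrite /flat x0 mulr_gt0 ?expR_gt0// exprn_gt0// invr_gt0. Qed.

Lemma flat_le0 m x : x <= 0 -> flat m x = 0.
Proof. by move=> x0; rewrite /flat ltNge x0. Qed.

(** With y = 1/x this is (y/(m+2))^(m+2) <= e^y, the power m+2 of t <= e^t. Vanishing to second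
    order is what [is_derive_sqr_small] needs at 0. *)
Lemma flat_le m x : flat m x <= m.+2%:R ^+ m.+2 * x ^+ 2.
Proof.
have [x0|x0] := ltP 0 x; last first.
  by rewrite flat_le0// mulr_ge0 ?sqr_ge0 ?exprn_ge0.
rewrite /flat x0 -(ler_pM2r (expR_gt0 (x^-1))) -mulrA -expRD addNr expR0 mulr1.
have [y y0 ->] : exists2 y, 0 < y & x = y^-1 by exists x^-1; rewrite ?invr_gt0 ?invrK.
rewrite invrK; have : (y / m.+2%:R) ^+ m.+2 <= expR y.
  have -> : expR y = expR (y / m.+2%:R) ^+ m.+2.
    by rewrite -expRM_natl mulrCA mulfV ?mulr1.
  apply: lerXn2r; rewrite ?nnegrE ?expR_ge0 ?divr_ge0 ?(ltW y0)//.
  by apply: le_trans (expR_ge1Dx _); rewrite lerDr.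
rewrite expr_div_n ler_pdivrMr ?exprn_gt0// => H.
rewrite mulrAC exprVn ler_pdivlMr ?exprn_gt0// -exprD addn2.
by rewrite [leRHS]mulrC.
Qed.

Lemma cvg_is_derive (V W : normedModType R) (f : V -> W) (z v : V) (a : W) :
  (h^-1 *: (f (h *: v + z) - f z) @[h --> (0:R)^'] --> a) <-> is_derive z v f a.
Proof.
split=> [H|[d <-]]; last exact: d.
by split; [apply/cvg_ex; exists a|exact: cvg_lim].
Qed.

Lemma is_derive_sqr_small (f : R -> R) (C : R) : (forall x, `|f x| <= C * x ^+ 2) ->
  is_derive (0:R) 1 f 0.
Proof.
move=> fC.
have f0 : f 0 = 0 by apply/eqP; rewrite -normr_le0 (le_trans (fC 0))// expr0n mulr0.
have C0 : 0 <= C by apply: (le_trans (normr_ge0 _)); move: (fC 1); rewrite expr1n mulr1; exact.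
have H : h^-1 *: (f (h *: (1:R) + 0) - f 0) @[h --> (0:R)^'] --> (0:R).
  apply/cvgrPdist_lt => e e0; near=> h.
  have h0 : h != 0 by near: h; exact: nbhs_dnbhs_neq.
  rewrite sub0r normrN f0 subr0 addr0 -[h *: 1]/(h * 1) mulr1 -[_ *: _]/(_ * _) normrM normfV.
  rewrite mulrC ltr_pdivrMr ?normr_gt0//.
  apply: (le_lt_trans (fC h)); rewrite -real_normK ?num_real// expr2 mulrA.
  rewrite ltr_pM2r ?normr_gt0//.
  apply: (@le_lt_trans _ _ ((C + 1) * `|h|)).
    by rewrite ler_wpM2r// lerDl.
  rewrite mulrC -ltr_pdivlMr ?ltr_wpDl//.
  near: h; apply: dnbhs0_lt; rewrite divr_gt0// ltr_wpDl//.
by split; [apply/cvg_ex; exists 0|apply: cvg_lim].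
Unshelve. all: by end_near. Qed.

Lemma is_derive_flat m x : is_derive x 1 (flat m) (flat m.+2 x - m%:R * flat m.+1 x).
Proof.
have [x0|x0|<-] := ltgtP 0 x; last 2 first.
- rewrite !(flat_le0 _ (ltW x0)) mulr0 subr0.
  apply: (@near_eq_is_derive _ _ _ (cst 0)).
  by near=> y; rewrite flat_le0// ltW//; near: y; exact: lt_nbhsl.
- rewrite !flat_le0// mulr0 subr0.
  apply: (@is_derive_sqr_small _ (m.+2%:R ^+ m.+2)) => y.
  by rewrite ger0_norm ?flat_ge0 ?flat_le.
pose g := fun y : R => y^-1 ^+ m * expR (- y^-1).
apply: (@near_eq_is_derive _ _ _ g).
  by near=> y; rewrite /flat ifT//; near: y; exact: lt_nbhsr.
have dV : is_derive x 1 (fun y : R => y^-1) (- (x ^- 2)).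
  have := @is_deriveV R id x 1 1 (lt0r_neq0 x0) (is_derive_id _ _).
  by move/is_derive_eq; apply; rewrite -[LHS]/(_ * 1) mulr1.
have dE : is_derive x 1 (fun y : R => expR (- y^-1)) (x ^- 2 * expR (- x^-1)).
  have := @is_derive1_comp R expR (fun y => - y^-1) x _ _ _ _.
  move=> /(_ _ _ (is_derive_expR _) (is_deriveN dV)).
  by move/is_derive_eq; apply; rewrite opprK mulrC.
have dX : is_derive x 1 (fun y : R => y^-1 ^+ m) (- m%:R * x^-1 ^+ m.+1).
  have := @is_deriveX _ _ (fun y : R => y^-1) m x 1 _ dV.
  rewrite (_ : (GRing.inv : R -> R) ^+ m = (fun y : R => y^-1 ^+ m)); last first.
    by apply/funext => y; rewrite exprfctE.
  move/is_derive_eq; apply; rewrite -[_ *: _]/(_ * _).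
  case: m {g} => [|m]; first by rewrite mulr0n oppr0 !mul0r.
  by rewrite -exprVn mulrN -mulrA -exprD addn2 mulNr.
have := is_deriveM dX dE; move/is_derive_eq; apply.
rewrite /flat x0 -![_ *: _]/(_ * _) !exprS.
by field; rewrite gt_eqF.
Unshelve. all: by end_near. Qed.


Lemma open_near (X : topologicalType) (U : set X) (z : X) : open U -> U z -> \forall w \near z, U w.
Proof. by move=> oU Uz; apply: open_nbhs_nbhs; split. Qed.

(** Directional derivability does not make f differentiable, so the chain rule is transported to the
    line h |-> h v + z, on which f is a function of one variable. *)
Lemma is_derive_comp1 (f : R * R -> R) (K : R -> R) z (v : R * R) a b :
  is_derive z v f a -> is_derive (f z) 1 K b -> is_derive z v (fun w => K (f w)) (b * a).
Proof.
move=> df dK.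
have cE (g : R * R -> R) c :
    is_derive (0:R) 1 (fun h : R => g (h *: v + z)) c <-> is_derive z v g c.
  rewrite -!cvg_is_derive.
  suff -> : (fun h : R => h^-1 *: (g ((h *: (1:R) + 0) *: v + z) - g (0 *: v + z))) =
    (fun h : R => h^-1 *: (g (h *: v + z) - g z)) by [].
  by apply/funext => h; rewrite addr0 scale0r add0r [h *: 1]mulr1.
have dK' : is_derive ((fun h : R => f (h *: v + z)) 0) 1 K b by rewrite scale0r add0r.
by apply/cE; exact: is_derive1_comp dK' (proj2 (cE _ _) df).
Qed.

Lemma is_derive_lin (f : R * R -> R) z (v : R * R) :
  (forall h : R, f (h *: v + z) = h * f v + f z) -> is_derive z v f (f v).
Proof.
move=> lf; apply/cvg_is_derive.
apply: (@cvg_trans _ ((fun=> f v) @ (0:R)^')); last exact: cvg_cst.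
apply: near_eq_cvg; near=> h; rewrite lf addrK -[RHS]/(_ * _) mulKf//.
by near: h; exact: nbhs_dnbhs_neq.
Unshelve. all: by end_near. Qed.

(* Closed under partial derivatives, so that membership gives [Ck k] for all k. *)
Inductive sm (O : set (R * R)) : (R * R -> R) -> Prop :=
| sm_cst c : sm O (fun=> c)
| sm_fst : sm O (fun z => z.1)
| sm_snd : sm O (fun z => z.2)
| sm_add f g : sm O f -> sm O g -> sm O (fun z => f z + g z)
| sm_mul f g : sm O f -> sm O g -> sm O (fun z => f z * g z)
| sm_exp f : sm O f -> sm O (fun z => expR (f z))
| sm_cos f : sm O f -> sm O (fun z => cos (f z))
| sm_sin f : sm O f -> sm O (fun z => sin (f z))
| sm_ln f : sm O f -> (forall z, O z -> 0 < f z) -> sm O (fun z => ln (f z))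
| sm_inv f : sm O f -> (forall z, O z -> f z != 0) -> sm O (fun z => (f z)^-1)
| sm_flat m f : sm O f -> sm O (fun z => flat m (f z))
| sm_prim1 (th : R -> R) (c : R) f :
    (forall x, is_derive x 1 th (c * (flat 0 (x + 1) * flat 0 (- x)))) ->
    sm O f -> sm O (fun z => th (f z))
| sm_prim2 (k th : R -> R) (c : R) f :
    (forall x, is_derive x 1 k (th x)) ->
    (forall x, is_derive x 1 th (c * (flat 0 (x + 1) * flat 0 (- x)))) ->
    sm O f -> sm O (fun z => k (f z)).

Definition e1 : R * R := (1, 0).
Definition e2 : R * R := (0, 1).

Definition sm_der O f := exists fx fy, [/\ sm O fx, sm O fy &
  forall z, O z -> [/\ {for z, continuous f}, is_derive z e1 f (fx z) & is_derive z e2 f (fy z)]].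

Lemma sm_der_comp O f (K K' : R -> R) : sm_der O f -> sm O (fun z => K' (f z)) ->
  (forall z, O z -> is_derive (f z) 1 K (K' (f z))) -> sm_der O (fun z => K (f z)).
Proof.
move=> [fx [fy [sx sy df]]] sK dK; exists (fun z => K' (f z) * fx z), (fun z => K' (f z) * fy z).
split; [exact: sm_mul|exact: sm_mul|] => z Oz; have [cf dx dy] := df z Oz; split.
- apply: (@continuous_comp _ _ _ f K z) => //.
  by apply/differentiable_continuous/derivable1_diffP; case: (dK z Oz).
- exact: (is_derive_comp1 dx (dK z Oz)).
- exact: (is_derive_comp1 dy (dK z Oz)).
Qed.

Lemma smP O f : sm O f -> sm_der O f.
Proof.
elim=> {f} [c|||f g sf Hf sg Hg|f g sf Hf sg Hg|f sf Hf|f sf Hf|f sf Hf|f sf Hf f0|f sf Hf f0|m f sf Hf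
  |th c f dth sf Hf|k th c f dk dth sf Hf].
- exists (fun=> 0), (fun=> 0); split; [exact: sm_cst|exact: sm_cst|] => z _; split.
  + exact: cvg_cst.
  + exact: is_derive_cst.
  + exact: is_derive_cst.
- exists (fun=> 1), (fun=> 0); split; [exact: sm_cst|exact: sm_cst|] => z _; split.
  + exact: cvg_fst.
  + exact: (@is_derive_lin fst).
  + exact: (@is_derive_lin fst).
- exists (fun=> 0), (fun=> 1); split; [exact: sm_cst|exact: sm_cst|] => z _; split.
  + exact: cvg_snd.
  + exact: (@is_derive_lin snd).
  + exact: (@is_derive_lin snd).
- have [[fx [fy [sfx sfy df]]] [gx [gy [sgx sgy dg]]]] := (Hf, Hg).
  exists (fun z => fx z + gx z), (fun z => fy z + gy z).
  split; [exact: sm_add|exact: sm_add|] => z Oz.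
  have [[cf dxf dyf] [cg dxg dyg]] := (df z Oz, dg z Oz); split.
  + exact: (@continuousD _ _ _ f g z).
  + exact: (is_deriveD dxf dxg).
  + exact: (is_deriveD dyf dyg).
- have [[fx [fy [sfx sfy df]]] [gx [gy [sgx sgy dg]]]] := (Hf, Hg).
  exists (fun z => f z * gx z + g z * fx z), (fun z => f z * gy z + g z * fy z).
  split; [by apply: sm_add; exact: sm_mul|by apply: sm_add; exact: sm_mul|] => z Oz.
  have [[cf dxf dyf] [cg dxg dyg]] := (df z Oz, dg z Oz); split.
  + exact: (@continuousM _ _ f g z).
  + exact: (is_deriveM dxf dxg).
  + exact: (is_deriveM dyf dyg).
- apply: (@sm_der_comp _ _ expR expR Hf); exact: sm_exp.
- apply: (@sm_der_comp _ _ cos (fun x => - 1 * sin x) Hf) => [|z _]; last first.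
    by rewrite mulN1r; exact: is_derive_cos.
  by apply: (@sm_mul _ (fun=> -1) (fun z => sin (f z))); [exact: sm_cst|exact: sm_sin].
- by apply: (@sm_der_comp _ _ sin cos Hf); exact: sm_cos.
- apply: (@sm_der_comp _ _ (@ln R) (fun x => x^-1) Hf) => [|z Oz].
    by apply: sm_inv => // z Oz; rewrite gt_eqF// f0.
  exact: is_derive1_ln (f0 z Oz).
- apply: (@sm_der_comp _ _ (fun x => x^-1) (fun x => -1 * (x^-1 * x^-1)) Hf) => [|z Oz].
    by apply: (@sm_mul _ (fun=> -1)); [exact: sm_cst|apply: sm_mul; exact: sm_inv].
  have := @is_deriveV R id (f z) 1 1 (f0 z Oz) (is_derive_id _ _).
  by move/is_derive_eq; apply; rewrite -[LHS]/(_ * 1) mulr1 mulN1r expr2 invfM.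
- apply: (@sm_der_comp _ _ (flat m) (fun x => flat m.+2 x + - m%:R * flat m.+1 x) Hf) => [|z _].
    apply: (@sm_add _ (fun z => flat m.+2 (f z)) (fun z => - m%:R * flat m.+1 (f z))).
      exact: sm_flat.
    by apply: (@sm_mul _ (fun=> _)); [exact: sm_cst|exact: sm_flat].
  by rewrite mulNr; exact: is_derive_flat.
- apply: (@sm_der_comp _ _ th (fun x => c * (flat 0 (x + 1) * flat 0 (- x))) Hf _ (fun z _ => dth (f z))).
  apply: (@sm_mul _ (fun=> c)); first exact: sm_cst.
  apply: (@sm_mul _ (fun z => flat 0 (f z + 1)) (fun z => flat 0 (- f z))).
    by apply: (@sm_flat _ _ (fun z => f z + 1)); apply: sm_add => //; exact: sm_cst.
  apply: (@sm_flat _ _ (fun z => - f z)); rewrite (_ : (fun z => _) = (fun z => -1 * f z)).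
    by apply: sm_mul => //; exact: sm_cst.
  by apply/funext => z; rewrite mulN1r.
- by apply: (@sm_der_comp _ _ k th Hf _ (fun z _ => dk (f z))); exact: (@sm_prim1 _ th c).
Qed.

(** A bump that is constant near a pole, or a function on the torus read through local
    representatives, has no single formula; one formula near each point is enough for [Ck]. *)
Definition locally_sm (A : set (R * R)) f := forall z, A z ->
  exists O, [/\ open O, O z & exists2 g, sm O g & forall w, O w -> f w = g w].

Lemma locally_sm_der A f : locally_sm A f ->
  [/\ forall z, A z -> {for z, continuous f}, 
     forall z, A z -> derivable f z ((1, 0) : R * R) /\ derivable f z ((0, 1) : R * R),
     locally_sm A (ddx f) & locally_sm A (ddy f)].
Proof.
move=> sf; split => z Az; have [U [oO Oz [g /smP [gx [gy [sx sy dg]]] fg]]] := sf z Az.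
- have [cg _ _] := dg z Oz; rewrite /prop_for /continuous_at (fg _ Oz).
  apply: cvg_trans cg; apply: near_eq_cvg.
  by apply: filterS (open_near oO Oz) => w Uw; rewrite fg.
- have gf : \forall w \near z, g w = f w.
    by apply: filterS (open_near oO Oz) => w Uw; rewrite fg.
  have [_ [dx _] [dy _]] := dg z Oz.
  by split; [exact: (near_eq_derivable gf dx)|exact: (near_eq_derivable gf dy)].
- exists U; split => //; exists gx => // w Ow; have [_ [_ <-] _] := dg w Ow.
  by apply: near_eq_derive; apply: filterS (open_near oO Ow) => t Ut; rewrite fg.
- exists U; split => //; exists gy => // w Ow; have [_ _ [_ <-]] := dg w Ow.
  by apply: near_eq_derive; apply: filterS (open_near oO Ow) => t Ut; rewrite fg.
Qed.

Lemma locally_sm_Ck A f k : locally_sm A f -> Ck k A f.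
Proof.
elim: k f => [|k IH] f /locally_sm_der[cf df dx dy]; split => //.
by split=> //; split; exact: IH.
Qed.

Lemma sm_locally O f : open O -> sm O f -> locally_sm O f.
Proof. by move=> oO sf z Oz; exists O; split => //; exists f. Qed.

(** The integral starts at -oo. It converges because on ]-oo, u] the function is supported in the
    compact interval [a, u]. *)
Lemma antiderivative (f : R -> R) a : continuous f -> (forall x, x <= a -> f x = 0) ->
  exists F, (forall x, is_derive x 1 F (f x)) /\ forall x, x <= a -> F x = 0.
Proof.
move=> cf f0; pose mu := @lebesgue_measure R.
pose F (x : R) := (\int[mu]_(t in [set` `]-oo, x]]) (f t))%R.
have Fi u : mu.-integrable [set` `]-oo, u]] (EFin \o f).
  have := @continuous_compact_integrable R f `[a, u] (@segment_compact _ _ _) (continuous_subspaceT cf).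
  move=> fi; apply: (@eq_integrable _ _ _ mu _ _ (EFin \o (f \_ `[a, u]))) => //.
    move=> x /[!inE]/=; rewrite in_itv/= => xu; rewrite patchE; case: ifPn => //.
    rewrite notin_setE/= in_itv/= xu andbT => /negP; rewrite -ltNge => xa.
    by rewrite f0// ltW.
  rewrite -restrict_EFin; apply/integrable_restrict => //; rewrite setIC setIidl//.
  by move=> x /=; rewrite !in_itv/= => /andP[].
exists F; split => x.
  have xx1 : x < x + 1 by rewrite ltrDl.
  have Nyx : ((BInfty R true) < (BRight x))%E by rewrite ltNyr.
  have [d1 d2] := @continuous_FTC1 R f (BInfty R true) x (x + 1) xx1 (Fi _) Nyx (cf x).
  by rewrite derive1E in d2; split; [exact: d1|exact: d2].
move=> xa; rewrite /F (_ : Rintegral _ _ _ = Rintegral mu [set` `]-oo, x]] (fun=> 0)).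
  by rewrite Rintegral_cst// mul0r.
by apply: eq_Rintegral => t /[!inE]/=; rewrite in_itv/= => tx; rewrite f0// (le_trans tx).
Qed.

Lemma cst_of_derive0 (f f' : R -> R) (a b : R) : a <= b -> (forall x, is_derive x 1 f (f' x)) ->
  (forall x, a < x < b -> f' x = 0) -> f a = f b.
Proof.
move=> ab df f'0.
rewrite le_eqVlt in ab; case/orP : ab => [/eqP -> //|ab].
have cf : {within `[a, b], continuous f}.
  apply: continuous_subspaceT => x.
  by apply/differentiable_continuous/derivable1_diffP; case: (df x).
have [c] := MVT ab (fun x _ => df x) cf.
by rewrite in_itv/= => /f'0 -> /eqP; rewrite mul0r subr_eq0 => /eqP.
Qed.

(** k is a smooth convex substitute for a maximum: its slope [th] climbs from 0 to 1 across [-1, 0].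
    Convexity, that is the sign of the bump k'', is what makes the weights positive later on. *)
Lemma cut_off : exists (k th : R -> R) (c : R), [/\
  (forall x, is_derive x 1 k (th x)),
  (forall x, is_derive x 1 th (c * (flat 0 (x + 1) * flat 0 (- x)))),
  0 < c,
  (forall x, 0 <= x -> k x = x) &
  (forall x, x <= -1 -> k x = k (-1))].
Proof.
pose b x := flat 0 (x + 1) * flat 0 (- x).
have cfl m : continuous (flat m).
  move=> x; apply/differentiable_continuous/derivable1_diffP.
  by case: (is_derive_flat m x).
have cb : continuous b.
  move=> x; apply: (@continuousM _ _ (fun x => flat 0 (x + 1)) (fun x => flat 0 (- x)) x).
    apply: (@continuous_comp _ _ _ (fun x => x + 1) (flat 0)); last exact: cfl.
    by apply: cvgD; [exact: cvg_id|exact: cvg_cst].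
  apply: (@continuous_comp _ _ _ (fun x => - x) (flat 0)); last exact: cfl.
  exact: opp_continuous.
have b0 x : x <= -1 -> b x = 0.
  by move=> x1; rewrite /b flat_le0 ?mul0r// -lerBrDr sub0r.
have b1 x : 0 <= x -> b x = 0.
  by move=> x0; rewrite /b [X in _ * X]flat_le0 ?mulr0// oppr_le0.
have [th0 [dth0 th00]] := antiderivative cb b0.
have cth0 : continuous th0.
  by move=> x; apply/differentiable_continuous/derivable1_diffP; case: (dth0 x).
have th0_gt0 : 0 < th0 0.
  have [c] := @MVT R th0 b (-1) 0 (ltrN10 _) (fun x _ => dth0 x) (continuous_subspaceT cth0).
  rewrite in_itv/= => /andP[c1 c0]; rewrite (th00 (-1))// subr0 opprK add0r mulr1 => ->.
  by rewrite /b mulr_gt0// flat_gt0// ?oppr_gt0// -ltrBlDr sub0r.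
(* The mass of the bump is 1/c, so that [th] is exactly 1 from 0 on. *)
pose c := (th0 0)^-1; pose th x := c * th0 x.
have dth x : is_derive x 1 th (c * b x).
  exact: is_deriveZ (dth0 x).
have cth : continuous th.
  by move=> x; apply/differentiable_continuous/derivable1_diffP; case: (dth x).
have th_0 x : x <= -1 -> th x = 0 by move=> x1; rewrite /th th00// mulr0.
have th_1 x : 0 <= x -> th x = 1.
  move=> x0; rewrite -(@cst_of_derive0 th (fun x => c * b x) 0 x)//.
    by rewrite /th /c mulVf// gt_eqF.
  by move=> y /andP[y0 _]; rewrite b1 ?mulr0// ltW.
have [k0 [dk0 k00]] := antiderivative cth th_0.
pose k x := k0 x - k0 0.
have dk x : is_derive x 1 k (th x).
  by have := @is_deriveB _ _ _ k0 (cst (k0 0)) x 1 _ _ (dk0 x) (is_derive_cst _ _ _); rewrite subr0.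
exists k, th, c; split => //.
- by rewrite invr_gt0.
- move=> x x0.
  have dkx y : is_derive y 1 (fun y => k y - y) (th y - 1).
    exact: (is_deriveB (dk y) (is_derive_id _ _)).
  have th1 y : 0 < y < x -> th y - 1 = 0 by move=> /andP[y0 _]; rewrite th_1 ?subrr// ltW.
  have := cst_of_derive0 x0 dkx th1; rewrite /= subr0 /k subrr => /esym/eqP.
  by rewrite subr_eq0 => /eqP.
- by move=> x x1; rewrite /k (k00 x)// (k00 (-1)).
Qed.

End smooth_functions.

(** * Polar coordinates *)

Section change_of_variables.
Local Open Scope ereal_scope.

Section transfer.
Context d1 d2 d (T1 : measurableType d1) (T2 : measurableType d2) (T : measurableType d) (R : realType).
Variables (m1 : {measure set T1 -> \bar R}) (m2 : {measure set T2 -> \bar R}).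
Variables (D1 : set T1) (D2 : set T2) (p1 : T1 -> T) (p2 : T2 -> T) (w1 : T1 -> R) (w2 : T2 -> R).
Hypotheses (mD1 : measurable D1) (mD2 : measurable D2).
Hypotheses (mp1 : measurable_fun setT p1) (mp2 : measurable_fun setT p2).
Hypotheses (mw1 : measurable_fun setT w1) (mw2 : measurable_fun setT w2).
Hypotheses (w1_ge0 : forall x, (0 <= w1 x)%R) (w2_ge0 : forall x, (0 <= w2 x)%R).

Import HBNNSimple.

(** The hypothesis says that two weighted images of measures agree on measurable sets. Simple
    functions and monotone convergence extend this to f, and each side is handled by the same
    formula [step]. *)
Lemma ge0_integral_transfer :
  (forall A, measurable A -> \int[m1]_(x in D1) ((\1_A (p1 x))%:E * (w1 x)%:E) =
                             \int[m2]_(x in D2) ((\1_A (p2 x))%:E * (w2 x)%:E)) ->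
  forall f : T -> \bar R, measurable_fun setT f -> (forall x, 0 <= f x) ->
  \int[m1]_(x in D1) (f (p1 x) * (w1 x)%:E) = \int[m2]_(x in D2) (f (p2 x) * (w2 x)%:E).
Proof.
move=> H f mf f0.
pose g := nnsfun_approx measurableT mf.
have step d' (U : measurableType d') (m : {measure set U -> \bar R}) (D : set U) (p : U -> T) (w : U -> R) :
    measurable D -> measurable_fun setT p -> measurable_fun setT w -> (forall x, 0 <= w x)%R ->
    \int[m]_(x in D) (f (p x) * (w x)%:E) =
    limn (fun n => \sum_(r \in range (g n)) (r%:E * \int[m]_(x in D) ((\1_(g n @^-1` [set r]) (p x))%:E * (w x)%:E))).
  move=> mD mp mw w0.
  have mgp n : measurable_fun setT (fun x => (g n (p x))%:E).
    by apply/measurable_EFinP; apply: measurableT_comp.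
  transitivity (limn (fun n => \int[m]_(x in D) ((g n (p x))%:E * (w x)%:E))).
    rewrite -monotone_convergence//.
    - apply: eq_integral => x _; apply/esym/cvg_lim => //.
      by apply: cvgeZr => //; exact: cvg_nnsfun_approx.
    - move=> n; apply: measurable_funTS; by apply: emeasurable_funM => //; exact/measurable_EFinP.
    - by move=> n x _; rewrite mule_ge0 ?lee_fin.
    - move=> x _ a b ab; rewrite lee_wpmul2r ?lee_fin//.
      by move: (nd_nnsfun_approx measurableT mf ab) => /lefP; apply.
  congr (lim (_ @ \oo)); apply/funext => n.
  have mi r : measurable_fun setT (fun x => (\1_(g n @^-1` [set r]) (p x))%:E * (w x)%:E).
    apply: emeasurable_funM => //; apply/measurable_EFinP => //.
    by apply: measurableT_comp => //; exact: measurable_indic.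
  transitivity (\int[m]_(x in D) \sum_(r \in range (g n)) (r%:E * ((\1_(g n @^-1` [set r]) (p x))%:E * (w x)%:E))).
    apply: eq_integral => x _; rewrite [in LHS](fimfunE (g n) (p x)).
    rewrite -fsumEFin// ge0_mule_fsuml; last first.
      by move=> r; rewrite EFinM; exact: nnfun_muleindic_ge0.
    by apply: eq_fsbigr => r _; rewrite EFinM muleA.
  rewrite ge0_integral_fsum//.
  - apply: eq_fsbigr => r; rewrite inE => -[y _ <-].
    rewrite ge0_integralZl//; first exact: measurable_funTS.
    + by move=> x _; rewrite mule_ge0 ?lee_fin.
    + by rewrite lee_fin.
  - move=> r; apply: measurable_funTS; apply: emeasurable_funM => //; exact: mi.
  - by move=> r x _; rewrite muleA mule_ge0 ?lee_fin// -lee_fin EFinM; exact: nnfun_muleindic_ge0.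
rewrite (step _ _ m1 D1)// (step _ _ m2 D2)//.
congr (lim (_ @ \oo)); apply/funext => n; apply: eq_fsbigr => r _; congr (_ * _).
by apply: H.
Qed.

End transfer.


Section substitution.
Context (R : realType).
Local Notation mu := (@lebesgue_measure R).
Variables (phi dphi : R -> R).
Hypothesis phi_inc : {homo phi : x y / (x < y)%R}.
Hypothesis phi_der : forall x : R, is_derive x (1%R : R) phi (dphi x).
Hypothesis dphi_cont : continuous dphi.
Hypothesis dphi_ge0 : forall x, (0 <= dphi x)%R.

Let phi_le : {mono phi : x y / (x <= y)%R}.
Proof. exact: le_mono. Qed.

Let phi_lt : {mono phi : x y / (x < y)%R}.
Proof. by move=> x y; rewrite !ltNge phi_le. Qed.

Let phi_cont : continuous phi.
Proof.
by move=> x; apply/differentiable_continuous/derivable1_diffP; case: (phi_der x).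
Qed.

Let mphi : measurable_fun setT phi.
Proof. exact: continuous_measurable_fun. Qed.

Let mdphi : measurable_fun setT dphi.
Proof. exact: continuous_measurable_fun. Qed.

Let integral_dphi a b : (a <= b)%R ->
  \int[mu]_(x in `[a, b]) (dphi x)%:E = (phi b - phi a)%:E.
Proof.
rewrite le_eqVlt => /orP[/eqP <-|ab]; first by rewrite set_itv1 integral_set1 subrr.
rewrite (@continuous_FTC2 _ dphi phi)//.
- exact: continuous_subspaceT.
- split.
  + by move=> x _; case: (phi_der x).
  + by apply: cvg_at_right_filter; exact: phi_cont.
  + by apply: cvg_at_left_filter; exact: phi_cont.
- by move=> x _; rewrite derive1E; case: (phi_der x).
Qed.

Let mpre (B : set (measurableTypeR R)) :
  measurable B -> measurable (phi @^-1` B : set (measurableTypeR R)).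
Proof. by move=> mB; rewrite -[X in measurable X]setTI; exact: mphi. Qed.

(** The left side is a measure in A carried by I = [phi p, phi q]. Adding to it Lebesgue measure
    outside I gives a measure on the whole line that agrees with Lebesgue measure on half-open
    intervals, so uniqueness applies. *)
Let integral_dphi_itv p q (A : set (measurableTypeR R)) : (p <= q)%R -> measurable A ->
  \int[mu]_(x in `[p, q] `&` phi @^-1` A) (dphi x)%:E =
  mu (A `&` `[phi p, phi q]).
Proof.
move=> pq mA; set I := (X in _ = mu (_ `&` X)).
pose nun (B : set (measurableTypeR R)) : \bar R :=
  \int[mu]_(x in `[p, q] `&` phi @^-1` B) (dphi x)%:E.
have nun0 : nun set0 = 0 by rewrite /nun preimage_set0 setI0 integral_set0.
have nun_ge0 B : 0 <= nun B by apply: integral_ge0 => x _; rewrite lee_fin.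
have nun_sigma : semi_sigma_additive nun.
  move=> /= F mF tF mUF; rewrite /nun; apply: cvg_toP.
    apply: ereal_nondecreasing_is_cvgn => i j ij.
    by apply: lee_sum_nneg_natr => // k _ _; exact: nun_ge0.
  rewrite preimage_bigcup setI_bigcupr ge0_integral_bigcup//=.
  - by move=> k; apply: measurableI; [exact: measurable_itv|exact: mpre].
  - exact/measurable_EFinP/measurable_funTS.
  - by move=> x _; rewrite lee_fin.
  - apply/trivIsetP => i j _ _ ij; move/trivIsetP : tF => /(_ i j Logic.I Logic.I ij) Fij.
    apply/seteqP; split => // x [[_ xi] [_ xj]].
    by have : (F i `&` F j) (phi x) by []; rewrite Fij.
pose nunm : {measure set (measurableTypeR R) -> \bar R} :=
  HB.pack nun (isMeasure.Build _ _ _ nun nun0 nun_ge0 nun_sigma).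
have mI : measurable (~` I : set (measurableTypeR R)).
  by apply: measurableC; exact: measurable_itv.
pose m2 : {measure set (measurableTypeR R) -> \bar R} := mrestr mu mI.
pose m : {measure set (measurableTypeR R) -> \bar R} := measure_add nunm m2.
have mE B : m B = nunm B + m2 B by exact: measure_addE.
have phin : (phi p <= phi q)%R by rewrite phi_le.
(* The ends of a half-open interval are moved into I, where the intermediate value theorem gives
   them preimages in [p, q]. *)
pose clamp t := Num.min (Num.max t (phi p)) (phi q).
have /boolp.choice[cl clP] : forall t : R, exists c : R, (p <= c <= q)%R /\ phi c = clamp t.
  move=> t.
  have [||c] := @IVT _ phi p q (clamp t) pq.
  - exact: continuous_subspaceT.
  - rewrite (min_l phin) (max_r phin) /clamp le_min le_max lexx orbT phin/=.
    by rewrite ge_min lexx orbT.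
  - by rewrite in_itv/=; exists c.
have key X : ocitv X -> mu X = m X.
  move=> /ocitvP[->|[[a b]/= ab ->]]; first by rewrite !measure0.
  have [/andP[pa aq] ca] := clP a; have [/andP[pb bq] cb] := clP b.
  have clab : (cl a <= cl b)%R.
    by rewrite -phi_le ca cb /clamp le_min !ge_min ge_max !le_max (ltW ab) !lexx !orbT.
  rewrite mE [X in _ = _ + X](_ : _ = mu (`]a, b] `&` ~` I))//.
  have mab : measurable (`]a, b]%classic : set (measurableTypeR R)) by exact: measurable_itv.
  have mII : measurable (I : set (measurableTypeR R)) by exact: measurable_itv.
  have {1}-> : `]a, b]%classic = (`]a, b] `&` I) `|` (`]a, b] `&` ~` I) :> set (measurableTypeR R).
    by rewrite -setIUr setUCr setIT.
  rewrite measureU; [|exact: measurableI|exact: measurableI|]; last first.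
    by rewrite setIACA setICr setI0.
  congr (_ + _).
  have E1 : mu (`]a, b] `&` I) = (phi (cl b) - phi (cl a))%:E.
    apply/eqP; rewrite eq_le; apply/andP; split.
      apply: (@le_trans _ _ (mu `[phi (cl a), phi (cl b)]%classic)).
        apply: le_measure; rewrite ?inE//; [exact: measurableI|].
        move=> y [/=]; rewrite /I/= !in_itv/= ca cb /clamp => /andP[ay yb] /andP[py yq].
        by rewrite ge_min le_min ge_max le_max py yq yb (ltW ay)/= ?orbT.
      rewrite lebesgue_measure_itv/= lte_fin; case: ifPn => // _.
      by rewrite lee_fin subr_ge0 phi_le.
    apply: (@le_trans _ _ (mu `]phi (cl a), phi (cl b)]%classic)).
      rewrite lebesgue_measure_itv/= lte_fin; case: ifPn => // H.
      by rewrite lee_fin subr_le0 leNgt.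
    apply: le_measure; rewrite ?inE//; [exact: measurableI|].
    move=> y /=; rewrite in_itv/= => /andP[y1 y2].
    have Iy : I y by rewrite /I/= in_itv/= (ltW (le_lt_trans _ y1)) ?(le_trans y2)// phi_le.
    split => //; move: Iy; rewrite /I/= !in_itv/= => /andP[py yq].
    move: y1 y2; rewrite ca cb /clamp gt_min gt_max le_min le_max.
    rewrite (ltNge (phi q)) yq orbF => /andP[ay py'] /andP[/orP[yb _|yp _]]; first by rewrite ay yb.
    by move: py'; rewrite ltNge yp.
  transitivity (phi (cl b) - phi (cl a))%:E; first exact: E1.
  rewrite -integral_dphi// /nunm/= /nun; apply/eqP; rewrite eq_le; apply/andP; split.
    rewrite -integral_itv_obnd_cbnd; last exact/measurable_EFinP/measurable_funTS.
    apply: ge0_subset_integral => //.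
    - by apply: measurableI; [exact: measurable_itv|exact: mpre].
    - exact/measurable_EFinP/measurable_funTS.
    - by move=> x _; rewrite lee_fin.
    move=> x /=; rewrite in_itv/= => /andP[x1 x2].
    have px : (p <= x)%R by rewrite (le_trans pa)// ltW.
    have xq : (x <= q)%R by rewrite (le_trans x2).
    have y1 : (phi (cl a) < phi x)%R by rewrite phi_lt.
    have y2 : (phi x <= phi (cl b))%R by rewrite phi_le.
    have qx : (phi q < phi x)%R = false by rewrite phi_lt ltNge xq.
    split; first by rewrite /= in_itv/= px xq.
    move: y1 y2; rewrite ca cb /clamp /= in_itv/= gt_min gt_max le_min le_max qx orbF.
    move=> /andP[ay py'] /andP[/orP[yb _|yp _]]; first by rewrite ay yb.
    by move: py'; rewrite ltNge yp.
  apply: ge0_subset_integral => //.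
  - by apply: measurableI; [exact: measurable_itv|exact: mpre].
  - exact/measurable_EFinP/measurable_funTS.
  - by move=> x _; rewrite lee_fin.
  move=> x [/=]; rewrite !in_itv/= => /andP[px xq] /andP[ay yb].
  have py : (phi p <= phi x)%R by rewrite phi_le.
  have yq : (phi x <= phi q)%R by rewrite phi_le.
  rewrite -(phi_le (cl a) x) -(phi_le x (cl b)) ca cb /clamp.
  by rewrite ge_min le_min ge_max le_max py yq yb (ltW ay)/= ?orbT.
have := lebesgue_measure_unique key (measurableI _ _ mA (measurableC mI)).
rewrite mE [X in _ = _ + X](_ : _ = mu ((A `&` ~` ~` I) `&` ~` I))//.
rewrite setCK -setIA setICr setI0 measure0 adde0 => ->.
rewrite /nunm/= /nun; congr (integral _ _ _); apply/seteqP; split => x /=.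
  move=> [/[dup] xpq]; rewrite in_itv/= => /andP[px xq] Ax; split => //; split => //.
  by rewrite /I/= in_itv/= !phi_le px xq.
by move=> [xpq [Ax _]].
Qed.

(** Transfer reduces the claim to sets, and [-n, n] exhausts the line. The right side runs over
    [range phi] because the substitutions used later, [expR] and [atan], are not onto. *)
Lemma ge0_integral_substitution (f : R -> \bar R) : measurable_fun setT f ->
  (forall x, 0 <= f x) ->
  \int[mu]_x (f (phi x) * (dphi x)%:E) = \int[mu]_(x in range phi) f x.
Proof.
move=> mf f0.
have rE : range phi = \bigcup_n `[phi (- n%:R)%R, phi (n%:R)%R]%classic.
  apply/seteqP; split => y.
    move=> [x _ <-]; exists (Num.Def.archi_bound `|x|) => //=.
    have := archi_boundP (normr_ge0 x); rewrite ltr_norml => /andP[x1 x2].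
    by rewrite in_itv/= !phi_le (ltW x1) (ltW x2).
  move=> [n _]/=; rewrite in_itv/= => /andP[y1 y2].
  have nn : (- n%:R <= n%:R :> R)%R by rewrite (@le_trans _ _ 0%R)// oppr_le0.
  have [||c] := @IVT _ phi _ _ y nn.
  - exact: continuous_subspaceT.
  - by rewrite min_l ?max_r ?phi_le// y1 y2.
  - by move=> _ <-; exists c.
have mr : measurable (range phi) by rewrite rE; apply: bigcup_measurable.
have := @ge0_integral_transfer _ _ _ _ _ _ R mu mu setT (range phi) phi id dphi (fun=> 1%R).
move=> -> //.
  by apply: eq_integral => x _; rewrite mule1.
move=> A mA.
transitivity (mu (A `&` range phi)); last first.
  under eq_integral do rewrite mule1.
  by rewrite integral_indic// setIC.
transitivity (\int[mu]_(x in phi @^-1` A) (dphi x)%:E).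
  rewrite [RHS]integral_mkcond; apply: eq_integral => x _.
  by rewrite epatch_indic/= muleC !indicE.
rewrite rE setI_bigcupr.
have -> : phi @^-1` A = \bigcup_n (`[(- n%:R)%R, n%:R%R]%classic `&` phi @^-1` A).
  rewrite -setI_bigcupl (_ : \bigcup_n _ = setT) ?setTI//.
  apply/seteqP; split => // x _; exists (Num.Def.archi_bound `|x|) => //=.
  have := archi_boundP (normr_ge0 x); rewrite ltr_norml => /andP[x1 x2].
  by rewrite in_itv/= (ltW x1) (ltW x2).
have itvS m n : (m <= n)%N -> (`[(- m%:R)%R, m%:R%R]%classic : set R) `<=` `[(- n%:R)%R, n%:R%R]%classic.
  move=> mn x /=; rewrite !in_itv/= => /andP[x1 x2]; rewrite (le_trans _ x1) ?(le_trans x2)//.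
    by rewrite ler_nat.
  by rewrite lerN2 ler_nat.
have E n : \int[mu]_(x in `[(- n%:R)%R, n%:R%R] `&` phi @^-1` A) (dphi x)%:E =
  mu (A `&` `[phi (- n%:R)%R, phi n%:R%R]).
  by apply: integral_dphi_itv => //; rewrite (@le_trans _ _ 0%R)// oppr_le0.
have c1 : \int[mu]_(x in `[(- n%:R)%R, n%:R%R] `&` phi @^-1` A) (dphi x)%:E @[n --> \oo] -->
    \int[mu]_(x in \bigcup_n (`[(- n%:R)%R, n%:R%R] `&` phi @^-1` A)) (dphi x)%:E.
  apply: ge0_nondecreasing_set_cvg_integral.
  + move=> m n mn; apply/subsetPset; apply: setSI; exact: itvS.
  + by move=> n; apply: measurableI; [exact: measurable_itv|exact: mpre].
  + by move=> n; exact/measurable_EFinP/measurable_funTS.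
  + by move=> n x _; rewrite lee_fin.
have c2 : (mu \o (fun n => A `&` `[phi (- n%:R)%R, phi n%:R%R])) n @[n --> \oo] -->
    mu (\bigcup_n (A `&` `[phi (- n%:R)%R, phi n%:R%R])).
  apply: nondecreasing_cvg_mu.
  + by move=> n; apply: measurableI => //; exact: measurable_itv.
  + by apply: bigcup_measurable => n _; apply: measurableI => //; exact: measurable_itv.
  + move=> m n mn; apply/subsetPset; apply: setIS => x /=; rewrite !in_itv/= => /andP[x1 x2].
    rewrite (le_trans _ x1) ?(le_trans x2)// phi_le ?ler_nat//.
    by rewrite lerN2 ler_nat.
rewrite -(cvg_lim _ c1)// -(cvg_lim _ c2)//.
by congr (lim (_ @ \oo)); apply/funext => n; exact: E.
Qed.

End substitution.

Section polar.
Context (R : realType).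
Local Notation mu := (@lebesgue_measure R).
Implicit Types (f : R -> \bar R).

Lemma ge0_integral_exp f : measurable_fun setT f -> (forall x, 0 <= f x) ->
  \int[mu]_(x in `]0%R, +oo[) f x = \int[mu]_x (f (expR x) * (expR x)%:E).
Proof.
move=> mf f0; rewrite (@ge0_integral_substitution _ (@expR R) (@expR R))//.
- congr (integral _ _ _); apply/seteqP; split => x /=.
    by rewrite in_itv/= andbT => x0; exists (ln x) => //; rewrite lnK ?posrE.
  by move=> [y _ <-]; rewrite in_itv/= expR_gt0.
- by move=> x y; rewrite ltr_expR.
- by move=> x; exact: continuous_expR.
Qed.

Lemma ge0_integral_shift f c : measurable_fun setT f -> (forall x, 0 <= f x) ->
  \int[mu]_x f (x + c)%R = \int[mu]_x f x.
Proof.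
move=> mf f0.
have h1 : {homo (fun x : R => x + c)%R : x y / (x < y)%R} by move=> x y; rewrite ltrD2r.
have h2 x : is_derive x (1%R : R) (fun x : R => x + c)%R 1%R.
  apply: is_derive_eq (is_deriveD (is_derive_id _ _) (is_derive_cst _ _ _)) _.
  by rewrite addr0.
have h3 : continuous (fun _ : R => 1%R : R) by move=> x; exact: cvg_cst.
have := ge0_integral_substitution h1 h2 h3 (fun=> ler01) mf f0.
have -> : range (fun x : R => x + c)%R = setT.
  by apply/seteqP; split => // y _; exists (y - c)%R => //; rewrite subrK.
by move=> H; rewrite -H; apply: eq_integral => x _; rewrite mule1.
Qed.

Lemma ge0_integral_opp f : measurable_fun setT f -> (forall x, 0 <= f x) ->
  \int[mu]_x f (- x)%R = \int[mu]_x f x.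
Proof.
move=> mf f0.
have mN : measurable_fun setT (-%R : measurableTypeR R -> measurableTypeR R).
  by apply: continuous_measurable_fun; exact: opp_continuous.
have := @ge0_integral_pushforward _ _ _ _ R _ mN mu setT f measurableT mf (fun x _ => f0 x).
rewrite preimage_setT => <-; apply: eq_measure_integral => A mA _; apply/esym.
apply: (@lebesgue_measure_unique R _ _ A mA) => X.
move=> /ocitvP[->|[[a b]/= ab ->]]; first by rewrite !measure0.
rewrite /pushforward (_ : _ @^-1` _ = `[(- b)%R, (- a)%R[%classic); last first.
  by apply/seteqP; split => x /=; rewrite !in_itv/= => /andP[]; lra.
by rewrite !lebesgue_measure_itv/= !lte_fin ltrN2 ab -!EFinB opprK addrC.
Qed.

Lemma measurable_invr : measurable_fun setT (GRing.inv : measurableTypeR R -> measurableTypeR R).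
Proof.
have m0 : measurable ([set 0%R] : set (measurableTypeR R)) by exact: measurable_set1.
rewrite -(setUv [set (0%R : R)]); apply/measurable_funU => //; first exact: measurableC.
split; first exact: measurable_fun_set1.
apply: open_continuous_measurable_fun.
  by rewrite openC; apply: accessible_closed_set1; apply: hausdorff_accessible; exact: Rhausdorff.
by move=> x; rewrite inE/= => x0; apply: inv_continuous; exact/eqP.
Qed.

(** [tan] is not defined on the whole line, so the substitution is made in the opposite direction,
    with Y |-> atan (Y / X). *)
Lemma ge0_integral_tan f (X : R) : (0 < X)%R -> measurable_fun setT f -> (forall x, 0 <= f x) ->
  \int[mu]_x f x = \int[mu]_(y in `](- (pi / 2))%R, (pi / 2)%R[)
    (f (X * tan y)%R * (X * (cos y ^+ 2)^-1)%:E).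
Proof.
move=> X0 mf f0.
have mcos : measurable_fun setT (@cos R) by apply: continuous_measurable_fun; exact: continuous_cos.
have mtan : measurable_fun setT (@tan R).
  by apply: measurable_funM; [apply: continuous_measurable_fun; exact: continuous_sin|exact: (measurableT_comp measurable_invr)].
pose g y := f (X * tan y)%R * (X * (cos y ^+ 2)^-1)%:E.
have mg : measurable_fun setT g.
  apply: emeasurable_funM.
    by apply: measurableT_comp => //; apply: measurable_funM.
  apply/measurable_EFinP; apply: measurable_funM => //.
  by apply: (measurableT_comp measurable_invr); apply: measurable_funX.
have g0 y : 0 <= g y.
  by rewrite mule_ge0 ?lee_fin// mulr_ge0 ?(ltW X0)// invr_ge0 sqr_ge0.
have h1 : {homo (fun Y : R => atan (Y / X))%R : x y / (x < y)%R}.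
  by move=> x y xy; apply: lt_atan; rewrite ltr_pM2r// invr_gt0.
have h2 (Y : R) : is_derive Y (1%R : R) (fun Y : R => atan (Y / X)) ((1 + (Y / X) ^+ 2)^-1 * X^-1)%R.
  apply: (@is_derive1_comp _ (@atan R) (fun Y => Y / X)%R Y _ _ (is_derive1_atan _) _).
  apply: is_derive_eq (is_deriveM (is_derive_id _ _) (is_derive_cst _ _ _)) _.
  by rewrite scaler0 add0r -[LHS]/(_ * _)%R mulr1.
have h3 : continuous (fun Y : R => (1 + (Y / X) ^+ 2)^-1 * X^-1)%R.
  move=> Y; apply: cvgM; last exact: cvg_cst.
  apply: cvgV; first by rewrite gt_eqF// ltr_pwDl// sqr_ge0.
  apply: cvgD; first exact: cvg_cst.
  apply: (@continuous_comp _ _ _ (fun Y : R => Y / X)%R (fun y : R => y ^+ 2)%R); last exact: exprn_continuous.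
  by apply: cvgM; [exact: cvg_id|exact: cvg_cst].
have h4 (Y : R) : (0 <= (1 + (Y / X) ^+ 2)^-1 * X^-1)%R.
  by rewrite mulr_ge0 ?invr_ge0 ?(ltW X0)// addr_ge0// sqr_ge0.
have := ge0_integral_substitution h1 h2 h3 h4 mg g0.
have -> : range (fun Y : R => atan (Y / X)) = `](- (pi / 2))%R, (pi / 2)%R[%classic.
  apply/seteqP; split => y /=.
    by move=> [x _ <-]; rewrite in_itv/= atan_gtNpi2 atan_ltpi2.
  move=> yI; exists (X * tan y)%R => //.
  by rewrite mulrAC mulfV ?mul1r ?gt_eqF// tanK.
move=> H; rewrite -H; apply: eq_integral => Y _; rewrite /g atanK.
have cn0 : cos (atan (Y / X)) != 0%R.
  by rewrite gt_eqF// cos_gt0_pihalf// atan_gtNpi2 atan_ltpi2.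
rewrite (cos2_tan2 cn0) atanK -muleA -EFinM mulrCA mulfV ?gt_eqF// mulr1.
rewrite -invfM [(_ * X)%R]mulrC mulfV ?mule1// mulf_neq0 ?gt_eqF//.
by rewrite ltr_pwDl// sqr_ge0.
Qed.

(** Polar coordinates in a half plane by substitutions in one variable only: the abscissa becomes
    e^x, the ordinate becomes e^x tan y at fixed x, and after Fubini x is translated at fixed y. *)
Let half (f : R * R -> \bar R) :
  measurable_fun (setT : set (measurableTypeR R * measurableTypeR R)) f -> (forall z, 0 <= f z) ->
  \int[mu]_(x in `]0%R, +oo[) \int[mu]_y f (x, y) =
  \int[mu]_(y in `](- (pi / 2))%R, (pi / 2)%R[) \int[mu]_x (f (cexp (x, y)) * (expR x ^+ 2)%:E).
Proof.
move=> mf f0.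
have mexp : measurable_fun setT (@expR R) by exact: measurable_expR.
have mcos : measurable_fun setT (@cos R) by apply: continuous_measurable_fun; exact: continuous_cos.
have msin : measurable_fun setT (@sin R) by apply: continuous_measurable_fun; exact: continuous_sin.
have mF : measurable_fun setT (fun x : R => \int[mu]_y f (x, y)).
  have := @measurable_fun_fubini_tonelli_F _ _ _ _ R mu f mf f0; exact.
rewrite ge0_integral_exp//; last by move=> x; exact: integral_ge0.
have msec a : measurable_fun setT (fun y : R => f (a, y)).
  exact: (measurable_fun_pair2 a mf).
have mtan : measurable_fun setT (@tan R).
  by apply: measurable_funM => //; exact: (measurableT_comp measurable_invr).
have mG : measurable_fun (setT : set (measurableTypeR R * measurableTypeR R)) (fun z =>
    f (expR z.1, expR z.1 * tan z.2)%R *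
    (expR z.1 ^+ 2 * (cos z.2 ^+ 2)^-1 * \1_(`](- (pi / 2))%R, (pi / 2)%R[%classic) z.2)%:E).
  have m1 : measurable_fun (setT : set (measurableTypeR R * measurableTypeR R)) (fun z => expR z.1).
    by apply: measurableT_comp => //; exact: measurable_fst.
  apply: emeasurable_funM.
    apply: (measurableT_comp mf); apply: measurable_fun_pair => //.
    by apply: measurable_funM => //; apply: measurableT_comp => //; exact: measurable_snd.
  apply/measurable_EFinP; apply: measurable_funM.
    apply: measurable_funM; first exact: measurable_funX.
    apply: (measurableT_comp measurable_invr); apply: measurable_funX.
    by apply: measurableT_comp => //; exact: measurable_snd.
  have mi : measurable_fun setT (\1_(`](- (pi / 2))%R, (pi / 2)%R[%classic) : measurableTypeR R -> R).
    by apply: measurable_indic; exact: measurable_itv.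
  exact: (measurableT_comp mi measurable_snd).
transitivity (\int[mu]_x \int[mu]_y (f (expR x, expR x * tan y)%R *
   (expR x ^+ 2 * (cos y ^+ 2)^-1 * \1_(`](- (pi / 2))%R, (pi / 2)%R[%classic) y)%:E)).
  apply: eq_integral => x _; rewrite (ge0_integral_tan (expR_gt0 x))//.
  rewrite -ge0_integralZr//.
  - rewrite [LHS]integral_mkcond; apply: eq_integral => y _; rewrite epatch_indic/=.
    by rewrite -!muleA; congr (_ * _); rewrite -!EFinM; congr (_%:E); rewrite expr2; ring.
  - apply: measurable_funTS; apply: emeasurable_funM.
      by apply: (measurableT_comp (msec (expR x))); apply: measurable_funM.
    apply/measurable_EFinP; apply: measurable_funM => //.
    by apply: (measurableT_comp measurable_invr); exact: measurable_funX.
  - move=> y _; rewrite mule_ge0 ?lee_fin// mulr_ge0 ?expR_ge0// invr_ge0 sqr_ge0.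
  - by rewrite ?lee_fin ?expR_ge0.
rewrite (@fubini_tonelli _ _ _ _ _ mu mu _ mG)/=; last first.
  move=> z; rewrite mule_ge0 ?lee_fin// !mulr_ge0 ?invr_ge0 ?sqr_ge0// indicE; by case: (_ \in _).
rewrite [RHS]integral_mkcond; apply: eq_integral => y _.
rewrite patchE; case: ifPn => yI; last first.
  rewrite (eq_integral (fun=> 0)) ?integral0// => x _.
  by rewrite indicE (negbTE yI) mulr0 mule0.
have cy : (0 < cos y)%R by move: yI; rewrite inE/= in_itv/=; exact: cos_gt0_pihalf.
pose h x := f (expR x, expR x * tan y)%R * (expR x ^+ 2 * (cos y ^+ 2)^-1)%:E.
transitivity (\int[mu]_x h x).
  by apply: eq_integral => x _; rewrite indicE yI mulr1.
(* This translation turns (e^x, e^x tan y) into (e^x cos y, e^x sin y), and its square cancels the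
   factor 1 / cos^2 y. *)
rewrite -(@ge0_integral_shift h (ln (cos y))).
- apply: eq_integral => x _; rewrite /h expRD lnK ?posrE// /cexp/=.
  congr (f (_, _) * _%:E).
    by rewrite /tan -mulrA (mulrC (cos y)) mulfVK// gt_eqF.
  by rewrite exprMn mulfK// expf_neq0// gt_eqF.
- apply: emeasurable_funM.
    apply: (measurableT_comp mf); apply: measurable_fun_pair => //.
    exact: measurable_funM.
  by apply/measurable_EFinP; apply: measurable_funM => //; exact: measurable_funX.
- by move=> x; rewrite mule_ge0 ?lee_fin// mulr_ge0 ?invr_ge0 ?sqr_ge0.
Qed.




Lemma ge0_integral_shift_itv f a b c : measurable_fun setT f -> (forall x, 0 <= f x) ->
  \int[mu]_(x in `[a, b[) f (x + c)%R = \int[mu]_(x in `[(a + c)%R, (b + c)%R[) f x.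
Proof.
move=> mf f0; rewrite [LHS]integral_mkcond [RHS]integral_mkcond.
rewrite -[RHS](@ge0_integral_shift _ c).
- apply: eq_integral => x _; rewrite !patchE; congr (if _ then _ else _).
  by apply/idP/idP; rewrite !inE/= !in_itv/= lerD2r ltrD2r.
- by apply/(measurable_restrictT _ (measurable_itv _)); exact: measurable_funTS.
- by move=> x; rewrite patchE; case: ifP.
Qed.

(** The window is moved by the largest multiple of p not exceeding b - a, which changes nothing, and
    then by a remainder in [0, p], which only cuts off a piece on the left and glues it on the
    right. *)
Lemma ge0_integral_period f p a b : (0 < p)%R -> (forall x, f (x + p)%R = f x) ->
  measurable_fun setT f -> (forall x, 0 <= f x) ->
  \int[mu]_(x in `[a, (a + p)%R[) f x = \int[mu]_(x in `[b, (b + p)%R[) f x.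
Proof.
move=> p0 fp mf f0.
have fz (m : int) x : f (x + m%:~R * p)%R = f x.
  have fn (n : nat) y : f (y + n%:R * p)%R = f y.
    by elim: n y => [|n IH] y; rewrite ?mul0r ?addr0// -natr1 mulrDl mul1r addrA fp.
  case: m => n; first exact: fn.
  by rewrite NegzE mulrNz mulNr -[in RHS](subrK (n.+1%:R * p)%R x) fn.
have split_itv u v w : (u <= v)%R -> (v <= w)%R ->
    \int[mu]_(x in `[u, w[) f x = \int[mu]_(x in `[u, v[) f x + \int[mu]_(x in `[v, w[) f x.
  move=> uv vw; rewrite -ge0_integral_setU//.
  - congr (integral _ _ _); apply/seteqP; split => x /=; rewrite !in_itv/=.
      by move=> /andP[-> ->]; rewrite andbT; case: (ltP x v); [left|right].
    move=> [/andP[-> xv]|/andP[vx ->]]; first by rewrite (lt_le_trans xv).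
    by rewrite (le_trans uv).
  - exact: measurable_funTS.
  - apply/disj_setPS => x [/=]; rewrite !in_itv/= => /andP[_ xv] /andP[vx _].
    by move: xv; rewrite ltNge vx.
have near_case u c : (0 <= c <= p)%R ->
    \int[mu]_(x in `[u, (u + p)%R[) f x = \int[mu]_(x in `[(u + c)%R, (u + c + p)%R[) f x.
  move=> /andP[c0 cp].
  rewrite (@split_itv u (u + c)%R)//; [|by rewrite lerDl|by rewrite lerD2l].
  rewrite [RHS](@split_itv (u + c)%R (u + p)%R (u + c + p)%R); [|by rewrite lerD2l|by rewrite [leRHS]addrAC lerDl].
  rewrite addeC; congr (_ + _).
  rewrite (_ : (u + c + p = u + p + c)%R); last by rewrite addrAC.
  rewrite (addrAC u p c) -ge0_integral_shift_itv//.
  by apply: eq_integral => x _; rewrite fp.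
have shift_case u (m : int) : \int[mu]_(x in `[u, (u + p)%R[) f x =
    \int[mu]_(x in `[(u + m%:~R * p)%R, (u + m%:~R * p + p)%R[) f x.
  rewrite (addrAC u _ p) -ge0_integral_shift_itv//.
  by apply: eq_integral => x _; rewrite fz.
pose m := Num.floor ((b - a) / p).
have /andP[m1 m2] : (m%:~R * p <= b - a < (m + 1)%:~R * p)%R.
  by rewrite -ler_pdivlMr// -ltr_pdivrMr// ge_floor/= floorD1_gt.
rewrite (shift_case a m) (@near_case _ (b - a - m%:~R * p)%R).
  by rewrite (_ : a + m%:~R * p + (b - a - m%:~R * p) = b)%R//; ring.
by move: m1 m2; rewrite intrD mulrDl mul1r; lra.
Qed.

Lemma cexpDpi (x y : R) : cexp (x, y + pi)%R = (- (cexp (x, y)).1, - (cexp (x, y)).2)%R.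
Proof. by rewrite /cexp/= cosDpi sinDpi !mulrN. Qed.

(** The left half plane is the image of the right one under Z |-> - Z, that is under a rotation by
    pi. The radial variable is the logarithm of the radius, hence the Jacobian e^(2 x) of [cexp]. *)
Lemma ge0_integral_polar (f : R * R -> \bar R) (a : R) :
  measurable_fun (setT : set (measurableTypeR R * measurableTypeR R)) f -> (forall z, 0 <= f z) ->
  \int[@area R]_z f z =
  \int[mu]_(y in `[a, (a + 2 * pi)%R[) \int[mu]_x (f (cexp (x, y)) * (expR x ^+ 2)%:E).
Proof.
move=> mf f0; rewrite /area fubini_tonelli1//.
pose N (z : R * R) : R * R := (- z.1, - z.2)%R.
have mN : measurable_fun (setT : set (measurableTypeR R * measurableTypeR R))
    (N : _ -> measurableTypeR R * measurableTypeR R).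
  apply: measurable_fun_pair; apply: measurableT_comp; [|exact: measurable_fst| |exact: measurable_snd];
  by apply: continuous_measurable_fun; exact: opp_continuous.
have mfN : measurable_fun (setT : set (measurableTypeR R * measurableTypeR R)) (fun z => f (N z)).
  exact: (measurableT_comp mf mN).
pose H y := \int[mu]_x (f (cexp (x, y)) * (expR x ^+ 2)%:E).
have mpol : measurable_fun (setT : set (measurableTypeR R * measurableTypeR R))
    (fun z => f (cexp z) * (expR z.1 ^+ 2)%:E).
  have mexp : measurable_fun (setT : set (measurableTypeR R * measurableTypeR R)) (fun z => expR z.1).
    by apply: measurableT_comp; [exact: measurable_expR|exact: measurable_fst].
  apply: emeasurable_funM; last by apply/measurable_EFinP; exact: measurable_funX.
  apply: (measurableT_comp mf); apply: measurable_fun_pair; apply: measurable_funM => //;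
  by apply: measurableT_comp; [apply: continuous_measurable_fun; first [exact: continuous_cos|exact: continuous_sin]|exact: measurable_snd].
have pol0 z : 0 <= f (cexp z) * (expR z.1 ^+ 2)%:E by rewrite mule_ge0// lee_fin sqr_ge0.
have mH : measurable_fun setT H.
  by have := @measurable_fun_fubini_tonelli_G _ _ _ _ R mu _ mpol pol0; exact.
have H0 y : 0 <= H y by apply: integral_ge0 => x _; exact: (pol0 (x, y)).
have per y : H (y + 2 * pi)%R = H y.
  apply: eq_integral => x _; rewrite mulr_natl mulr2n addrA !cexpDpi/=.
  by rewrite !opprK /cexp.
(* The window [- pi / 2, 3 pi / 2[ splits at pi / 2 into the angles of the two half planes. *)
rewrite -[RHS](@ge0_integral_period H (2 * pi)%R (- (pi / 2))%R) ?mulr_gt0 ?pi_gt0//.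
pose G (x : R) := \int[mu]_y f (x, y).
have mG : measurable_fun setT G.
  by have := @measurable_fun_fubini_tonelli_F _ _ _ _ R mu f mf f0; exact.
have G0 x : 0 <= G x by exact: integral_ge0.
transitivity (\int[mu]_x G x); first by [].
have -> : [set: measurableTypeR R] = `]-oo, 0%R] `|` `]0%R, +oo[ :> set (measurableTypeR R).
  apply/seteqP; split => // x _ /=; rewrite !in_itv/= andbT.
  by case: (leP x 0%R); [left|right].
rewrite ge0_integral_setU//; [|exact: measurable_funTS|]; last first.
  apply/disj_setPS => x [/=]; rewrite !in_itv/= andbT => x1 x2.
  by move: x2; rewrite ltNge x1.
rewrite [X in _ + X](half mf f0).
have -> : \int[mu]_(x in `]-oo, 0%R]) G x = \int[mu]_(x in `]0%R, +oo[) \int[mu]_y f (N (x, y)).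
  rewrite -integral_itv_bndo_bndc; last exact: measurable_funTS.
  rewrite [LHS]integral_mkcond [RHS]integral_mkcond -[LHS]ge0_integral_opp.
  - apply: eq_integral => x _; rewrite !patchE; congr (if _ then _ else _).
      by apply/idP/idP; rewrite !inE/= !in_itv/= andbT oppr_lt0.
    rewrite /G -ge0_integral_opp//; exact: (measurable_fun_pair2 _ mf).
  - by apply/(measurable_restrictT _ (measurable_itv _)); exact: measurable_funTS.
  - by move=> x; rewrite patchE; case: ifP.
rewrite (half mfN (fun z => f0 (N z))).
have mHN : \int[mu]_(y in `](- (pi / 2))%R, (pi / 2)%R[) \int[mu]_x (f (N (cexp (x, y))) * (expR x ^+ 2)%:E) =
    \int[mu]_(y in `[(pi / 2)%R, (pi / 2 + pi)%R[) H y.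
  have pE : (- (pi / 2) + pi)%R = (pi / 2)%R :> R by field.
  transitivity (\int[mu]_(y in `[(- (pi / 2) + pi)%R, (pi / 2 + pi)%R[) H y); last by rewrite pE.
  rewrite -(ge0_integral_shift_itv _ _ _ mH H0) -(@integral_itv_obnd_cbnd R).
    by apply: eq_integral => y _; apply: eq_integral => x _; rewrite cexpDpi.
  apply: measurable_funTS; apply: measurableT_comp => //.
  by apply: measurable_funD => //; exact: measurable_cst.
rewrite mHN integral_itv_obnd_cbnd; last exact: measurable_funTS.
rewrite addeC -ge0_integral_setU; [|exact: measurable_itv|exact: measurable_itv|exact: measurable_funTS| |].
- congr (integral _ _ _); apply/seteqP; split => x /=; rewrite !in_itv/=.
  + by have := @pi_gt0 R; move=> ? [/andP[]|/andP[]]; lra.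
  + move=> /andP[x1 x2]; case: (ltP x (pi / 2)%R) => x3; [left; rewrite x1|right].
      by [].
    by rewrite /=; move: x2; lra.
- by move=> x _; exact: H0.
- apply/disj_setPS => x [/=]; rewrite !in_itv/= => /andP[_ xv] /andP[vx _].
  by move: xv; rewrite ltNge vx.
Qed.

End polar.
End change_of_variables.

(** * Measurability of open sets and semicontinuous functions in the plane *)

Section plane_measurable.
Variable R : realType.
Local Notation pT := (plane_mT R).

(** The plane carries the product sigma-algebra, so an open set is written as a countable union of
    boxes with rational corners. *)
Lemma open_measurable_plane (U : set (R * R)) : open U -> measurable (U : set pT).
Proof.
move=> oU.
pose box (q : (rat * rat) * (rat * rat)) : set pT :=
  `]ratr q.1.1, ratr q.1.2[%classic `*` `]ratr q.2.1, ratr q.2.2[%classic.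
have -> : U = \bigcup_q (if `[< box q `<=` U >] then box q else set0).
  apply/seteqP; split=> z; last by move=> [q _]; case: asboolP => // h; exact: h.
  move=> Uz; have /nbhs_ballP[e /= e0 He] : nbhs z U by apply: open_nbhs_nbhs.
  have [a /[!in_itv]/= /andP[a1 a2]] : exists a, ratr a \in `]z.1 - e, z.1[.
    by apply: rat_in_itvoo; rewrite ltrBlDr ltrDl.
  have [b /[!in_itv]/= /andP[b1 b2]] : exists a, ratr a \in `]z.1, z.1 + e[.
    by apply: rat_in_itvoo; rewrite ltrDl.
  have [c /[!in_itv]/= /andP[c1 c2]] : exists a, ratr a \in `]z.2 - e, z.2[.
    by apply: rat_in_itvoo; rewrite ltrBlDr ltrDl.
  have [d /[!in_itv]/= /andP[d1 d2]] : exists a, ratr a \in `]z.2, z.2 + e[.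
    by apply: rat_in_itvoo; rewrite ltrDl.
  exists ((a, b), (c, d)) => //; case: asboolP => [_|[]].
    by split; rewrite /= in_itv/=; apply/andP.
  move=> w [/=]; rewrite !in_itv/= => /andP[w1 w2] /andP[w3 w4].
  apply: He; split; rewrite /ball/= ltr_norml; apply/andP; lra.
apply: countable_bigcupT_measurable => [|q]; first exact: countableP.
case: ifP => _; last exact: measurable0.
by apply: measurableX; exact: measurable_itv.
Qed.

Lemma continuous_measurable_plane (A D : set (R * R)) (f : R * R -> R) : open A -> D `<=` A ->
  (forall z, A z -> {for z, continuous f}) -> measurable_fun (D : set pT) (f : _ -> measurableTypeR R).
Proof.
move=> oA DA cf; apply: (@measurable_funS _ _ _ _ (A : set pT)) => //.
  exact: open_measurable_plane.
move=> mA; apply: (measurability _ (RGenOInfty.measurableE R)) => //.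
move=> /= _ [_ [x ->] <-]; apply: open_measurable_plane.
rewrite openE => z [Az fz]; have cz := cf z Az.
apply: filterI; first exact: open_nbhs_nbhs.
by apply: cz; apply: open_nbhs_nbhs; split => //; exact: interval_open.
Qed.

Lemma lsc_measurable_plane (f : R * R -> \bar R) :
  lower_semicontinuous f -> measurable_fun (setT : set pT) f.
Proof.
move=> scif; apply: (measurability _ (ErealGenOInfty.measurableE R)).
move=> /= _ [_ [a ->]] <-; apply: measurableI => //; apply: open_measurable_plane.
by rewrite preimage_itvoy; move/lower_semicontinuousP : scif; exact.
Qed.

Lemma lsc_comp (X Y : topologicalType) (f : Y -> \bar R) (h : X -> Y) :
  continuous h -> lower_semicontinuous f -> lower_semicontinuous (f \o h).
Proof.
move=> ch lf x a /lf[U nU HU]; exists (h @^-1` U) => [|y]; [exact: ch|exact: HU].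
Qed.

End plane_measurable.

(** Subharmonic functions are bounded above locally but may be -oo. Passing to the defect C - v
    makes all integrands nonnegative, and the identity also holds when the integral of v is -oo. *)
Lemma integral_defect d (T : measurableType d) (R : realType) (mu : {measure set T -> \bar R})
    (D : set T) (M C : R) (v : T -> \bar R) : measurable D -> mu D = M%:E ->
  measurable_fun D v -> (forall x, D x -> (v x <= C%:E)%E) ->
  (\int[mu]_(x in D) v x = (C * M)%:E - \int[mu]_(x in D) maxe 0 (C%:E - v x))%E.
Proof.
move=> mD muD mv vC.
have icst (c : R) : mu.-integrable D (cst c%:E).
  apply/integrableP; split; first exact: measurable_cst.
  by rewrite (eq_integral (cst `|c|%:E))// integral_cst// muD -EFinM ltry.
have fE x : D x -> maxe 0%E (C%:E - v x)%E = (C%:E - v x)%E.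
  by move=> Dx; apply/max_idPr; rewrite sube_ge0 ?orbT// vC.
rewrite [in RHS](eq_integral (fun x => (C%:E - v x)%E)); last by move=> x /[!inE] Dx; exact: fE.
have f0 x : D x -> (0 <= C%:E - v x)%E by move=> Dx; rewrite -fE// le_max lexx.
have mf : measurable_fun D (fun x => C%:E - v x)%E.
  by apply: emeasurable_funB => //; exact: measurable_cst.
have vpos : (\int[mu]_(x in D) v^\+ x < +oo)%E.
  apply: (@le_lt_trans _ _ (\int[mu]_(x in D) (Num.max C 0)%:E)%E).
    apply: ge0_le_integral => //.
    - exact: measurable_funepos.
    - by move=> x Dx; rewrite funeposE EFin_max le_max2// vC.
  by rewrite integral_cst// muD -EFinM ltry.
have [vneg|] := boolP (\int[mu]_(x in D) v^\- x < +oo)%E.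
  have iv : mu.-integrable D v.
    apply/integrableP; split => //.
    rewrite (eq_integral (fun x => v^\+ x + v^\- x)%E); last first.
      by move=> x _; have := congr1 (@^~ x) (fune_abse v).
    rewrite (ge0_integralD mu mD (fun x _ => funepos_ge0 v x) (measurable_funepos mv)
      (fun x _ => funeneg_ge0 v x) (measurable_funeneg mv)).
    exact: lte_add_pinfty.
  have -> : (\int[mu]_(x in D) (C%:E - v x) = \int[mu]_(x in D) cst C%:E x - \int[mu]_(x in D) v x)%E.
    exact: (integralB mD (icst C) iv).
  rewrite integral_cst// muD -EFinM; have := integrable_fin_num mD iv.
  by case: (integral _ _ _) => // r _; rewrite -!EFinB opprB addrCA subrr addr0.
rewrite -leNgt leye_eq => /eqP vneg.
have -> : (\int[mu]_(x in D) (C%:E - v x) = +oo)%E.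
  apply/eqP; rewrite -leye_eq; apply/negPn/negP; rewrite -ltNge => fin.
  have : (\int[mu]_(x in D) v^\- x < +oo)%E; last by rewrite vneg.
  apply: (@le_lt_trans _ _ (\int[mu]_(x in D) (C%:E - v x + `|C|%:E))%E).
    apply: ge0_le_integral => //.
    - exact: measurable_funeneg.
    - by apply: emeasurable_funD => //; exact: measurable_cst.
    - move=> x Dx; rewrite funenegE ge_max; apply/andP; split; last first.
        by apply: adde_ge0; [exact: f0|rewrite lee_fin].
      rewrite addeAC -EFinD leeDr// lee_fin.
      by have := ler_norm (- C); rewrite normrN; lra.
  rewrite ge0_integralD//.
  by rewrite lte_add_pinfty// integral_cst// muD -EFinM ltry.
by rewrite integralE vneg addeNy addeNy.
Qed.

(** * Mean values over circles and annuli *)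

Section mean_values.
Variable R : realType.
Local Notation mu := (@lebesgue_measure R).
Local Notation pT := (plane_mT R).
Local Open Scope ereal_scope.

Definition sqd (v w : R * R) : R := ((v.1 - w.1) ^+ 2 + (v.2 - w.2) ^+ 2)%R.

Lemma sqd_ge0 v w : (0 <= sqd v w)%R.
Proof. by rewrite addr_ge0// sqr_ge0. Qed.

Lemma sqd_circle Z r t : sqd (circle Z r t) Z = (r ^+ 2)%R.
Proof.
rewrite /sqd /circle/=; have := cos2Dsin2 t; move: (cos t) (sin t) => c s cs.
by transitivity (r ^+ 2 * (c ^+ 2 + s ^+ 2))%R; [ring|rewrite cs mulr1].
Qed.

Lemma circleDpi (Z : R * R) r t : circle Z r (t + pi)%R = ((Z.1 - r * cos t)%R, (Z.2 - r * sin t)%R).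
Proof. by rewrite /circle cosDpi sinDpi !mulrN. Qed.

Lemma circleD2pi (Z : R * R) r t : circle Z r (t + 2 * pi)%R = circle Z r t.
Proof. by rewrite mulr_natl mulr2n addrA /circle !cosDpi !sinDpi !opprK. Qed.

Lemma continuous_circle Z r : continuous (circle Z r : R -> R * R).
Proof.
move=> t.
have c (a : R) (h : R -> R) : continuous h -> {for t, continuous (fun t => a + r * h t)%R}.
  by move=> ch; apply: cvgD; [exact: cvg_cst|apply: cvgM; [exact: cvg_cst|exact: ch]].
exact: (cvg_pair (c Z.1 _ (@continuous_cos R)) (c Z.2 _ (@continuous_sin R))).
Qed.

Lemma measurable_circle Z : measurable_fun (setT : set (measurableTypeR R * measurableTypeR R))
  (fun x => circle Z (expR x.1) x.2 : pT).
Proof.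
have mexp : measurable_fun (setT : set (measurableTypeR R * measurableTypeR R)) (fun z => expR z.1).
  by apply: measurableT_comp; [exact: measurable_expR|exact: measurable_fst].
apply: measurable_fun_pair; apply: measurable_funD; try exact: measurable_cst;
  apply: measurable_funM => //; apply: measurableT_comp; try exact: measurable_snd;
  apply: continuous_measurable_fun; [exact: continuous_cos|exact: continuous_sin].
Qed.

Lemma ge0_integral_plane_shift (f : pT -> \bar R) (Z : R * R) : measurable_fun setT f ->
  (forall z, 0 <= f z) -> \int[@area R]_z f z = \int[@area R]_z f (z.1 + Z.1, z.2 + Z.2)%R.
Proof.
move=> mf f0.
have ms : measurable_fun (setT : set pT) (fun z : pT => (z.1 + Z.1, z.2 + Z.2)%R : pT).
  apply: measurable_fun_pair; apply: measurable_funD => //; exact: measurable_cst.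
have mfs : measurable_fun setT (fun z : pT => f (z.1 + Z.1, z.2 + Z.2)%R).
  exact: (measurableT_comp mf ms).
rewrite /area !fubini_tonelli1//= /fubini_F/=.
have mF : measurable_fun setT (fun x => \int[mu]_y f (x, y)).
  by have := @measurable_fun_fubini_tonelli_F _ _ _ _ R mu f mf f0; exact.
have F0 x : 0 <= \int[mu]_y f (x, y) by exact: integral_ge0.
rewrite -(ge0_integral_shift Z.1 mF F0); apply: eq_integral => x _.
rewrite (@ge0_integral_shift R (fun y => f (x + Z.1, y)%R))//.
exact: (measurable_fun_pair2 _ mf).
Qed.

Variable beta : R -> R.
Hypothesis cbeta : continuous beta.
Hypothesis beta0 : forall x, (0 <= beta x)%R.

Let mbeta : measurable_fun setT (beta : measurableTypeR R -> measurableTypeR R).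
Proof. exact: continuous_measurable_fun. Qed.

(** For beta = k'' this is the Laplacian in v of k(ln |v - Z|^2 - l): the logarithm is harmonic off
    Z and the square of its gradient is 4 / |v - Z|^2. *)
Definition kernel (l : R) (Z v : R * R) : R :=
  (4 * beta (ln (sqd v Z) - l) / sqd v Z)%R.

Lemma kernel_ge0 l Z v : (0 <= kernel l Z v)%R.
Proof. by rewrite /kernel mulr_ge0 ?mulr_ge0// invr_ge0 sqd_ge0. Qed.

Lemma measurable_sqd Z : measurable_fun (setT : set pT) (sqd ^~ Z : pT -> measurableTypeR R).
Proof.
apply: measurable_funD; apply: measurable_funX; apply: measurable_funB => //;
  exact: measurable_cst.
Qed.

Lemma measurable_kernel l Z : measurable_fun (setT : set pT) (kernel l Z : pT -> measurableTypeR R).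
Proof.
apply: measurable_funM; last exact: (measurableT_comp (@measurable_invr R) (measurable_sqd Z)).
apply: measurable_funM; first exact: measurable_cst.
apply: (measurableT_comp mbeta); apply: measurable_funB; last exact: measurable_cst.
exact: (measurableT_comp (@measurable_ln R) (measurable_sqd Z)).
Qed.

(** The integral of f against [kernel] in polar coordinates about Z, with radius e^x: the Jacobian
    e^(2 x) cancels the denominator |v - Z|^2. *)
Definition annular (l : R) (f : R * R -> \bar R) (Z : R * R) : \bar R :=
  \int[mu]_x (\int[mu]_(t in `[0%R, (2 * pi)%R[) f (circle Z (expR x) t) * (4 * beta (2 * x - l))%:E).

(** Both sides are the same integral over the plane, in polar coordinates about the origin on the
    left and, after a translation, about Z on the right. *)
Lemma annular_polar l (f : R * R -> \bar R) Z (a : R) :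
  measurable_fun (setT : set pT) f -> (forall z, 0 <= f z) ->
  \int[mu]_(y in `[a, (a + 2 * pi)%R[) \int[mu]_x
    (f (cexp (x, y)) * (kernel l Z (cexp (x, y)) * expR x ^+ 2)%:E) = annular l f Z.
Proof.
move=> mf f0.
have mfk : measurable_fun (setT : set pT) (fun v => f v * (kernel l Z v)%:E).
  by apply: emeasurable_funM => //; apply/measurable_EFinP; exact: measurable_kernel.
have fk0 v : 0 <= f v * (kernel l Z v)%:E by rewrite mule_ge0// lee_fin kernel_ge0.
transitivity (\int[@area R]_v (f v * (kernel l Z v)%:E)).
  rewrite (ge0_integral_polar a mfk fk0); apply: eq_integral => y _.
  by apply: eq_integral => x _; rewrite EFinM muleA.
rewrite (ge0_integral_plane_shift Z mfk fk0).
have mfk' : measurable_fun (setT : set pT) (fun v : pT => f (v.1 + Z.1, v.2 + Z.2)%R * (kernel l Z (v.1 + Z.1, v.2 + Z.2)%R)%:E).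
  have ms : measurable_fun (setT : set pT) (fun z : pT => (z.1 + Z.1, z.2 + Z.2)%R : pT).
    apply: measurable_fun_pair; apply: measurable_funD => //; exact: measurable_cst.
  exact: (measurableT_comp mfk ms).
rewrite (ge0_integral_polar 0%R mfk')//.
rewrite add0r /annular.
have mG : measurable_fun (setT : set (measurableTypeR R * measurableTypeR R))
    (fun x => f (circle Z (expR x.1) x.2) * (4 * beta (2 * x.1 - l))%:E).
  apply: emeasurable_funM; first exact: (measurableT_comp mf (measurable_circle Z)).
  apply/measurable_EFinP; apply: measurable_funM; first exact: measurable_cst.
  apply: (measurableT_comp mbeta); apply: measurable_funB; last exact: measurable_cst.
  by apply: measurable_funM; [exact: measurable_cst|exact: measurable_fst].
pose G (x : R * R) := f (circle Z (expR x.1) x.2) * (4 * beta (2 * x.1 - l))%:E * (\1_(`[0%R, (2 * pi)%R[%classic : set R) x.2)%:E.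
have mGG : measurable_fun (setT : set (measurableTypeR R * measurableTypeR R)) G.
  apply: emeasurable_funM => //; apply/measurable_EFinP.
  have mi : measurable_fun setT (\1_(`[0%R, (2 * pi)%R[%classic : set R) : measurableTypeR R -> R).
    by apply: measurable_indic; exact: measurable_itv.
  exact: (measurableT_comp mi measurable_snd).
have GG0 x : 0 <= G x.
  by rewrite /G; apply: mule_ge0; rewrite ?lee_fin ?indicE//; apply: mule_ge0; rewrite ?lee_fin ?mulr_ge0.
transitivity (\int[mu]_y \int[mu]_x G (x, y)).
  rewrite [LHS]integral_mkcond epatch_indic; apply: eq_integral => y _.
  transitivity (\int[mu]_x (f (circle Z (expR x) y) * (4 * beta (2 * x - l))%:E) *
    (\1_(`[0%R, (2 * pi)%R[%classic : set R) y)%:E); last first.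
    rewrite /G/= indicE; case: (_ \in _); last by rewrite mule0; under eq_integral do rewrite mule0; rewrite integral0.
    by rewrite mule1; apply: eq_integral => x _; rewrite mule1.
  congr (_ * _); apply: eq_integral => x _; rewrite /kernel -muleA -EFinM /cexp/=.
  have -> : ((expR x * cos y + Z.1)%R, (expR x * sin y + Z.2)%R) = circle Z (expR x) y.
    by rewrite /circle !(addrC (_ * _)%R).
  rewrite sqd_circle lnXn ?expR_gt0// expRK -(mulr_natl x 2) mulfVK//.
  by rewrite expf_neq0// gt_eqF// expR_gt0.
have := @fubini_tonelli _ _ _ _ R mu mu G mGG GG0 => <-.
apply: eq_integral => x _.
have mc : measurable_fun setT (fun t : R => f (circle Z (expR x) t)).
  exact: (measurable_fun_pair2 x (measurableT_comp mf (measurable_circle Z))).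
rewrite -ge0_integralZr//.
- by rewrite [RHS]integral_mkcond epatch_indic.
- exact: measurable_funTS.
- by rewrite lee_fin mulr_ge0.
Qed.

(** A change of l rescales the annulus, which is a translation of the radial variable, so the total
    weight does not depend on l. The angular factor 2 pi is left out. *)
Definition mass : \bar R := \int[mu]_x (4 * beta (2 * x))%:E.

Let m4beta (l : R) : measurable_fun setT (fun x : measurableTypeR R => (4 * beta (2 * x - l))%:E).
Proof.
apply/measurable_EFinP; apply: measurable_funM; first exact: measurable_cst.
apply: (measurableT_comp mbeta); apply: measurable_funB; last exact: measurable_cst.
by apply: measurable_funM; first exact: measurable_cst.
Qed.

Lemma mass_shift (l : R) : \int[mu]_x (4 * beta (2 * x - l))%:E = mass.
Proof.
rewrite /mass -(@ge0_integral_shift R (fun x => (4 * beta (2 * x - l))%:E) (l / 2)%R (m4beta l)); last by move=> x; rewrite lee_fin mulr_ge0.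
by apply: eq_integral => x _; congr (4 * beta _)%:E; rewrite mulrDr mulrCA divff// mulr1 addrK.
Qed.

Let measurable_inner (f : R * R -> \bar R) Z : measurable_fun (setT : set pT) f -> (forall z, 0 <= f z) ->
  measurable_fun setT (fun x : measurableTypeR R => \int[mu]_(t in `[0%R, (2 * pi)%R[) f (circle Z (expR x) t)).
Proof.
move=> mf f0.
pose H (x : measurableTypeR R * measurableTypeR R) := f (circle Z (expR x.1) x.2) * (\1_(`[0%R, (2 * pi)%R[%classic : set R) x.2)%:E.
have mH : measurable_fun setT H.
  apply: emeasurable_funM; first exact: (measurableT_comp mf (measurable_circle Z)).
  apply/measurable_EFinP.
  have mi : measurable_fun setT (\1_(`[0%R, (2 * pi)%R[%classic : set R) : measurableTypeR R -> R).
    by apply: measurable_indic; exact: measurable_itv.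
  exact: (measurableT_comp mi measurable_snd).
have H0 x : 0 <= H x by rewrite mule_ge0// lee_fin indicE; case: (_ \in _).
rewrite (_ : (fun x => _) = (fun x => \int[mu]_t H (x, t))).
  by have := @measurable_fun_fubini_tonelli_F _ _ _ _ R mu H mH H0; exact.
apply/funext => x; rewrite integral_mkcond; apply: eq_integral => t _.
by rewrite epatch_indic.
Qed.

Lemma annular_le l (f : R * R -> \bar R) Z (a : \bar R) : 0 <= a ->
  measurable_fun (setT : set pT) f -> (forall z, 0 <= f z) ->
  (forall x, beta (2 * x - l)%R != 0%R -> \int[mu]_(t in `[0%R, (2 * pi)%R[) f (circle Z (expR x) t) <= a) ->
  annular l f Z <= a * mass.
Proof.
move=> a0 mf f0 fa; rewrite -(mass_shift l) -ge0_integralZl;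
  [|exact: measurableT|exact: m4beta|by move=> x _; rewrite lee_fin mulr_ge0|exact: a0].
apply: ge0_le_integral.
- exact: measurableT.
- by move=> x _; apply: mule_ge0; [exact: integral_ge0|rewrite lee_fin mulr_ge0].
- exact: emeasurable_funM (measurable_inner Z mf f0) (m4beta l).
- by apply: emeasurable_funM (m4beta l); exact: measurable_cst.
move=> x _; have [->|b0] := eqVneq (beta (2 * x - l)%R) 0%R; first by rewrite mulr0 !mule0.
by apply: lee_wpmul2r; [rewrite lee_fin mulr_ge0|exact: fa].
Qed.

Lemma annular_ge l (f : R * R -> \bar R) Z (a : R) : (0 <= a)%R ->
  measurable_fun (setT : set pT) f -> (forall z, 0 <= f z) ->
  (forall x, beta (2 * x - l)%R != 0%R -> a%:E <= \int[mu]_(t in `[0%R, (2 * pi)%R[) f (circle Z (expR x) t)) ->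
  a%:E * mass <= annular l f Z.
Proof.
move=> a0 mf f0 fa; rewrite -(mass_shift l) -ge0_integralZl;
  [|exact: measurableT|exact: m4beta|by move=> x _; rewrite lee_fin mulr_ge0|by rewrite lee_fin].
apply: ge0_le_integral.
- exact: measurableT.
- by move=> x _; rewrite mule_ge0// lee_fin// mulr_ge0.
- by apply: emeasurable_funM (m4beta l); exact: measurable_cst.
- exact: emeasurable_funM (measurable_inner Z mf f0) (m4beta l).
move=> x _; have [->|b0] := eqVneq (beta (2 * x - l)%R) 0%R; first by rewrite mulr0 !mule0.
by apply: lee_wpmul2r; [rewrite lee_fin mulr_ge0|exact: fa].
Qed.

Let mu2pi : mu (`[0%R, (2 * pi)%R[%classic : set R) = (2 * pi)%:E.
Proof.
by rewrite lebesgue_measure_itv/= lte_fin mulr_gt0 ?pi_gt0// sube0.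
Qed.

(** Adding the values at the antipodal points t and t + pi cancels the cross terms (parallelogram
    law), so that only a constant has to be integrated. *)
Lemma circle_mean_sqr Z r : \int[mu]_(t in `[0%R, (2 * pi)%R[) (sqd (circle Z r t) (0, 0)%R)%:E =
  (2 * pi * (sqd Z (0, 0)%R + r ^+ 2))%:E.
Proof.
pose f t := (sqd (circle Z r t) (0, 0)%R)%:E.
have mf : measurable_fun setT (f : measurableTypeR R -> _).
  apply/measurable_EFinP; apply: continuous_measurable_fun => t.
  have := @continuous_circle Z r t => /cvg_pair; rewrite /sqd => c.
  have c1 : {for t, continuous (fun t => (circle Z r t).1)}.
    by apply: (@continuous_comp _ _ _ (circle Z r) fst t); [exact: continuous_circle|exact: cvg_fst].
  have c2 : {for t, continuous (fun t => (circle Z r t).2)}.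
    by apply: (@continuous_comp _ _ _ (circle Z r) snd t); [exact: continuous_circle|exact: cvg_snd].
  have cs (h : R -> R) : {for t, continuous h} -> {for t, continuous (fun x => (h x - 0) ^+ 2)%R}.
    move=> ch; rewrite (_ : (fun x => _) = (fun x => h x * h x)%R); first exact: cvgM.
    by apply/funext => x; rewrite subr0 expr2.
  by apply: cvgD; exact: cs.
have f0 t : 0 <= f t by rewrite lee_fin sqd_ge0.
have mfp : measurable_fun setT (fun t : measurableTypeR R => f (t + pi)%R).
  by apply: (measurableT_comp mf); apply: measurable_funD => //; exact: measurable_cst.
have fper t : f (t + 2 * pi)%R = f t by rewrite /f circleD2pi.
have e1 : \int[mu]_(t in `[0%R, (2 * pi)%R[) f (t + pi)%R = \int[mu]_(t in `[0%R, (2 * pi)%R[) f t.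
  rewrite (ge0_integral_shift_itv _ _ _ mf f0) add0r addrC.
  have p0 : (0 < 2 * pi :> R)%R by rewrite mulr_gt0 ?pi_gt0.
  by rewrite (ge0_integral_period pi 0 p0 fper mf f0) add0r.
have mI : measurable (`[0%R, (2 * pi)%R[%classic : set (measurableTypeR R)) by exact: measurable_itv.
have e2 : \int[mu]_(t in `[0%R, (2 * pi)%R[) (f t + f (t + pi)%R) = (2 * (sqd Z (0, 0)%R + r ^+ 2) * (2 * pi))%:E.
  rewrite EFinM -mu2pi -(integral_cst mu mI).
  apply: eq_integral => t _; rewrite /f circleDpi -EFinD /cst; congr (_ %:E).
  rewrite /sqd/=; have := cos2Dsin2 t; move: (cos t) (sin t) => c s cs.
  transitivity (2 * (Z.1 ^+ 2 + Z.2 ^+ 2 + r ^+ 2 * (c ^+ 2 + s ^+ 2)))%R; first by ring.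
  by rewrite cs !subr0 mulr1.
move: e2; rewrite (ge0_integralD mu mI (fun t _ => f0 t) (measurable_funTS mf) (fun t _ => f0 _) (measurable_funTS mfp)).
rewrite e1 -/f; move: (\int[mu]_(t in `[0%R, (2 * pi)%R[) f t) => I.
case: I => [I| |]//; rewrite -EFinD => -[h]; congr (_ %:E); lra.
Qed.

(** The sub-mean value inequality rewritten for the nonnegative defect C - V, in which form it can
    be integrated over the radius without meeting oo - oo. *)
Lemma subharmonic_circle (V : R * R -> \bar R) (C : R) Z r : subharmonic V -> (0 < r)%R ->
  (forall t, V (circle Z r t) <= C%:E) ->
  V Z <= C%:E /\
  \int[mu]_(t in `[0%R, (2 * pi)%R[) (maxe 0 (C%:E - V (circle Z r t))) <= (2 * pi)%:E * (C%:E - V Z).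
Proof.
move=> [Vfin lV Vmean] r0 VC.
have p0 : (0 < 2 * pi :> R)%R by rewrite mulr_gt0 ?pi_gt0.
pose v t := V (circle Z r t).
have mv : measurable_fun setT (v : measurableTypeR R -> _).
  have h : measurable_fun setT (fun t : measurableTypeR R => - v t).
    by apply: lower_semicontinuous_measurable; apply: (lsc_comp (@continuous_circle Z r) lV).
  rewrite (_ : v = (fun t => - - v t)); last by apply/funext => t; rewrite oppeK.
  exact: measurableT_comp.
have mvI : measurable_fun (`[0%R, (2 * pi)%R[%classic : set (measurableTypeR R)) v by exact: measurable_funTS.
have := Vmean Z r r0.
rewrite /angles -(@integral_itv_bndo_bndc R); last by exact: mvI.
have mI : measurable (`[0%R, (2 * pi)%R[%classic : set (measurableTypeR R)) by exact: measurable_itv.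
rewrite (integral_defect mI mu2pi mvI (fun t _ => VC t)) -/v.
have J0 : 0 <= \int[mu]_(t in `[0%R, (2 * pi)%R[) maxe 0 (C%:E - v t).
  by apply: integral_ge0 => t _; rewrite le_max lexx.
move: J0 (Vfin Z); case: (integral _ _ _) => [J| |] // J0.
  case: (V Z) => [VZ| |]// _.
    rewrite -!EFinB -!EFinM !lee_fin => h.
    rewrite lee_fin in J0; move: h; rewrite mulrC ler_pdivlMr// => h.
    by split; [rewrite -(ler_pM2r p0)|]; lra.
  by move=> _; rewrite gt0_muley ?lte_fin// leNye leey.
rewrite addeNy gt0_muleNy ?lte_fin ?invr_gt0// leeNy_eq => _ /eqP ->.
by rewrite gt0_muley ?lte_fin// leNye leey.
Qed.

End mean_values.

(** * Calculus of C^k functions and of the Laplacian *)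

Section Ck_theory.
Variable R : realType.
Implicit Types (A : set (R * R)) (f g : R * R -> R).

Lemma Ck_continuous k A f : Ck k A f -> forall z, A z -> {for z, continuous f}.
Proof. by case: k => [|k] []. Qed.

Lemma Ck_is_derive k A f : Ck k.+1 A f -> forall z, A z ->
  is_derive z ((1, 0) : R * R) f (ddx f z) /\ is_derive z ((0, 1) : R * R) f (ddy f z).
Proof. by move=> [_ [df _]] z /df[dx dy]; split; split. Qed.

Lemma Ck_der k A f : Ck k.+1 A f -> Ck k A (ddx f) /\ Ck k A (ddy f).
Proof. by move=> [_ [_ []]]. Qed.

Lemma CkS k A f : (forall z, A z -> {for z, continuous f}) ->
  (forall z, A z -> derivable f z ((1, 0) : R * R) /\ derivable f z ((0, 1) : R * R)) ->
  Ck k A (ddx f) -> Ck k A (ddy f) -> Ck k.+1 A f.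
Proof. by []. Qed.

Lemma Ck_pred k A f : Ck k.+1 A f -> Ck k A f.
Proof.
elim: k f => [|k IH] f Cf; first by split => //; exact: (Ck_continuous Cf).
have [dx dy] := Ck_der Cf; apply: CkS.
- exact: (Ck_continuous Cf).
- by case: Cf => [_ []].
- exact: IH.
- exact: IH.
Qed.

Lemma Ck_subset k A B f : B `<=` A -> Ck k A f -> Ck k B f.
Proof.
move=> BA; elim: k f => [|k IH] f [cf]; first by move=> _; split => // z /BA /cf.
move=> [df [dx dy]]; split; first by move=> z /BA /cf.
by split; [move=> z /BA /df|split; exact: IH].
Qed.

Lemma Ck_ext k A f g : open A -> (forall z, A z -> f z = g z) -> Ck k A f -> Ck k A g.
Proof.
move=> oA; elim: k f g => [|k IH] f g fg.
  move=> [cf _]; split => // z Az; rewrite /prop_for /continuous_at -(fg _ Az).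
  apply: cvg_trans (cf z Az); apply: near_eq_cvg.
  by apply: filterS (open_near oA Az) => w Aw; rewrite fg.
move=> Cf; have [dx dy] := Ck_der Cf; have nfg z : A z -> \forall w \near z, f w = g w.
  by move=> Az; apply: filterS (open_near oA Az) => w Aw; rewrite fg.
apply: CkS.
- exact: Ck_continuous (IH f g fg (Ck_pred Cf)).
- move=> z Az; have [[d1 _] [d2 _]] := Ck_is_derive Cf Az.
  by split; [exact: near_eq_derivable (nfg z Az) d1|exact: near_eq_derivable (nfg z Az) d2].
- by apply: IH dx => z Az; exact: near_eq_derive (nfg z Az).
- by apply: IH dy => z Az; exact: near_eq_derive (nfg z Az).
Qed.

Lemma Ck_add k A f g : open A -> Ck k A f -> Ck k A g -> Ck k A (fun z => f z + g z).
Proof.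
move=> oA; elim: k f g => [|k IH] f g.
  by move=> [cf _] [cg _]; split => // z Az; apply: cvgD; [exact: cf|exact: cg].
move=> Cf Cg; split; first by move=> z Az; apply: cvgD; [exact: (Ck_continuous Cf)|exact: (Ck_continuous Cg)].
split; first by move=> z Az; have [? ?] := Ck_is_derive Cf Az; have [? ?] := Ck_is_derive Cg Az; split;
  apply: derivableD; apply: ex_derive.
have [fx fy] := Ck_der Cf; have [gx gy] := Ck_der Cg.
split; [apply: Ck_ext (IH _ _ fx gx) => // z Az|apply: Ck_ext (IH _ _ fy gy) => // z Az];
  have [? ?] := Ck_is_derive Cf Az; have [? ?] := Ck_is_derive Cg Az;
  by apply/esym; apply: derive_val.
Qed.

Lemma Ck_mul k A f g : open A -> Ck k A f -> Ck k A g -> Ck k A (fun z => f z * g z).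
Proof.
move=> oA; elim: k f g => [|k IH] f g.
  by move=> [cf _] [cg _]; split => // z Az; apply: cvgM; [exact: cf|exact: cg].
move=> Cf Cg; split; first by move=> z Az; apply: cvgM; [exact: (Ck_continuous Cf)|exact: (Ck_continuous Cg)].
split; first by move=> z Az; have [? ?] := Ck_is_derive Cf Az; have [? ?] := Ck_is_derive Cg Az; split;
  apply: derivableM; apply: ex_derive.
have [fx fy] := Ck_der Cf; have [gx gy] := Ck_der Cg.
split; [apply: Ck_ext (Ck_add oA (IH _ _ (Ck_pred Cf) gx) (IH _ _ (Ck_pred Cg) fx)) => // z Az
       |apply: Ck_ext (Ck_add oA (IH _ _ (Ck_pred Cf) gy) (IH _ _ (Ck_pred Cg) fy)) => // z Az];
  have [? ?] := Ck_is_derive Cf Az; have [? ?] := Ck_is_derive Cg Az;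
  by apply/esym; apply: derive_val.
Qed.

Definition laplacian f : R * R -> R := fun z => ddx (ddx f) z + ddy (ddy f) z.

Lemma laplacianD A f g z : open A -> A z -> Ck 2 A f -> Ck 2 A g ->
  laplacian (fun z => f z + g z) z = laplacian f z + laplacian g z.
Proof.
move=> oA Az Cf Cg; rewrite /laplacian.
have [fx fy] := Ck_der Cf; have [gx gy] := Ck_der Cg.
have -> : ddx (ddx (fun z => f z + g z)) z = ddx (ddx f) z + ddx (ddx g) z.
  have [? _] := Ck_is_derive fx Az; have [? _] := Ck_is_derive gx Az.
  transitivity (ddx (fun z => ddx f z + ddx g z) z); last by apply: derive_val.
  apply: near_eq_derive; apply: filterS (open_near oA Az) => w Aw.
  have [? _] := Ck_is_derive Cf Aw; have [? _] := Ck_is_derive Cg Aw.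
  by apply: derive_val.
have -> : ddy (ddy (fun z => f z + g z)) z = ddy (ddy f) z + ddy (ddy g) z.
  have [_ ?] := Ck_is_derive fy Az; have [_ ?] := Ck_is_derive gy Az.
  transitivity (ddy (fun z => ddy f z + ddy g z) z); last by apply: derive_val.
  apply: near_eq_derive; apply: filterS (open_near oA Az) => w Aw.
  have [_ ?] := Ck_is_derive Cf Aw; have [_ ?] := Ck_is_derive Cg Aw.
  by apply: derive_val.
exact: addrACA.
Qed.

Lemma is_derive_add (z v : R * R) f g a b : is_derive z v f a -> is_derive z v g b ->
  is_derive z v (fun w => f w + g w) (a + b).
Proof. exact: is_deriveD. Qed.

Lemma is_derive_mul (z v : R * R) f g a b : is_derive z v f a -> is_derive z v g b ->
  is_derive z v (fun w => f w * g w) (a * g z + f z * b).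
Proof. by move=> df dg; apply: is_derive_eq (is_deriveM df dg) _; rewrite addrC mulrC. Qed.

Lemma is_derive_scale (z v : R * R) f a (t : R) : is_derive z v f a ->
  is_derive z v (fun w => t * f w) (t * a).
Proof. exact: is_deriveZ. Qed.

Lemma is_derive_fst (z : R * R) v : is_derive z v (fun w : R * R => w.1) v.1.
Proof. exact: is_derive_lin. Qed.

Lemma is_derive_snd (z : R * R) v : is_derive z v (fun w : R * R => w.2) v.2.
Proof. exact: is_derive_lin. Qed.

Lemma is_derive_exp_mul (z v : R * R) (s : R) (f : R * R -> R) d : is_derive z v f d ->
  is_derive z v (fun w => expR (s * w.1) * f w) (expR (s * z.1) * (d + s * v.1 * f z)).
Proof.
move=> df.
have dl : is_derive z v (fun w : R * R => s * w.1) (s * v.1).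
  by apply: (@is_derive_lin _ (fun w : R * R => s * w.1)) => h; rewrite /= -![_ *: _]/(_ * _); ring.
have de := is_derive_comp1 dl (is_derive_expR (s * z.1)).
apply: is_derive_eq (is_deriveM de df) _.
by rewrite -![_ *: _]/(_ * _); ring.
Qed.

(** Conjugation by e^(s x) turns L_s into the Laplacian. It serves the eigenfunction with s = rho(M)
    and the test functions with s = - rho. *)
Lemma laplacian_exp A s f z : open A -> A z -> Ck 2 A f ->
  laplacian (fun w => expR (s * w.1) * f w) z = expR (s * z.1) * Lop s f z.
Proof.
move=> oA Az Cf; have [fx fy] := Ck_der Cf; rewrite /laplacian /Lop.
have E1 w : A w -> ddx (fun w => expR (s * w.1) * f w) w = expR (s * w.1) * (ddx f w + s * f w).
  move=> Aw; have [d1 _] := Ck_is_derive Cf Aw; have := is_derive_exp_mul s d1 => -[_].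
  by rewrite mulr1.
have E2 w : A w -> ddy (fun w => expR (s * w.1) * f w) w = expR (s * w.1) * ddy f w.
  move=> Aw; have [_ d2] := Ck_is_derive Cf Aw; have := is_derive_exp_mul s d2 => -[_].
  by rewrite mulr0 mul0r addr0.
have -> : ddx (ddx (fun w => expR (s * w.1) * f w)) z =
    expR (s * z.1) * (ddx (ddx f) z + s * ddx f z + s * (ddx f z + s * f z)).
  transitivity (ddx (fun w => expR (s * w.1) * (ddx f w + s * f w)) z).
    by apply: near_eq_derive; apply: filterS (open_near oA Az) => w; exact: E1.
  have [d1 _] := Ck_is_derive Cf Az; have [dd1 _] := Ck_is_derive fx Az.
  have d : is_derive z ((1, 0) : R * R) (fun w => ddx f w + s * f w) (ddx (ddx f) z + s * ddx f z).
    exact: (is_deriveD dd1 (is_deriveZ s d1)).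
  by have := is_derive_exp_mul s d => -[_]; rewrite mulr1.
have -> : ddy (ddy (fun w => expR (s * w.1) * f w)) z = expR (s * z.1) * ddy (ddy f) z.
  transitivity (ddy (fun w => expR (s * w.1) * ddy f w) z).
    by apply: near_eq_derive; apply: filterS (open_near oA Az) => w; exact: E2.
  have [_ dd2] := Ck_is_derive fy Az; have := is_derive_exp_mul s dd2 => -[_].
  by rewrite mulr0 mul0r addr0.
ring.
Qed.

Lemma laplacian_scale A f (a : R) z : open A -> A z -> Ck 2 A f ->
  laplacian (fun z => a * f z) z = a * laplacian f z.
Proof.
move=> oA Az Cf; have [fx fy] := Ck_der Cf; rewrite /laplacian.
have -> : ddx (ddx (fun z => a * f z)) z = a * ddx (ddx f) z.
  have [dxx _] := Ck_is_derive fx Az; have [_ e] := is_derive_scale a dxx.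
  transitivity (ddx (fun z => a * ddx f z) z); last exact: e.
  apply: near_eq_derive; apply: filterS (open_near oA Az) => w Aw.
  by have [dx _] := Ck_is_derive Cf Aw; have [_ e'] := is_derive_scale a dx; exact: e'.
have -> : ddy (ddy (fun z => a * f z)) z = a * ddy (ddy f) z.
  have [_ dyy] := Ck_is_derive fy Az; have [_ e] := is_derive_scale a dyy.
  transitivity (ddy (fun z => a * ddy f z) z); last exact: e.
  apply: near_eq_derive; apply: filterS (open_near oA Az) => w Aw.
  by have [_ dy] := Ck_is_derive Cf Aw; have [_ e'] := is_derive_scale a dy; exact: e'.
by rewrite mulrDr.
Qed.

Lemma Ck_cst k A (a : R) : Ck k A (fun=> a).
Proof.
apply: (@Ck_subset _ setT) => //; apply: locally_sm_Ck; apply: sm_locally; [exact: openT|exact: sm_cst].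
Qed.

Lemma laplacian_cst (a : R) z : laplacian (fun=> a) z = 0.
Proof.
rewrite /laplacian; have E (b : R) (e t : R * R) : 'D_e (fun _ : R * R => b) t = 0 by exact: derive_cst.
have -> : ddx (fun=> a) = (fun=> 0) by apply/funext => t; exact: E.
have -> : ddy (fun=> a) = (fun=> 0) by apply/funext => t; exact: E.
by transitivity (0 + 0 : R); [congr (_ + _); exact: E|exact: addr0].
Qed.

Lemma smooth_exp (s : R) : locally_sm setT (fun w : R * R => expR (s * w.1)).
Proof.
apply: sm_locally; first exact: openT.
by apply: sm_exp; apply: sm_mul; [exact: sm_cst|exact: sm_fst].
Qed.

Lemma Ck_exp_mul k A s f : open A -> Ck k A f -> Ck k A (fun w => expR (s * w.1) * f w).
Proof.
move=> oA Cf; apply: Ck_mul => //; apply: (@Ck_subset _ setT) => //.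
exact/locally_sm_Ck/smooth_exp.
Qed.

End Ck_theory.

(** * Differences of cut-off logarithms *)

Section log_bump.
Variables (R : realType) (k th : R -> R) (c : R).
Local Notation e1 := ((1, 0) : R * R).
Local Notation e2 := ((0, 1) : R * R).
Local Notation beta := (fun x : R => c * (flat 0 (x + 1) * flat 0 (- x))).
Hypothesis dk : forall x : R, is_derive x 1 k (th x).
Hypothesis dth : forall x : R, is_derive x 1 th (beta x).
Hypothesis c0 : 0 < c.
Hypothesis k_id : forall x : R, 0 <= x -> k x = x.
Hypothesis k_cst : forall x : R, x <= -1 -> k x = k (-1).

Lemma beta_ge0 x : 0 <= beta x.
Proof. by rewrite mulr_ge0 ?(ltW c0)// mulr_ge0// flat_ge0. Qed.

Lemma beta_supp x : beta x != 0 -> -1 <= x <= 0.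
Proof.
apply: contraR; rewrite negb_and -!ltNge => /orP[h|h].
  by rewrite flat_le0 ?mul0r ?mulr0//; lra.
by rewrite [X in _ * (_ * X)]flat_le0 ?mulr0//; lra.
Qed.

Lemma continuous_flat m : continuous (@flat R m).
Proof.
move=> x; apply/differentiable_continuous/derivable1_diffP.
by case: (is_derive_flat m x).
Qed.

Lemma continuous_beta : continuous beta.
Proof.
pose b (x : R) : R := flat 0 (x + 1) * flat 0 (- x).
have cb : continuous b.
  move=> x; apply: (@continuousM R R (fun x : R => flat 0 (x + 1)) (fun x : R => flat 0 (- x)) x).
    apply: (@continuous_comp _ _ _ (fun x : R => x + 1) (flat 0)); last exact: continuous_flat.
    by apply: cvgD; [exact: cvg_id|exact: cvg_cst].
  apply: (@continuous_comp _ _ _ (fun x => - x) (flat 0)); last exact: continuous_flat.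
  exact: opp_continuous.
by move=> x; apply: cvgM; [exact: cvg_cst|exact: cb].
Qed.

Variables (l1 l2 : R) (Z : R * R).
Local Notation S := (fun w => sqd (cexp w) Z).

Let kap t := k (t - l1) + l1 - (k (t - l2) + l2).

(** Each cut-off logarithm equals ln S outside its disc, so their difference vanishes outside both
    discs. Close to the pole both have reached k(-1) + l_i, which leaves l1 - l2, the value given at
    the pole. *)
Definition log_bump (w : R * R) : R := if 0 < S w then kap (ln (S w)) else l1 - l2.

Let Sx (w : R * R) := 2 * (expR w.1 * expR w.1) - 2 * (expR w.1 * (Z.1 * cos w.2 + Z.2 * sin w.2)).
Let Sy (w : R * R) := 2 * (expR w.1 * (Z.1 * sin w.2 - Z.2 * cos w.2)).

Let d_comp (z v : R * R) :
  [/\ is_derive z v (fun w : R * R => expR w.1) (v.1 * expR z.1),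
   is_derive z v (fun w : R * R => cos w.2) (- (v.2 * sin z.2)) &
   is_derive z v (fun w : R * R => sin w.2) (v.2 * cos z.2)].
Proof.
split.
- by apply: is_derive_eq (is_derive_comp1 (is_derive_fst z v) (is_derive_expR z.1)) _; rewrite mulrC.
- by apply: is_derive_eq (is_derive_comp1 (is_derive_snd z v) (is_derive_cos z.2)) _; rewrite mulNr mulrC.
- by apply: is_derive_eq (is_derive_comp1 (is_derive_snd z v) (is_derive_sin z.2)) _; rewrite mulrC.
Qed.

Let SE w : S w = expR w.1 * expR w.1 - 2 * (expR w.1 * (Z.1 * cos w.2 + Z.2 * sin w.2)) + (Z.1 ^+ 2 + Z.2 ^+ 2).
Proof.
rewrite /sqd /cexp/=; have := cos2Dsin2 w.2; move: (cos w.2) (sin w.2) (expR w.1) => a b e ab.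
transitivity (e * e * (a ^+ 2 + b ^+ 2) - 2 * (e * (Z.1 * a + Z.2 * b)) + (Z.1 ^+ 2 + Z.2 ^+ 2)); first by ring.
by rewrite ab mulr1.
Qed.

Let dS (w : R * R) : is_derive w e1 S (Sx w) /\ is_derive w e2 S (Sy w).
Proof.
have -> : S = (fun w => expR w.1 * expR w.1 + (-2) * (expR w.1 * (Z.1 * cos w.2 + Z.2 * sin w.2)) + (Z.1 ^+ 2 + Z.2 ^+ 2)).
  by apply/funext => v; rewrite SE mulNr.
have D v : is_derive w v (fun w : R * R => expR w.1 * expR w.1 + (-2) * (expR w.1 * (Z.1 * cos w.2 + Z.2 * sin w.2)) + (Z.1 ^+ 2 + Z.2 ^+ 2))
    (v.1 * expR w.1 * expR w.1 + expR w.1 * (v.1 * expR w.1) + (-2) * (v.1 * expR w.1 * (Z.1 * cos w.2 + Z.2 * sin w.2) +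
       expR w.1 * (Z.1 * - (v.2 * sin w.2) + Z.2 * (v.2 * cos w.2))) + 0).
  have [de dc ds] := d_comp w v.
  have dsum := is_derive_add (is_derive_scale Z.1 dc) (is_derive_scale Z.2 ds).
  have dm := is_derive_scale (-2) (is_derive_mul de dsum).
  exact: is_derive_add (is_derive_add (is_derive_mul de de) dm) (is_derive_cst (Z.1 ^+ 2 + Z.2 ^+ 2) w v).
by split; apply: is_derive_eq (D _) _; rewrite /Sx /Sy /=; ring.
Qed.

Let dSS (w : R * R) : is_derive w e1 Sx (4 * (expR w.1 * expR w.1) - 2 * (expR w.1 * (Z.1 * cos w.2 + Z.2 * sin w.2))) /\
  is_derive w e2 Sy (2 * (expR w.1 * (Z.1 * cos w.2 + Z.2 * sin w.2))).
Proof.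
rewrite /Sx /Sy; split.
  have [de dc ds] := d_comp w e1.
  have D := is_derive_add (is_derive_scale 2 (is_derive_mul de de)) (is_derive_scale (-2) (is_derive_mul de (is_derive_add (is_derive_scale Z.1 dc) (is_derive_scale Z.2 ds)))).
  rewrite (_ : (fun w => _) = (fun w => 2 * (expR w.1 * expR w.1) + (-2) * (expR w.1 * (Z.1 * cos w.2 + Z.2 * sin w.2)))).
    by apply: is_derive_eq D _; rewrite /=; ring.
  by apply/funext => v; rewrite mulNr.
have [de dc ds] := d_comp w e2.
have D := is_derive_scale 2 (is_derive_mul de (is_derive_add (is_derive_scale Z.1 ds) (is_derive_scale (- Z.2) dc))).
rewrite (_ : (fun w => _) = (fun w => 2 * (expR w.1 * (Z.1 * sin w.2 + (- Z.2) * cos w.2)))).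
  by apply: is_derive_eq D _; rewrite /=; ring.
by apply/funext => v; rewrite mulNr.
Qed.

Let kap1 t := th (t - l1) - th (t - l2).
Let kap2 t := beta (t - l1) - beta (t - l2).

Let dshift (f : R -> R) (d t l : R) : is_derive (t - l) 1 f d -> is_derive t 1 (fun t => f (t - l)) d.
Proof.
move=> df; have h : is_derive t 1 (fun t : R => t - l) 1.
  by apply: is_derive_eq (is_deriveB (is_derive_id _ _) (is_derive_cst l _ _)) _; rewrite subr0.
by have := @is_derive1_comp _ f (fun t => t - l) t _ _ df h; rewrite mulr1.
Qed.

Let dkap (t : R) : is_derive t 1 kap (kap1 t).
Proof.
have h l := is_deriveD (dshift (dk (t - l))) (is_derive_cst l t 1).
by apply: is_derive_eq (is_deriveB (h l1) (h l2)) _; rewrite !addr0.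
Qed.

Let dkap1 (t : R) : is_derive t 1 kap1 (kap2 t).
Proof. exact: (is_deriveB (dshift (dth (t - l1))) (dshift (dth (t - l2)))). Qed.

Let dln (w v : R * R) d : 0 < S w -> is_derive w v S d -> is_derive w v (fun w => ln (S w)) (d / S w).
Proof.
move=> S0 dSw; apply: is_derive_eq (is_derive_comp1 dSw (is_derive1_ln S0)) _.
by rewrite mulrC.
Qed.

Let smS (O : set (R * R)) (lam : R * R) : sm O (fun w => S (w.1 + lam.1, w.2 + lam.2)).
Proof.
have -> : (fun w : R * R => S (w.1 + lam.1, w.2 + lam.2)) =
    (fun w => expR (w.1 + lam.1) * expR (w.1 + lam.1) +
      (-2) * (expR (w.1 + lam.1) * (Z.1 * cos (w.2 + lam.2) + Z.2 * sin (w.2 + lam.2))) + (Z.1 ^+ 2 + Z.2 ^+ 2)).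
  by apply/funext => v; rewrite SE mulNr.
have s1 : sm O (fun w : R * R => w.1 + lam.1) by apply: sm_add; [exact: sm_fst|exact: sm_cst].
have s2 : sm O (fun w : R * R => w.2 + lam.2) by apply: sm_add; [exact: sm_snd|exact: sm_cst].
have se := sm_exp s1; have sc := sm_cos s2; have ss := sm_sin s2.
apply: sm_add; last exact: sm_cst.
apply: sm_add; first exact: sm_mul.
apply: sm_mul; first exact: sm_cst.
by apply: sm_mul => //; apply: sm_add; (apply: sm_mul; first exact: sm_cst).
Qed.

Let cSl (lam : R * R) : continuous (fun w : R * R => S (w.1 + lam.1, w.2 + lam.2)).
Proof. by move=> w; have [fx [fy [_ _ H]]] := smP (smS setT lam); have [] := H w I. Qed.

Let cS : continuous S.
Proof.
have := @cSl (0, 0); rewrite (_ : (fun w => _) = S)//.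
by apply/funext => -[w1 w2]; rewrite !addr0.
Qed.

Let oS a : open ([set w | a < S w] : set (R * R)).
Proof. by apply: (@open_comp _ _ S [set x | a < x]); [move=> w _; exact: cS|exact: open_gt]. Qed.

Lemma smooth_ln_sqd : locally_sm [set w | 0 < S w] (fun w => ln (S w)).
Proof.
move=> w S0; have o := @oS 0; exists [set v | 0 < S v]; split; [exact: o|exact: S0|].
exists (fun w => ln (S w)) => //.
have := smS [set v | 0 < S v] (0, 0); rewrite (_ : (fun w => _) = S).
  by move=> h; apply: sm_ln.
by apply/funext => -[w1 w2]; rewrite !addr0.
Qed.

(** This identity, together with the value 4 e^(2 x) of the Laplacian of S, makes ln S harmonic and
    leaves only the k'' terms in [laplacian_log_bump]. *)
Let grad (w : R * R) : Sx w ^+ 2 + Sy w ^+ 2 = 4 * expR w.1 ^+ 2 * sqd (cexp w) Z.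
Proof.
rewrite SE /Sx /Sy; have := cos2Dsin2 w.2; move: (cos w.2) (sin w.2) (expR w.1) => a b e ab.
transitivity (4 * e ^+ 2 * (e ^+ 2 - 2 * (e * (Z.1 * a + Z.2 * b)) + (Z.1 ^+ 2 + Z.2 ^+ 2) * (a ^+ 2 + b ^+ 2))); first by ring.
by rewrite ab mulr1 expr2.
Qed.

Lemma laplacian_ln_sqd w : 0 < S w -> laplacian (fun v => ln (S v)) w = 0.
Proof.
move=> S0; rewrite /laplacian.
have -> : ddx (ddx (fun v => ln (S v))) w = ddx (fun w => Sx w / S w) w.
  apply: near_eq_derive; apply: filterS (open_near (@oS 0) S0) => v Sv.
  by have [_ e] := dln Sv (dS v).1; exact: e.
have -> : ddy (ddy (fun v => ln (S v))) w = ddy (fun w => Sy w / S w) w.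
  apply: near_eq_derive; apply: filterS (open_near (@oS 0) S0) => v Sv.
  by have [_ e] := dln Sv (dS v).2; exact: e.
have di (v : R * R) d : is_derive w v S d -> is_derive w v (fun w => (S w)^-1) (- (S w) ^- 2 * d).
  move=> dSw; apply: is_derive_comp1 => //; apply: is_derive_eq (is_deriveV _ (is_derive_id _ _)) _.
    by rewrite gt_eqF.
  by rewrite -[_ *: _]/(_ * _) mulr1.
have [dx dy] := dS w; have [dxx dyy] := dSS w.
have [_ Ex] := is_derive_mul dxx (di _ _ dx); have [_ Ey] := is_derive_mul dyy (di _ _ dy).
rewrite [X in X + _]Ex [X in _ + X]Ey.
have Sn : S w != 0 by rewrite gt_eqF.
have := grad w; set A := 2 * (expR w.1 * (_ + _)); move: A => A.
move: (Sx w) (Sy w) (S w) (expR w.1) Sn => sx sy s e Sn gr.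
transitivity (4 * e ^+ 2 / s - (sx ^+ 2 + sy ^+ 2) / s ^+ 2); first by field.
by rewrite gr; field.
Qed.

Let kapS w := kap (ln (S w)).

Let d1 (w : R * R) : 0 < S w ->
  is_derive w e1 kapS (kap1 (ln (S w)) * (Sx w / S w)) /\ is_derive w e2 kapS (kap1 (ln (S w)) * (Sy w / S w)).
Proof.
move=> S0; have [dx dy] := dS w.
by split; apply: is_derive_comp1 (dkap _); exact: dln.
Qed.

Let dq (w v : R * R) (s : R * R -> R) d d' : 0 < S w -> is_derive w v S d -> is_derive w v s d' ->
  is_derive w v (fun w => kap1 (ln (S w)) * (s w / S w))
    (kap2 (ln (S w)) * (d / S w) * (s w / S w) + kap1 (ln (S w)) * (d' / S w - s w * d / S w ^+ 2)).
Proof.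
move=> S0 dSw ds; have dl := dln S0 dSw.
have di : is_derive w v (fun w => (S w)^-1) (- (S w) ^- 2 * d).
  apply: is_derive_comp1 => //; apply: is_derive_eq (is_deriveV _ (is_derive_id _ _)) _.
    by rewrite gt_eqF.
  by rewrite -[_ *: _]/(_ * _) mulr1.
apply: is_derive_eq (is_derive_mul (is_derive_comp1 dl (dkap1 _)) (is_derive_mul ds di)) _.
congr (_ + _ * (_ + _)); by rewrite mulNr mulrN -mulrA (mulrC d).
Qed.

(** Once ln S is below m, both cut-offs are constant, since [k] is constant on the left of -1. *)
Let m := Num.min l1 l2 - 1.

Let loc v : S v < expR m -> log_bump v = l1 - l2.
Proof.
move=> Sv; rewrite /log_bump; case: ifPn => // Sv0; rewrite /kap.
have : ln (S v) <= m by rewrite -[leRHS]expRK ler_ln ?posrE ?expR_gt0// ltW.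
rewrite /m => h; have m1 : Num.min l1 l2 <= l1 by rewrite ge_min lexx.
have m2 : Num.min l1 l2 <= l2 by rewrite ge_min lexx orbT.
by rewrite (@k_cst (ln (S v) - l1)) ?(@k_cst (ln (S v) - l2)); [ring|lra|lra].
Qed.

Lemma log_bump_far w : expR l1 <= S w -> expR l2 <= S w -> log_bump w = 0.
Proof.
move=> h1 h2; have S0 : 0 < S w by exact: lt_le_trans (expR_gt0 _) h1.
have e1 : l1 <= ln (S w) by rewrite -[leLHS]expRK ler_ln ?posrE ?expR_gt0.
have e2 : l2 <= ln (S w) by rewrite -[leLHS]expRK ler_ln ?posrE ?expR_gt0.
by rewrite /log_bump S0 /kap !k_id ?subr_ge0// !subrK subrr.
Qed.

(** The exponential factor and the translation [lam] are those met when a test function on the torus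
    is read near a lattice translate of its support. *)
Lemma smooth_log_bump (r : R) (lam : R * R) :
  locally_sm setT (fun w => expR (r * (w.1 + lam.1)) * log_bump (w.1 + lam.1, w.2 + lam.2)).
Proof.
move=> w _; pose Sl (w : R * R) := S (w.1 + lam.1, w.2 + lam.2).
have se O : sm O (fun w : R * R => expR (r * (w.1 + lam.1))).
  apply: sm_exp; apply: sm_mul; first exact: sm_cst.
  by apply: sm_add; [exact: sm_fst|exact: sm_cst].
have [S0|S0] := ltP 0 (Sl w).
  exists [set w | 0 < Sl w]; split => //.
    by apply: (@open_comp _ _ Sl [set x | 0 < x]); [move=> v _; exact: cSl|exact: open_gt].
  exists (fun w => expR (r * (w.1 + lam.1)) * kap (ln (Sl w))); last first.
    by move=> v /= v0; rewrite /log_bump ifT.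
  apply: sm_mul => //; have sl := sm_ln (smS [set w | 0 < Sl w] lam) (fun w h => h).
  rewrite /kap; apply: (@sm_add _ _ (fun w => k (ln (Sl w) - l1) + l1) (fun w => - (k (ln (Sl w) - l2) + l2))).
    apply: sm_add; last exact: sm_cst.
    by apply: (sm_prim2 dk dth); apply: sm_add; [|exact: sm_cst].
  rewrite (_ : (fun w => - _) = (fun w => (-1) * (k (ln (Sl w) - l2) + l2))); last first.
    by apply/funext => v; rewrite mulN1r.
  apply: sm_mul; first exact: sm_cst; apply: sm_add; last exact: sm_cst.
  by apply: (sm_prim2 dk dth); apply: sm_add; [|exact: sm_cst].
exists [set w | Sl w < expR m]; split => /=.
- by apply: (@open_comp _ _ Sl [set x | x < expR m]); [move=> v _; exact: cSl|exact: open_lt].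
- exact: le_lt_trans S0 (expR_gt0 _).
exists (fun w => expR (r * (w.1 + lam.1)) * (l1 - l2)); first by apply: sm_mul => //; exact: sm_cst.
by move=> v /= /loc ->.
Qed.

Lemma laplacian_log_bump w : laplacian log_bump w =
  kernel beta l1 Z (cexp w) * expR w.1 ^+ 2 - kernel beta l2 Z (cexp w) * expR w.1 ^+ 2.
Proof.
have [S0|S0] := ltP 0 (S w).
  have nS : \forall v \near w, 0 < sqd (cexp v) Z by exact: (open_near (@oS 0) S0).
  rewrite /laplacian.
  have -> : ddx (ddx log_bump) w = ddx (fun w => kap1 (ln (S w)) * (Sx w / S w)) w.
    apply: near_eq_derive; near=> v; transitivity (ddx kapS v).
      apply: near_eq_derive; near=> t; rewrite /log_bump ifT//; near: t.
      by apply: (open_near (@oS 0)); near: v.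
    have Sv : 0 < sqd (cexp v) Z by near: v.
    by have [[_ e] _] := d1 Sv; exact: e.
  have -> : ddy (ddy log_bump) w = ddy (fun w => kap1 (ln (S w)) * (Sy w / S w)) w.
    apply: near_eq_derive; near=> v; transitivity (ddy kapS v).
      apply: near_eq_derive; near=> t; rewrite /log_bump ifT//; near: t.
      by apply: (open_near (@oS 0)); near: v.
    have Sv : 0 < sqd (cexp v) Z by near: v.
    by have [_ [_ e]] := d1 Sv; exact: e.
  have [dx dy] := dS w; have [dxx dyy] := dSS w.
  have [_ Ex] := dq S0 dx dxx; have [_ Ey] := dq S0 dy dyy.
  rewrite [X in X + _]Ex [X in _ + X]Ey /kernel /kap2.
  have grw := grad w.
  have Sn : S w != 0 by rewrite gt_eqF.
  move: (c * _) (c * _) (kap1 _) => b2 b1 t.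
  move: grw; set A := 2 * (expR w.1 * (_ + _)); move: A => A.
  move: (Sx w) (Sy w) (S w) (expR w.1) Sn => sx sy s e Sn grw.
  have -> : (b1 - b2) * (sx / s) * (sx / s) + t * ((4 * (e * e) - A) / s - sx * sx / s ^+ 2) +
    ((b1 - b2) * (sy / s) * (sy / s) + t * (A / s - sy * sy / s ^+ 2)) =
    (b1 - b2) * ((sx ^+ 2 + sy ^+ 2) / s ^+ 2) + t * (4 * e ^+ 2 / s - (sx ^+ 2 + sy ^+ 2) / s ^+ 2) by field.
  by rewrite grw; field.
have SZ : S w = 0 by apply/eqP; rewrite eq_le S0 sqd_ge0.
rewrite /kernel SZ invr0 !mulr0 !mul0r subrr.
have oSm : open [set v | S v < expR m] by apply: (@open_comp _ _ S [set x | x < expR m]); [move=> u _; exact: cS|exact: open_lt].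
have D0 (e : R * R) v : S v < expR m -> 'D_e log_bump v = 0.
  move=> Sv; transitivity ('D_e (cst (l1 - l2) : R * R -> R) v); last exact: derive_cst.
  by apply: near_eq_derive; apply: filterS (open_near oSm Sv) => t; exact: loc.
have Swm : S w < expR m by rewrite SZ expR_gt0.
have DD e : 'D_e (fun v => 'D_e log_bump v) w = 0.
  transitivity ('D_e (cst 0 : R * R -> R) w); last exact: derive_cst.
  by apply: near_eq_derive; apply: filterS (open_near oSm Swm) => t; exact: D0.
by transitivity (0 + 0 : R); [congr (_ + _); exact: DD|exact: addr0].
Unshelve. all: by end_near. Qed.

End log_bump.

(** * Discs around e^z seen in the coordinate z *)

Section log_disc.
Variable R : realType.
Implicit Types (z w : R * R).

(** Scaling by |e^z| reduces estimates at z to the point 1 = e^0, which is why the constant of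
    [log_disc] is independent of z. *)
Lemma sqd_cexp z w : sqd (cexp w) (cexp z) =
  expR z.1 ^+ 2 * sqd (cexp (w.1 - z.1, w.2 - z.2)) (1, 0).
Proof.
rewrite /sqd /cexp/= expRD expRN cosB sinB.
have := cos2Dsin2 z.2; have E0 : expR z.1 != 0 by rewrite gt_eqF ?expR_gt0.
move: (cos z.2) (sin z.2) (cos w.2) (sin w.2) (expR z.1) (expR w.1) E0 => a b c d E F E0 ab.
transitivity (F ^+ 2 * (c ^+ 2 + d ^+ 2) - 2 * E * F * (c * a + d * b) + E ^+ 2 * (a ^+ 2 + b ^+ 2)); first by ring.
transitivity (F ^+ 2 * (c ^+ 2 + d ^+ 2) * (a ^+ 2 + b ^+ 2) - 2 * E * F * (c * a + d * b) + E ^+ 2).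
  by rewrite ab !mulr1.
by field.
Qed.

(** After scaling, |e^(u + i v) - 1|^2 = (e^u - 1)^2 + 2 e^u (1 - cos v). If |u| >= d the first term
    is at least a; if |u| < d <= |v| the second is at least b. Half of the smaller one is a safe
    squared radius. *)
Lemma log_disc (d : R) : 0 < d -> d < pi -> exists l0, forall z w, `|w.2 - z.2| <= pi ->
  sqd (cexp w) (cexp z) <= expR (l0 + 2 * z.1) -> `|w.1 - z.1| < d /\ `|w.2 - z.2| < d.
Proof.
move=> d0 dpi.
pose a : R := (1 - expR (- d)) ^+ 2; pose b : R := 2 * expR (- d) * (1 - cos d).
have a0 : 0 < a by rewrite exprn_gt0// subr_gt0 expR_lt1 oppr_lt0.
have b0 : 0 < b.
  rewrite mulr_gt0 ?mulr_gt0 ?expR_gt0// subr_gt0 -cos0.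
  by rewrite ltr_cos ?in_itv/= ?lexx ?pi_ge0 ?ltW.
have ab0 : 0 < Num.min a b / 2 by rewrite divr_gt0// lt_min a0.
exists (ln (Num.min a b / 2)) => z w wpi.
rewrite sqd_cexp expRD lnK ?posrE// mulrC expRM_natl ler_pM2r ?exprn_gt0 ?expR_gt0//.
set u := w.1 - z.1; set v := w.2 - z.2 => h.
have E : sqd (cexp (u, v)) (1, 0) = (expR u - 1) ^+ 2 + 2 * expR u * (1 - cos v).
  rewrite /sqd /cexp/=; have := cos2Dsin2 v; move: (cos v) (sin v) (expR u) => x y e xy.
  transitivity (e ^+ 2 * (x ^+ 2 + y ^+ 2) - 2 * e * x + 1); first by ring.
  by rewrite xy; ring.
have c1 : 0 <= 1 - cos v by rewrite subr_ge0 cos_le1.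
have ud : `|u| < d.
  rewrite ltNge; apply/negP => ud; suff : a <= (expR u - 1) ^+ 2.
    move: h; rewrite E; have := @ge_min _ _ a a b; rewrite lexx/= => ha.
    have : 0 <= 2 * expR u * (1 - cos v) by rewrite !mulr_ge0 ?expR_ge0.
    by lra.
  rewrite /a; have em1 : expR (- d) <= 1 by rewrite expR_le1 oppr_le0 ltW.
  have [u0|u0] := leP 0 u.
    have eu : 1 <= expR u by rewrite -expR0 ler_expR.
    rewrite ler_sqr ?nnegrE ?subr_ge0//.
    have : expR d <= expR u by rewrite ler_expR; move: ud; rewrite ger0_norm.
    have : 1 <= expR d * expR (- d) by rewrite -expRD subrr expR0.
    have : 1 < expR d by rewrite expR_gt1.
    by have := expR_gt0 (- d); nra.
  have eu : expR u <= 1 by rewrite -expR0 ler_expR ltW.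
  rewrite -[leRHS]sqrrN opprB ler_sqr ?nnegrE ?subr_ge0//.
  by rewrite lerD2l lerN2 ler_expR; move: ud; rewrite ltr0_norm// => ?; lra.
split => //; rewrite ltNge; apply/negP => vd; suff : b <= 2 * expR u * (1 - cos v).
  move: h; rewrite E; have := @ge_min _ _ b a b; rewrite lexx orbT => ha.
  by have := sqr_ge0 (expR u - 1); lra.
rewrite /b ler_pM ?mulr_ge0 ?expR_ge0 ?subr_ge0 ?cos_le1//.
  by rewrite ler_pM2l// ler_expR; move: ud; rewrite ltr_norml => /andP[] *; lra.
rewrite lerD2l lerN2.
rewrite -(cos_norm v).
rewrite le_eqVlt; move: vd; rewrite le_eqVlt => /orP[/eqP <-|vd]; first by rewrite eqxx.
by apply/orP; right; rewrite ltr_cos ?in_itv/= ?normr_ge0 ?wpi ?(ltW d0) ?(ltW dpi).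
Qed.

End log_disc.

(** * Sets of zero capacity *)

Section weak_limit.
Variable R : realType.
Local Notation mu := (@lebesgue_measure R).

Lemma ultra_compact_cvg (T : topologicalType) (K : set T) (U : set_system nat) (a : nat -> T) :
  UltraFilter U -> compact K -> (forall n, K (a n)) -> exists p, K p /\ a n @[n --> U] --> p.
Proof.
move=> UU cK Ka.
have PF : ProperFilter (a @ U) by apply: fmap_proper_filter; exact: ultra_proper.
have FK : (a @ U) K by apply: (@filterS _ U _ setT) => [n _ /=|]; [exact: Ka|exact: filterT].
have [p [Kp clp]] := cK _ PF FK.
exists p; split => // B nB.
have [//|h] := in_ultra_setVsetC (a @^-1` B) UU.
by have [x []] := clp (~` B) B h nB.
Qed.

Lemma cvg_sum_ord (U : set_system nat) N (f : 'I_N -> nat -> R) (a : 'I_N -> R) : Filter U ->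
  (forall i, f i n @[n --> U] --> a i) -> \sum_(i < N) f i n @[n --> U] --> \sum_(i < N) a i.
Proof.
move=> FU; elim: N f a => [|N IH] f a fa.
  by under eq_fun do rewrite big_ord0; rewrite big_ord0; exact: cvg_cst.
under eq_fun do rewrite big_ord_recr/=; rewrite big_ord_recr/=.
by apply: cvgD => //; apply: IH => i; exact: fa.
Qed.

(* Points are coded along nested grids, in such a way that an ultrafilter limit
   of empirical measures is the image of the Lebesgue measure of [0, 1[ under a
   map f to K, obtained from the limits of the distribution functions of the codes. *)
Section codes.
Variable L : R.
Definition cell1 (l : nat) (x : R) : nat := Num.truncn (l.+1%:R * (x + L)).
Definition ncell1 (l : nat) : nat := (Num.truncn (l.+1%:R * (L + L))).+1.
Definition cell l (z : R * R) : nat := (cell1 l z.1 * ncell1 l + cell1 l z.2)%N.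
Definition ncell l : nat := (ncell1 l * ncell1 l)%N.
(** A number in mixed radix whose digits are the cells of z at successive levels. Division by
    [ncell l] drops the last digit, which makes the codes of consecutive levels compatible. *)
Fixpoint code l (z : R * R) : nat :=
  if l is l'.+1 then (code l' z * ncell l' + cell l' z)%N else 0%N.
Fixpoint ncode l : nat := if l is l'.+1 then (ncode l' * ncell l')%N else 1%N.

Definition inbox (z : R * R) : Prop := `|z.1| <= L /\ `|z.2| <= L.

Lemma cell1_lt l x : `|x| <= L -> (cell1 l x < ncell1 l)%N.
Proof.
rewrite ler_norml => /andP[_ xL]; rewrite ltnS; apply: le_truncn.
by rewrite ler_wpM2l// lerD2r.
Qed.

Lemma ncell_gt0 l : (0 < ncell l)%N. Proof. by rewrite muln_gt0. Qed.

Lemma cell_lt l z : inbox z -> (cell l z < ncell l)%N.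
Proof.
move=> [z1 z2]; have h1 := cell1_lt l z1; have h2 := cell1_lt l z2.
rewrite /cell /ncell; apply: (@leq_trans (cell1 l z.1 * ncell1 l + ncell1 l)%N).
  by rewrite ltn_add2l.
by rewrite -mulSnr leq_mul2r h1 orbT.
Qed.

Lemma code_lt l z : inbox z -> (code l z < ncode l)%N.
Proof.
move=> zb; elim: l => //= l IH.
apply: (@leq_trans (code l z * ncell l + ncell l)%N); first by rewrite ltn_add2l cell_lt.
by rewrite -mulSnr leq_mul2r IH orbT.
Qed.

Lemma codeS_div l z : inbox z -> (code l.+1 z %/ ncell l)%N = code l z.
Proof.
by move=> zb /=; rewrite divnMDl ?ncell_gt0// divn_small ?addn0// cell_lt.
Qed.

Lemma cell1_dist l x y : `|x| <= L -> `|y| <= L -> cell1 l x = cell1 l y -> `|x - y| <= l.+1%:R^-1.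
Proof.
rewrite !ler_norml => /andP[x1 x2] /andP[y1 y2] xy.
have h (t : R) : - L <= t -> (cell1 l t)%:R <= l.+1%:R * (t + L) < (cell1 l t).+1%:R.
  move=> t1; apply: truncn_itv; rewrite mulr_ge0//; lra.
have /andP[hx1 hx2] := h x x1; have /andP[hy1 hy2] := h y y1.
rewrite xy in hx1 hx2; rewrite -[_.+1%:R]natr1 in hx2 hy2.
have l0 : 0 < l.+1%:R :> R by [].
rewrite -ler_norml -(ler_pM2l l0) mulfV ?gt_eqF// -{1}(gtr0_norm l0) -normrM ler_norml.
have -> : l.+1%:R * (x - y) = l.+1%:R * (x + L) - l.+1%:R * (y + L) by ring.
by apply/andP; split; lra.
Qed.

Lemma code_dist l z w : inbox z -> inbox w -> code l.+1 z = code l.+1 w ->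
  `|z.1 - w.1| <= l.+1%:R^-1 /\ `|z.2 - w.2| <= l.+1%:R^-1.
Proof.
move=> zb wb E; have E0 : code l z = code l w by rewrite -(codeS_div l zb) -(codeS_div l wb) E.
have : cell l z = cell l w by move: E => /=; rewrite E0 => /addnI.
have [z1 z2] := zb; have [w1 w2] := wb.
rewrite /cell => C.
have C1 : cell1 l z.1 = cell1 l w.1.
  have := congr1 (fun n => n %/ ncell1 l)%N C; rewrite !divnMDl//.
  by rewrite !divn_small ?addn0// cell1_lt.
split; apply: cell1_dist => //.
by move: C; rewrite C1 => /addnI.
Qed.
End codes.

Section limit.
Variables (K : set (R * R)) (L : R) (z : nat -> R * R).
Hypotheses (cK : compact K) (bK : forall w, K w -> inbox L w) (Kz : forall n, K (z n)).
Variable U : set_system nat.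
Hypotheses (UU : UltraFilter U) (oU : \oo `<=` U).

Local Notation code := (code L).
Local Notation ncode := (ncode L).
Local Notation ncell := (ncell L).

Let PU : ProperFilter U. Proof. exact: ultra_proper. Qed.

Let cvgU_uniq (a : nat -> R) (l l' : R) : a n @[n --> U] --> l -> a n @[n --> U] --> l' -> l = l'.
Proof.
by move=> h1 h2; rewrite -(cvg_lim (@Rhausdorff R) h1) (cvg_lim (@Rhausdorff R) h2).
Qed.

Let cvgU_le (a b : nat -> R) (l l' : R) : a n @[n --> U] --> l -> b n @[n --> U] --> l' ->
  (\forall n \near U, a n <= b n) -> l <= l'.
Proof.
move=> h1 h2 ab; rewrite -(cvg_lim (@Rhausdorff R) h1) -(cvg_lim (@Rhausdorff R) h2).
by apply: ler_lim => //; apply/cvg_ex; [exists l|exists l'].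
Qed.

(** The distribution function of the empirical measure of the first n points, carried over to
    codes. *)
Definition freq l j n : R := (\sum_(i < n) (code l (z i) < j)%N%:R) / n%:R.

Let freq01 l j n : 0 <= freq l j n <= 1.
Proof.
have h : 0 <= \sum_(i < n) ((code l (z i) < j)%N%:R : R) <= n%:R.
  apply/andP; split; first by apply: sumr_ge0.
  rewrite -[leRHS]mulr1 -[X in X%:R * _]card_ord -sumr_const mulr_suml.
  by apply: ler_sum => i _; rewrite mulr1; case: (_ < _)%N.
rewrite /freq; case: n h => [|n] /andP[h1 h2]; first by rewrite big_ord0 mul0r lexx ler01.
by rewrite divr_ge0//= ler_pdivrMr// mul1r.
Qed.

(** An ultrafilter gives the limits for all levels and all codes at once, in place of a diagonal
    extraction of subsequences. *)
Lemma freq_lim : exists A : nat -> nat -> R, forall l j, freq l j n @[n --> U] --> A l j.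
Proof.
have /boolp.choice[A HA] : forall p : nat * nat, exists a, freq p.1 p.2 n @[n --> U] --> (a : R).
  move=> p; have [n|a [_ ?]] := ultra_compact_cvg UU (@segment_compact R 0 1) (a := freq p.1 p.2).
    by rewrite /= in_itv/=; exact: freq01.
  by exists a.
by exists (fun l j => A (l, j)) => l j; exact: (@HA (l, j)).
Qed.

Variable A : nat -> nat -> R.
Hypothesis HA : forall l j, freq l j n @[n --> U] --> A l j.

Let A0 l : A l 0 = 0.
Proof.
apply: (@cvgU_uniq (freq l 0) _ _ (@HA l 0)); rewrite (_ : freq l 0 = fun=> 0); first exact: cvg_cst.
by apply/funext => n; rewrite /freq big1 ?mul0r.
Qed.

Let evU (P : nat -> Prop) : (exists N, forall n, (N <= n)%N -> P n) -> \forall n \near U, P n.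
Proof. by move=> [N H]; apply: oU; exists N. Qed.

Let A1 l : A l (ncode l) = 1.
Proof.
apply: (cvgU_uniq (@HA l _)).
apply: (@cvg_trans _ ((fun=> 1 : R) @ U)); last exact: cvg_cst.
apply: near_eq_cvg; apply: evU; exists 1%N => n n0.
rewrite /freq (eq_bigr (fun=> 1)) => [|i _]; last by rewrite code_lt//; exact: bK.
by rewrite sumr_const card_ord divff// pnatr_eq0 -lt0n.
Qed.

Let A_le l i j : (i <= j)%N -> A l i <= A l j.
Proof.
move=> ij; apply: (cvgU_le (@HA l i) (@HA l j)); apply: nearW => n.
rewrite /freq ler_wpM2r ?invr_ge0//; apply: ler_sum => k _.
by rewrite ler_nat; case: ltnP => // h; rewrite (leq_trans h).
Qed.

Let AS l j : A l.+1 (j * ncell l) = A l j.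
Proof.
apply: (cvgU_uniq (@HA l.+1 _)); rewrite (_ : freq _ _ = freq l j); first apply: HA.
apply/funext => n; rewrite /freq; congr (_ / _); apply: eq_bigr => i _.
by rewrite -ltn_divLR ?ncell_gt0// codeS_div//; exact: bK.
Qed.

(** A code of positive limit mass is the code of some point of the sequence, hence has a
    representative in K. *)
Let A_lt l j : A l j < A l j.+1 -> exists i, code l (z i) = j.
Proof.
move=> Aj; apply: contrapT => H; move: Aj; rewrite (_ : A l j.+1 = A l j) ?ltxx//.
apply: (cvgU_uniq (@HA l _)); rewrite (_ : freq _ _ = freq l j); first apply: HA.
apply/funext => n; rewrite /freq; congr (_ / _); apply: eq_bigr => i _.
rewrite ltnS leq_eqVlt; case: eqP => //= E; by case: H; exists i.
Qed.

Lemma rep_exists : exists rep : nat -> nat -> R * R, forall l j, K (rep l j) /\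
  ((exists i, code l (z i) = j) -> code l (rep l j) = j).
Proof.
have /boolp.choice[r Hr] : forall p : nat * nat, exists w, K w /\
    ((exists i, code p.1 (z i) = p.2) -> code p.1 w = p.2).
  move=> p; have [[i ip]|ne] := pselect (exists i, code p.1 (z i) = p.2).
    by exists (z i).
  by exists (z 0%N).
by exists (fun l j => r (l, j)) => l j; exact: (Hr (l, j)).
Qed.

Variable rep : nat -> nat -> R * R.
Hypothesis Hrep : forall l j, K (rep l j) /\ ((exists i, code l (z i) = j) -> code l (rep l j) = j).

(** J l is the quantile function of the limit distribution: the interval of those x with J l x = j
    has length A l (j+1) - A l j. *)
Lemma index_exists : exists J : nat -> R -> nat, forall l x, 0 <= x < 1 -> A l (J l x) <= x < A l (J l x).+1.
Proof.
have /boolp.choice[J HJ] : forall p : nat * R, exists j, 0 <= p.2 < 1 -> A p.1 j <= p.2 < A p.1 j.+1.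
  move=> [l x] /=; have [x01|//] := boolP (0 <= x < 1); last by exists 0%N.
  have ex : exists j, x < A l j by exists (ncode l); rewrite A1; case/andP : x01.
  case: (ex_minnP ex) => -[|j] xj jmin; first by move: xj; rewrite A0 ltNge; case/andP : x01 => ->.
  exists j => _; rewrite xj andbT leNgt; apply/negP => /jmin; by rewrite ltnn.
by exists (fun l x => J (l, x)) => l x; exact: (HJ (l, x)).
Qed.

Variable J : nat -> R -> nat.
Hypothesis HJ : forall l x, 0 <= x < 1 -> A l (J l x) <= x < A l (J l x).+1.

Let J_uniq l x i : 0 <= x < 1 -> A l i <= x < A l i.+1 -> J l x = i.
Proof.
move=> /(HJ l) /andP[h1 h2] /andP[h3 h4]; apply/eqP; rewrite eqn_leq; apply/andP; split.
  by rewrite leqNgt; apply/negP => /(A_le l) h; move: (lt_le_trans h4 (le_trans h h1)); rewrite ltxx.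
by rewrite leqNgt; apply/negP => /(A_le l) h; move: (lt_le_trans h2 (le_trans h h3)); rewrite ltxx.
Qed.

Let J_lt l x : 0 <= x < 1 -> (J l x < ncode l)%N.
Proof.
move=> x01; have /andP[h1 _] := HJ l x01; rewrite ltnNge; apply/negP => /(A_le l); rewrite A1.
by move=> h; case/andP : x01 => _; rewrite ltNge (le_trans h).
Qed.

Let J_div l x : 0 <= x < 1 -> (J l.+1 x %/ ncell l)%N = J l x.
Proof.
move=> x01; have /andP[h1 h2] := HJ l.+1 x01; apply/esym/J_uniq => //.
rewrite -(AS l (_ %/ _)) -(AS l (_ %/ _).+1); apply/andP; split.
  by rewrite (le_trans _ h1)// A_le// leq_trunc_div.
by rewrite (lt_le_trans h2)// A_le// -ltn_divLR ?ncell_gt0.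
Qed.

Let fl l x : R * R := rep l (J l x).

Let code_fl l x : 0 <= x < 1 -> code l (fl l x) = J l x.
Proof.
move=> x01; apply: (Hrep l (J l x)).2; apply: A_lt.
by have /andP[h1 h2] := HJ l x01; exact: le_lt_trans h1 h2.
Qed.

Let fl_box l x : inbox L (fl l x). Proof. exact/bK/(Hrep _ _).1. Qed.

(** The quantile intervals of successive levels are nested, so a later approximation keeps the
    earlier digits. This makes the points [fl l x] converge at the rate of the mesh. *)
Let code_fl_le l m x : 0 <= x < 1 -> (l <= m)%N -> code l (fl m x) = J l x.
Proof.
move=> x01; move: m; elim/ltn_ind => m IH; rewrite leq_eqVlt => /orP[/eqP ->|].
  exact: code_fl.
have : code m (fl m x) = J m x by exact: code_fl.
case: m IH => // m IH; rewrite ltnS => C lm.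
have : code m (fl m.+1 x) = J m x by rewrite -codeS_div ?C ?J_div.
move: lm; clear -x01 fl_box J_div; elim: m (fl m.+1 x) (fl_box m.+1 x) => [|m IH] w wb.
  by rewrite leqn0 => /eqP ->.
rewrite leq_eqVlt => /orP[/eqP -> //|]; rewrite ltnS => lm C.
by apply: IH => //; rewrite -codeS_div// C J_div.
Qed.

Let fl_dist l m x : 0 <= x < 1 -> (l < m)%N ->
  `|(fl m x).1 - (fl l.+1 x).1| <= l.+1%:R^-1 /\ `|(fl m x).2 - (fl l.+1 x).2| <= l.+1%:R^-1.
Proof.
by move=> x01 lm; apply: (@code_dist L) => //; rewrite !code_fl_le.
Qed.

Lemma limit_exists : exists f : R -> R * R, forall x, 0 <= x < 1 -> K (f x) /\
  forall l, `|(f x).1 - (fl l.+1 x).1| <= l.+1%:R^-1 /\ `|(f x).2 - (fl l.+1 x).2| <= l.+1%:R^-1.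
Proof.
suff : forall x : R, exists q : R * R, 0 <= x < 1 -> K q /\
    forall l, `|q.1 - (fl l.+1 x).1| <= l.+1%:R^-1 /\ `|q.2 - (fl l.+1 x).2| <= l.+1%:R^-1.
  by move=> /boolp.choice[f Hf]; exists f.
move=> x; have [x01|//] := boolP (0 <= x < 1); last by exists (z 0%N).
(* The limit along the ultrafilter lies in K by compactness, and the bounds between levels pass to
   it. *)
have [p [Kp pl]] := ultra_compact_cvg UU cK (fun l => (Hrep l (J l x)).1).
exists p => _; split => // l.
have p1 : (fl m x).1 @[m --> U] --> p.1 by apply: cvg_comp pl _; exact: cvg_fst.
have p2 : (fl m x).2 @[m --> U] --> p.2 by apply: cvg_comp pl _; exact: cvg_snd.
have bnd (g : R * R -> R) : (g (fl m x)) @[m --> U] --> g p ->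
    (forall m, (l < m)%N -> `|g (fl m x) - g (fl l.+1 x)| <= l.+1%:R^-1) ->
    `|g p - g (fl l.+1 x)| <= l.+1%:R^-1.
  move=> gp gl; have c : `|g (fl m x) - g (fl l.+1 x)| @[m --> U] --> `|g p - g (fl l.+1 x)|.
    by apply: cvg_norm; apply: cvgB => //; exact: cvg_cst.
  have c2 : (fun _ : nat => l.+1%:R^-1 : R) n @[n --> U] --> (l.+1%:R^-1 : R) by exact: cvg_cst.
  apply: (cvgU_le c c2); apply: evU; exists l.+1 => m lm; exact: gl.
split; first by apply: (bnd fst) => // m lm; exact: (fl_dist x01 lm).1.
by apply: (bnd snd) => // m lm; exact: (fl_dist x01 lm).2.
Qed.

Let I01 : set R := `[0, 1[%classic.
Let II l j : set R := `[A l j, A l j.+1[%classic.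
Let p l j : R := A l j.+1 - A l j.

Let sum_indic l (c : nat -> R) x : 0 <= x < 1 ->
  c (J l x) = \sum_(j < ncode l) c j * \1_(II l j) x.
Proof.
move=> x01; rewrite (bigD1 (Ordinal (J_lt l x01)))//= big1 ?addr0.
  by rewrite indicE mem_set ?mulr1// /II/= in_itv/= HJ.
move=> j /eqP jJ; rewrite indicE memNset ?mulr0//.
rewrite /II/= in_itv/= => /(J_uniq x01) E; apply: jJ; exact/val_inj.
Qed.

Let mu_II l j : mu (II l j) = (p l j)%:E.
Proof.
rewrite /II (lebesgue_measure_itv `[A l j, A l j.+1[)/= lte_fin; case: ifPn => //.
rewrite -leNgt => h; congr (_%:E); apply/esym/eqP; rewrite subr_eq0 eq_le h.
by rewrite A_le.
Qed.

Let integral_J l (c : nat -> R) : (forall j, 0 <= c j) ->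
  (\int[mu]_(x in I01) (c (J l x))%:E)%E = (\sum_(j < ncode l) c j * p l j)%:E.
Proof.
move=> c0.
transitivity (\int[mu]_(x in I01) (\sum_(j < ncode l) (c j)%:E * (\1_(II l j) x)%:E))%E.
  apply: eq_integral => x; rewrite inE/I01/= in_itv/= => x01.
  by rewrite (sum_indic _ _ x01) -sumEFin; apply: eq_bigr => j _; rewrite EFinM.
have mI : measurable (I01 : set (measurableTypeR R)) by exact: measurable_itv.
have mII j : measurable (II l j : set (measurableTypeR R)) by exact: measurable_itv.
have mi j : measurable_fun I01 (fun x => (\1_(II l j) x)%:E : \bar R).
  by apply/measurable_EFinP; apply: measurable_funTS; apply: measurable_indic; exact: mII.
rewrite ge0_integral_sum//=.
- rewrite -sumEFin; apply: eq_bigr => j _; rewrite ge0_integralZl//.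
  + rewrite integral_indic// EFinM; congr (_ * _)%E.
    rewrite (_ : II l j `&` I01 = II l j).
      exact: mu_II.
    apply/setIidl => x; rewrite /II /I01 /= !in_itv/= => /andP[h1 h2].
    rewrite (le_trans _ h1) -?(A0 l) ?A_le//=.
    by rewrite (lt_le_trans h2)// -(A1 l) A_le.
  + exact: mi.
  + by rewrite lee_fin.
- by move=> j; apply: emeasurable_funM => //; exact: mi.
- by move=> j x _; rewrite mule_ge0// lee_fin.
Qed.

Let sum_freq l (c : nat -> R) n :
  \sum_(j < ncode l) c j * (freq l j.+1 n - freq l j n) = (\sum_(i < n) c (code l (z i))) / n%:R.
Proof.
rewrite /freq; under eq_bigr do rewrite -mulrBl -sumrB mulrA mulr_sumr.
rewrite -mulr_suml exchange_big/=; congr (_ / _); apply: eq_bigr => i _.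
have h : (code l (z i) < ncode l)%N by apply: code_lt; exact: bK.
rewrite (bigD1 (Ordinal h))//= big1 ?addr0.
  by rewrite ltnSn ltnn subr0 mulr1.
move=> j /eqP jJ; rewrite ltnS leq_eqVlt; case: eqP => [E|_ /=]; last by rewrite subrr mulr0.
by case: jJ; apply/val_inj.
Qed.

Let measurable_J l (c : nat -> R) : measurable_fun I01 (fun x => c (J l x)).
Proof.
apply: (@eq_measurable_fun _ _ _ _ _ (fun x => \sum_(j < ncode l) c j * \1_(II l j) x)).
  by move=> x; rewrite inE/I01/= in_itv/= => x01; rewrite (sum_indic _ _ x01).
apply: measurable_sum => j; apply: measurable_funM; first exact: measurable_cst.
by apply: measurable_funTS; apply: measurable_indic; exact: measurable_itv.
Qed.

Let sum_p l : \sum_(j < ncode l) p l j = 1.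
Proof.
have := @integral_J l (fun=> 1) (fun=> ler01); under eq_bigr do rewrite mul1r.
rewrite integral_cst/=; last exact: measurable_itv.
by rewrite /I01 (lebesgue_measure_itv `[0, 1[)/= lte_fin ltr01 mul1e oppr0 adde0 => -[].
Qed.

Variables (k : R * R -> R * R -> R) (C B D : R).
Hypothesis C0 : 0 <= C.
Hypothesis k0 : forall v w, 0 <= k v w.
Hypothesis kL : forall v w v' w' e, `|v.1 - v'.1| <= e -> `|v.2 - v'.2| <= e ->
  `|w.1 - w'.1| <= e -> `|w.2 - w'.2| <= e -> k v w <= k v' w' + C * e.
Hypothesis kz : forall n, \sum_(i < n) \sum_(j < n) k (z i) (z j) <= B * n%:R ^+ 2 + D * n%:R.

Let doublesum l := \sum_(i < ncode l) (\sum_(j < ncode l) k (rep l i) (rep l j) * p l j) * p l i.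

(** Replacing each point by the representative of its code moves it by at most the mesh and costs C
    / (l+1). The resulting sums are finite sums over codes and pass to the limit along U. *)
Let doublesum_le l : doublesum l.+1 <= B + C * l.+1%:R^-1.
Proof.
pose q j n := freq l.+1 j.+1 n - freq l.+1 j n.
pose E n := \sum_(i < ncode l.+1) (\sum_(j < ncode l.+1) k (rep l.+1 i) (rep l.+1 j) * q j n) * q i n.
have cq j : q j n @[n --> U] --> p l.+1 j by apply: cvgB; apply: HA.
have cE : E n @[n --> U] --> doublesum l.+1.
  apply: cvg_sum_ord => i; apply: cvgM; last exact: cq.
  by apply: cvg_sum_ord => j; apply: cvgM; [exact: cvg_cst|exact: cq].
apply/ler_addgt0Pr => e e0.
have c2 : (fun _ : nat => B + C * l.+1%:R^-1 + e : R) n @[n --> U] --> (B + C * l.+1%:R^-1 + e : R).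
  exact: cvg_cst.
(* For n > D / e the diagonal contribution D n is at most e n^2, so it disappears after division by
   n^2. *)
apply: (cvgU_le cE c2); apply: evU; exists (Num.truncn (D / e)).+1 => n nD.
have n0 : 0 < n%:R :> R by rewrite ltr0n (leq_trans _ nD).
have -> : E n = (\sum_(i < n) \sum_(j < n) k (rep l.+1 (code l.+1 (z i))) (rep l.+1 (code l.+1 (z j)))) / n%:R ^+ 2.
  have sq (c : nat -> R) : \sum_(j < ncode l.+1) c j * q j n = (\sum_(i < n) c (code l.+1 (z i))) / n%:R.
    exact: sum_freq.
  rewrite /E (eq_bigr (fun i : 'I_(ncode l.+1) =>
      (\sum_(j < n) k (rep l.+1 i) (rep l.+1 (code l.+1 (z j)))) / n%:R * q i n)); last first.
    by move=> i _; rewrite (sq (fun j => k (rep l.+1 i) (rep l.+1 j))).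
  rewrite (sq (fun i => (\sum_(j < n) k (rep l.+1 i) (rep l.+1 (code l.+1 (z j)))) / n%:R)).
  by rewrite -mulr_suml expr2 invfM mulrA.
rewrite ler_pdivrMr ?exprn_gt0//.
have rz i : `|(rep l.+1 (code l.+1 (z i))).1 - (z i).1| <= l.+1%:R^-1 /\
            `|(rep l.+1 (code l.+1 (z i))).2 - (z i).2| <= l.+1%:R^-1.
  apply: (@code_dist L); [exact/bK/(Hrep _ _).1|exact: bK|].
  by apply: (Hrep _ _).2; exists i.
apply: (@le_trans _ _ (\sum_(i < n) \sum_(j < n) (k (z i) (z j) + C * l.+1%:R^-1))).
  apply: ler_sum => i _; apply: ler_sum => j _.
  by have [? ?] := rz i; have [? ?] := rz j; exact: kL.
under eq_bigr do rewrite big_split/= sumr_const card_ord.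
rewrite big_split/= sumr_const card_ord; set c' := C / _.
have -> : c' *+ n *+ n = c' * n%:R ^+ 2 by rewrite -[c' *+ n]mulr_natr -mulr_natr -mulrA -expr2.
have Dn : D * n%:R <= e * n%:R ^+ 2.
  rewrite expr2 mulrA ler_wpM2r ?ler0n//.
  rewrite mulrC -ler_pdivrMr//.
  by rewrite ltW// (lt_le_trans (truncnS_gt _))// ler_nat.
by have := kz n; move: Dn; lra.
Qed.

Variable f : R -> R * R.
Hypothesis Hf : forall x, 0 <= x < 1 -> K (f x) /\
  forall l, `|(f x).1 - (fl l.+1 x).1| <= l.+1%:R^-1 /\ `|(f x).2 - (fl l.+1 x).2| <= l.+1%:R^-1.

Lemma measurable_limit_coord (g : R * R -> R) : (forall x l, 0 <= x < 1 -> `|g (f x) - g (fl l.+1 x)| <= l.+1%:R^-1) ->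
  measurable_fun I01 (fun x => g (f x)).
Proof.
move=> Hg; apply: (@measurable_fun_cvg _ _ R I01 (fun l x => g (fl l.+1 x))).
  by move=> l; exact: (measurable_J l.+1 (fun j => g (rep l.+1 j))).
move=> x; rewrite /I01/= in_itv/= => x01; apply/cvgrPdist_le => e e0.
exists (Num.truncn e^-1) => // l /= el; rewrite (le_trans (Hg _ _ x01))//.
rewrite -[leRHS]invrK lef_pV2 ?posrE ?invr_gt0//.
by rewrite ltW// (lt_le_trans (truncnS_gt _))// ler_nat.
Qed.

Hypothesis mk : measurable_fun (setT : set (plane_mT R * plane_mT R)) (fun vw => k vw.1 vw.2).
Variable f' : measurableTypeR R -> plane_mT R.
Hypothesis mf' : measurable_fun setT f'.
Hypothesis ff' : forall x, 0 <= x < 1 -> f' x = f x.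

(** One error C / (l+1) comes from replacing f by its approximation of level l+1, the other from
    [doublesum_le]; both vanish as l grows. *)
Lemma double_integral_le :
  (\int[mu]_(x in I01) \int[mu]_(y in I01) (k (f' x) (f' y))%:E <= B%:E)%E.
Proof.
have mI : measurable (I01 : set (measurableTypeR R)) by exact: measurable_itv.
have mkk : measurable_fun (setT : set (measurableTypeR R * measurableTypeR R))
    (fun xy => (k (f' xy.1) (f' xy.2) * \1_I01 xy.2)%:E).
  apply/measurable_EFinP; apply: measurable_funM.
    have mff : measurable_fun (setT : set (measurableTypeR R * measurableTypeR R))
        (fun xy => (f' xy.1, f' xy.2)).
      apply: measurable_fun_pair; first exact: (measurableT_comp mf' measurable_fst).
      exact: (measurableT_comp mf' measurable_snd).
    exact: (measurableT_comp mk mff).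
  have mi : measurable_fun setT (\1_I01 : measurableTypeR R -> R) by exact: measurable_indic.
  exact: (measurableT_comp mi measurable_snd).
have kk0 xy : (0 <= (k (f' xy.1) (f' xy.2) * \1_I01 xy.2)%:E)%E.
  by rewrite lee_fin mulr_ge0// indicE; case: (_ \in _).
have innerE x : (\int[mu]_(y in I01) (k (f' x) (f' y))%:E = \int[mu]_y (k (f' x) (f' y) * \1_I01 y)%:E)%E.
  rewrite integral_mkcond; apply: eq_integral => y _.
  by rewrite epatch_indic/= EFinM.
have minner : measurable_fun setT (fun x => \int[mu]_(y in I01) (k (f' x) (f' y))%:E)%E.
  under eq_fun do rewrite innerE.
  by have := @measurable_fun_fubini_tonelli_F _ _ _ _ R mu _ mkk kk0; exact.
suff H l : (\int[mu]_(x in I01) \int[mu]_(y in I01) (k (f' x) (f' y))%:E <= (B + 2 * C * l.+1%:R^-1)%:E)%E.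
  apply/lee_addgt0Pr => e e0; have [l le] : exists l : nat, 2 * C * l.+1%:R^-1 <= e.
    exists (Num.truncn (2 * C / e)); rewrite ler_pdivrMr//.
    by rewrite [leRHS]mulrC -ler_pdivrMr// ltW// truncnS_gt.
  by apply: (le_trans (H l)); rewrite -EFinD lee_fin lerD2l.
pose c i j := k (rep l.+1 i) (rep l.+1 j) + C * l.+1%:R^-1.
have c0 i j : 0 <= c i j by rewrite addr_ge0// mulr_ge0.
pose d i := \sum_(j < ncode l.+1) c i j * p l.+1 j.
have d0 i : 0 <= d i.
  by apply: sumr_ge0 => j _; rewrite mulr_ge0// subr_ge0 A_le.
apply: (@le_trans _ _ (\int[mu]_(x in I01) (d (J l.+1 x))%:E)%E).
  apply: ge0_le_integral => //.
  - by move=> x _; apply: integral_ge0 => y _; rewrite lee_fin.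
  - exact: measurable_funTS.
  - by apply/measurable_EFinP; exact: measurable_J.
  move=> x; rewrite /I01/= in_itv/= => x01; rewrite /d -integral_J//.
  apply: ge0_le_integral => //.
  - by move=> y _; rewrite lee_fin.
  - apply/measurable_EFinP; apply: measurable_funTS.
    by have := measurable_fun_pair2 (f' x) mk => h; exact: (measurableT_comp h mf').
  - by apply/measurable_EFinP; exact: (measurable_J l.+1 (c (J l.+1 x))).
  move=> y; rewrite /= in_itv/= => y01; rewrite lee_fin !ff'//.
  by apply: kL; [exact: ((Hf x01).2 l).1|exact: ((Hf x01).2 l).2|exact: ((Hf y01).2 l).1|exact: ((Hf y01).2 l).2].
rewrite integral_J// lee_fin.
have -> : \sum_(i < ncode l.+1) d i * p l.+1 i = doublesum l.+1 + C * l.+1%:R^-1.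
  rewrite /doublesum; transitivity (\sum_(i < ncode l.+1)
      ((\sum_(j < ncode l.+1) k (rep l.+1 i) (rep l.+1 j) * p l.+1 j) * p l.+1 i + C * l.+1%:R^-1 * p l.+1 i)).
    apply: eq_bigr => i _; rewrite -mulrDl; congr (_ * _).
    rewrite /d; under eq_bigr do rewrite mulrDl.
    rewrite big_split/=; congr (_ + _).
    transitivity (C * l.+1%:R^-1 * \sum_(j < ncode l.+1) p l.+1 j); first by rewrite mulr_sumr.
    by rewrite sum_p mulr1.
  rewrite big_split/=; congr (_ + _).
  transitivity (C * l.+1%:R^-1 * \sum_(j < ncode l.+1) p l.+1 j); first by rewrite mulr_sumr.
  by rewrite sum_p mulr1.
by rewrite -mulrA mulr_natl mulr2n addrA lerD2r; exact: doublesum_le.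
Qed.

End limit.

(** The map f is produced before the kernel is given, so one measure serves every truncation of the
    logarithm. The term D n leaves room for the diagonal, on which a truncated kernel is large. *)
Theorem weak_limit (K : set (R * R)) (L : R) (z : nat -> R * R) :
  compact K -> (forall w, K w -> inbox L w) -> (forall n, K (z n)) ->
  exists f : measurableTypeR R -> plane_mT R, [/\ measurable_fun setT f, forall x, K (f x) &
    forall (k : R * R -> R * R -> R) (C B D : R), 0 <= C -> (forall v w, 0 <= k v w) ->
    (forall v w v' w' e, `|v.1 - v'.1| <= e -> `|v.2 - v'.2| <= e ->
      `|w.1 - w'.1| <= e -> `|w.2 - w'.2| <= e -> k v w <= k v' w' + C * e) ->
    (forall n, \sum_(i < n) \sum_(j < n) k (z i) (z j) <= B * n%:R ^+ 2 + D * n%:R) ->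
    measurable_fun (setT : set (plane_mT R * plane_mT R)) (fun vw => k vw.1 vw.2) ->
    (\int[mu]_(x in `[0%R, 1%R[) \int[mu]_(y in `[0%R, 1%R[) (k (f x) (f y))%:E <= B%:E)%E].
Proof.
move=> cK bK Kz.
have [U [UU oU]] := ultraFilterLemma (@eventually_filter).
have [A HA] := freq_lim L z UU.
have [rep Hrep] := rep_exists L Kz.
have [J HJ] := index_exists bK Kz UU oU HA.
have [f Hf] := limit_exists cK bK Kz UU oU HA Hrep HJ.
(* Outside [0, 1[ any point of K will do; it makes f total, measurable and K-valued. *)
pose f' (x : measurableTypeR R) : plane_mT R := if 0 <= (x : R) < 1 then f x else z 0%N.
have mcoord (g : R * R -> R) : measurable_fun (`[0, 1[%classic : set (measurableTypeR R)) (fun x => g (f x)) ->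
    measurable_fun setT (fun x => g (f' x)).
  move=> mg; pose h x := g (f x) - g (z 0%N).
  rewrite (_ : (fun x => _) = (fun x => (h \_ `[0, 1[%classic) x + g (z 0%N))); last first.
    apply/funext => x; rewrite patchE /f' /h; case: ifPn => x01.
      by rewrite mem_set ?subrK//= in_itv.
    by rewrite memNset ?add0r//= in_itv/=; exact/negP.
  apply: measurable_funD; last exact: measurable_cst.
  apply/(measurable_restrictT _ (measurable_itv _)); exact: measurable_funB.
have mf' : measurable_fun setT f'.
  apply/measurable_fun_pairP; split; apply: mcoord;
    apply: (measurable_limit_coord bK Kz UU oU HA HJ (rep := rep)) => x l x01.
    by have [? _] := (Hf x x01).2 l.
  by have [_ ?] := (Hf x x01).2 l.
exists f'; split => //.
- by move=> x; rewrite /f'; case: ifPn => // /Hf[].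
- move=> k C B D C0 k0 kL kz mk.
  have ff' x : 0 <= x < 1 -> f' x = f x by move=> x01; rewrite /f' x01.
  exact: (double_integral_le bK Kz UU oU HA Hrep HJ C0 k0 kL kz Hf mk mf' ff').
Qed.

End weak_limit.

(** * Logarithmic energy and Leja points *)

Section euclid.
Variable R : realType.
Implicit Types (z w v : R * R).

Lemma euclid_distE z w :
  euclid_dist z w = Normc.normc ((z.1 - w.1) +i* (z.2 - w.2))%C.
Proof. by []. Qed.

Lemma euclid_distC z w : euclid_dist z w = euclid_dist w z.
Proof. by rewrite /euclid_dist -(sqrrN (z.1 - w.1)) -(sqrrN (z.2 - w.2)) !opprB. Qed.

Lemma euclid_dist_ge0 z w : 0 <= euclid_dist z w.
Proof. exact: sqrtr_ge0. Qed.

Lemma euclid_dist0 z : euclid_dist z z = 0.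
Proof. by rewrite /euclid_dist !subrr expr0n/= addr0 sqrtr0. Qed.

Lemma euclid_dist_sqr z w : euclid_dist z w ^+ 2 = (z.1 - w.1) ^+ 2 + (z.2 - w.2) ^+ 2.
Proof. by rewrite sqr_sqrtr// addr_ge0// sqr_ge0. Qed.

Lemma euclid_dist_gt0 z w : z != w -> 0 < euclid_dist z w.
Proof.
move=> zw; rewrite lt_def euclid_dist_ge0 andbT; apply: contra zw => /eqP d0.
have := euclid_dist_sqr z w; rewrite d0 expr0n/= => /esym/eqP.
rewrite paddr_eq0 ?sqr_ge0// !sqrf_eq0 !subr_eq0 => /andP[/eqP e1 /eqP e2].
by apply/eqP; rewrite (surjective_pairing z) (surjective_pairing w) e1 e2.
Qed.

Lemma euclid_dist_triangle z w v : euclid_dist z v <= euclid_dist z w + euclid_dist w v.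
Proof.
rewrite !euclid_distE.
have -> : ((z.1 - v.1) +i* (z.2 - v.2))%C =
    ((z.1 - w.1) +i* (z.2 - w.2))%C + ((w.1 - v.1) +i* (w.2 - v.2))%C.
  by apply/eqP; rewrite eq_complex/=; apply/andP; split; apply/eqP; rewrite addrA subrK.
exact: le_normcD.
Qed.

Lemma euclid_dist_le z w : euclid_dist z w <= `|z.1 - w.1| + `|z.2 - w.2|.
Proof.
rewrite -(ler_pXn2r (n := 2))// ?nnegrE ?euclid_dist_ge0 ?addr_ge0//.
rewrite euclid_dist_sqr [leRHS]sqrrD !real_normK ?num_real// addrAC lerDl.
by rewrite mulrn_wge0// mulr_ge0.
Qed.


(** The positive part of - ln d truncated at height m. It is Lipschitz, as [weak_limit] requires,
    and increases with m to the positive part of the logarithmic kernel. *)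
Definition log_cut (m : nat) (d : R) : R := - ln (Num.min 1 (Num.max (expR (- m%:R)) d)).

Let cut_in m (d : R) : expR (- m%:R) <= Num.min 1 (Num.max (expR (- m%:R)) d) <= 1.
Proof. by rewrite le_min le_max lexx/= expR_le1 oppr_le0 ler0n/= ge_min lexx. Qed.

Let cut_gt0 m (d : R) : 0 < Num.min 1 (Num.max (expR (- m%:R)) d).
Proof. by have /andP[h _] := cut_in m d; rewrite (lt_le_trans _ h)// expR_gt0. Qed.

Lemma log_cut_ge0 m d : 0 <= log_cut m d.
Proof. by rewrite oppr_ge0 ln_le0//; case/andP : (cut_in m d). Qed.

Lemma log_cut_le m d : log_cut m d <= m%:R.
Proof.
rewrite lerNl -[X in X <= _]expRK ler_ln ?posrE ?expR_gt0//.
by case/andP : (cut_in m d).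
Qed.

Lemma log_cut_le_log m d : 0 < d -> log_cut m d <= Num.max 0 (- ln d).
Proof.
move=> d0; rewrite /log_cut le_max; have [d1|d1] := leP 1 d.
  by rewrite min_l ?ln1 ?oppr0 ?lexx// le_max d1 orbT.
apply/orP; right; rewrite lerN2 ler_ln ?posrE ?cut_gt0//.
by rewrite le_min (ltW d1)/= le_max lexx orbT.
Qed.

(** The clamped argument is at least e^(- m), where the slope of ln is at most e^m. *)
Lemma log_cut_lip m d d' e : d' <= d + e -> 0 <= e -> log_cut m d <= log_cut m d' + expR m%:R * e.
Proof.
move=> dd e0; rewrite /log_cut.
set a := Num.min 1 (Num.max _ d); set b := Num.min 1 (Num.max _ d').
have a0 : 0 < a by exact: cut_gt0.
have b0 : 0 < b by exact: cut_gt0.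
have ab : b <= a + e.
  rewrite /a /b; case: (leP 1 (Num.max _ d)) => h; case: (leP 1 (Num.max _ d')) => h'; rewrite ?lerDl//.
    by rewrite (le_trans (ltW h')) ?lerDl.
    move: h'; rewrite le_max => /orP[E1|d1]; first by move: h; rewrite gt_max ltNge E1.
    by rewrite (le_trans d1)// (le_trans dd)// lerD2r le_max lexx orbT.
  rewrite ge_max; apply/andP; split; first by rewrite ler_wpDr// le_max lexx.
  by rewrite (le_trans dd)// lerD2r le_max lexx orbT.
suff : ln b - ln a <= expR m%:R * e by lra.
rewrite -ln_div ?posrE//; apply: (@le_trans _ _ (b / a - 1)).
  have /le_ln1Dx : -1 < b / a - 1 by rewrite ltrBrDl subrr divr_gt0.
  by rewrite addrCA subrr addr0.
rewrite -[X in _ - X](@divff _ a) ?gt_eqF// -mulrBl mulrC.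
apply: (@le_trans _ _ (a^-1 * e)); first by rewrite ler_wpM2l ?invr_ge0 ?(ltW a0)// lerBlDl.
rewrite ler_wpM2r// -[leRHS]invrK -expRN lef_pV2 ?posrE ?expR_gt0//.
by case/andP : (cut_in m d).
Qed.

Lemma measurable_log_cut m : measurable_fun setT (log_cut m : measurableTypeR R -> R).
Proof.
apply: measurable_funN; apply: measurableT_comp; first exact: measurable_ln.
by apply: measurable_minr => //; apply: measurable_maxr.
Qed.

Lemma log_cut_nd d : {homo (log_cut ^~ d) : m n / (m <= n)%N >-> m <= n}.
Proof.
move=> m n mn; rewrite lerN2 ler_ln ?posrE ?cut_gt0//.
rewrite le_min !ge_min lexx/=; apply/orP; right.
by rewrite ge_max !le_max lexx orbT andbT ler_expR lerN2 ler_nat mn.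
Qed.

Lemma measurable_euclid_dist :
  measurable_fun (setT : set (plane_mT R * plane_mT R)) (fun vw => euclid_dist vw.1 vw.2).
Proof.
have ms : measurable_fun setT (Num.sqrt : measurableTypeR R -> R).
  by apply: continuous_measurable_fun; exact: sqrt_continuous.
apply: (measurableT_comp ms); apply: measurable_funD; apply: measurable_funX; apply: measurable_funB.
- exact: (measurableT_comp measurable_fst measurable_fst).
- exact: (measurableT_comp measurable_fst measurable_snd).
- exact: (measurableT_comp measurable_snd measurable_fst).
- exact: (measurableT_comp measurable_snd measurable_snd).
Qed.

Lemma log_cut_cvg z w : ((log_cut n (euclid_dist z w))%:E @[n --> \oo] --> maxe 0 (log_kernel z w))%E.
Proof.
rewrite /log_kernel; have [->|zw] := eqVneq z w.
  rewrite euclid_dist0 le0_lneNy//= maxey.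
  apply/cvgeyPge => M; exists (Num.truncn M).+1 => // n /= Mn.
  rewrite lee_fin /log_cut max_l ?expR_ge0// min_r ?expR_le1 ?oppr_le0// expRK opprK.
  by rewrite ltW// (lt_le_trans (truncnS_gt _))// ler_nat.
have d0 := euclid_dist_gt0 zw; set d := euclid_dist z w in d0 *.
rewrite lne_EFin// -EFinN -EFin_max; apply: cvg_near_cst.
exists (Num.truncn (- ln d)).+1 => // n /= dn; congr (_%:E); rewrite /log_cut max_r; last first.
  rewrite -[leRHS]lnK ?posrE// ler_expR lerNl.
  by rewrite ltW// (lt_le_trans (truncnS_gt _))// ler_nat.
have [d1|d1] := leP 1 d; first by rewrite ln1 oppr0 max_l// oppr_le0 ln_ge0.
by rewrite max_r// oppr_ge0 ln_le0// ltW.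
Qed.

(** Greedy choice: the hypothesis is applied repeatedly to the list of points already chosen, and
    each new point has small potential with respect to its predecessors. *)
Lemma leja_seq (K : set (R * R)) (N : R) : K !=set0 ->
  (forall s : seq (R * R), s != [::] -> (forall w, w \in s -> K w) -> exists z, [/\ K z, z \notin s &
    \sum_(w <- s) Num.max 0 (- ln (euclid_dist z w)) < N * (size s)%:R]) ->
  exists z : nat -> R * R, (forall n, K (z n)) /\
    forall n, (0 < n)%N -> (forall i, (i < n)%N -> z n != z i) /\
      \sum_(i < n) Num.max 0 (- ln (euclid_dist (z n) (z i))) < N * n%:R.
Proof.
move=> [z0 Kz0] H.
have /boolp.choice[g Hg] : forall s : seq (R * R), exists z, (forall w, w \in s -> K w) ->
    K z /\ (s != [::] -> z \notin s /\
      \sum_(w <- s) Num.max 0 (- ln (euclid_dist z w)) < N * (size s)%:R).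
  move=> s; have [Ks|nKs] := pselect (forall w, w \in s -> K w); last by exists z0.
  have [->|s0] := eqVneq s [::]; first by exists z0.
  by have [z [Kz zs sN]] := H s s0 Ks; exists z.
pose S n := iter n (fun s => rcons s (g s)) [::].
pose z n := g (S n).
have SE n : S n = [seq z i | i <- iota 0 n].
  by elim: n => // n IH; rewrite /S iterS -/(S n) -[n.+1]addn1 iotaD map_cat -IH/= cats1 add0n.
have KS n : forall w, w \in S n -> K w.
  elim: n => // n IH w; rewrite /S iterS -/(S n) mem_rcons inE => /orP[/eqP ->|]; last exact: IH.
  by case: (Hg (S n) IH).
exists z; split => [n|n n0]; first by case: (Hg (S n) (KS n)).
have Sn0 : S n != [::] by rewrite SE -size_eq0 size_map size_iota -lt0n.
have [_ /(_ Sn0)] := Hg (S n) (KS n); rewrite -/(z n) => -[zS].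
rewrite SE big_map size_map size_iota.
have -> (G : nat -> R) : \sum_(i <- iota 0 n) G i = \sum_(i < n) G i.
  by rewrite -(big_mkord xpredT) /index_iota subn0.
move=> h; split => // i iN.
apply: contra zS => /eqP ->; rewrite SE; apply: map_f; by rewrite mem_iota.
Qed.

(* Otherwise a greedily chosen (Leja) sequence has bounded mean mutual energy, and
   a weak limit of its empirical measures has finite energy. *)
Lemma log_potential_large (K : set (R * R)) (N : R) : compact K -> K !=set0 ->
  (forall P : probability (plane_mT R) R, P K = 1%E -> log_energy P = +oo%E) ->
  exists s : seq (R * R), [/\ s != [::], forall w, w \in s -> K w & forall z, K z -> z \in s \/
    N * (size s)%:R <= \sum_(w <- s) Num.max 0 (- ln (euclid_dist z w))].
Proof.
move=> cK K0 Kenergy; apply: contrapT => Hn.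
wlog N0 : N Hn / 0 <= N.
  move=> W; apply: (W (Num.max 0 N)); last by rewrite le_max lexx.
  move=> [s [s0 sK sN]]; apply: Hn; exists s; split => // z /sN[|h]; [by left|right].
  by apply: le_trans h; rewrite ler_wpM2r// le_max lexx orbT.
have [|z [Kz Hz]] := @leja_seq K N K0.
  move=> s s0 sK; apply: contrapT => nz; apply: Hn; exists s; split => // z Kz.
  have [?|zs] := boolP (z \in s); [by left|right].
  by rewrite leNgt; apply/negP => h; apply: nz; exists z.
(* Going from n to n+1 adds two off-diagonal sums of at most N n each and a diagonal term of at most
   m, while N (n+1)^2 - N n^2 >= 2 N n. *)
have kz m n : \sum_(i < n) \sum_(j < n) log_cut m (euclid_dist (z i) (z j)) <= N * n%:R ^+ 2 + m%:R * n%:R.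
  elim: n => [|n IH]; first by rewrite big_ord0 expr0n/= !mulr0 addr0.
  rewrite big_ord_recr/=; under eq_bigr do rewrite big_ord_recr/=.
  rewrite big_split/= big_ord_recr/=.
  have Hs : \sum_(i < n) log_cut m (euclid_dist (z n) (z i)) <= N * n%:R.
    have [->|n0] := posnP n; first by rewrite big_ord0 mulr0.
    have [zn /ltW h] := Hz n n0; apply: le_trans h; apply: ler_sum => i _.
    by apply: log_cut_le_log; apply: euclid_dist_gt0; exact: zn.
  have Hs' : \sum_(i < n) log_cut m (euclid_dist (z i) (z n)) <= N * n%:R.
    by under eq_bigr do rewrite euclid_distC.
  have Hm := log_cut_le m (euclid_dist (z n) (z n)).
  by rewrite -natr1; nra.
have [L bK] : exists L, forall w, K w -> inbox L w.
  have /compact_bounded[M [Mr HM]] := cK.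
  exists (M + 1) => w /(HM (M + 1)) => /(_ (ltr_pwDr ltr01 (lexx _))).
  by rewrite /= prod_normE ge_max => /andP[].
have [f [mf Kf Hf]] := weak_limit cK bK Kz.
have mLeb : (@uniform_prob R 0 1 ltr01 : set _ -> \bar R) setT = 1%E by exact: probability_setT.
pose F : {mfun measurableTypeR R >-> plane_mT R} := HB.pack f (isMeasurableFun.Build _ _ _ _ f mf).
pose P : probability (plane_mT R) R := distribution (uniform_prob ltr01) F.
have PK : P K = 1%E.
  rewrite /P /distribution /pushforward/= (_ : f @^-1` K = setT) ?probability_setT//.
  by apply/seteqP; split => // x _; exact: Kf.
suff : (log_energy P <= N%:E)%E by rewrite Kenergy.
have IP (h : plane_mT R -> \bar R) : measurable_fun setT h -> (forall v, 0 <= h v)%E ->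
    (\int[P]_v h v = \int[lebesgue_measure]_(x in `[0%R, 1%R[) h (f x))%E.
  move=> mh h0; rewrite ge0_integral_distribution// integral_uniform//=.
  - rewrite subr0 invr1 mul1e integral_itv_bndo_bndc//.
    by apply: measurable_funTS; exact: (measurableT_comp mh mf).
  - exact: (measurableT_comp mh mf).
pose G m (vw : plane_mT R * plane_mT R) := (log_cut m (euclid_dist vw.1 vw.2))%:E.
have mGr m : measurable_fun (setT : set (plane_mT R * plane_mT R)) (fun vw => log_cut m (euclid_dist vw.1 vw.2)).
  exact: (measurableT_comp (measurable_log_cut m) measurable_euclid_dist).
have mG m : measurable_fun setT (G m) by apply/measurable_EFinP; exact: mGr.
have G0 m vw : (0 <= G m vw)%E by rewrite lee_fin log_cut_ge0.
have mGF m : measurable_fun setT (fun v => \int[P]_w G m (v, w))%E.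
  by have := @measurable_fun_fubini_tonelli_F _ _ _ _ R P _ (mG m) (G0 m); exact.
have GN m : (\int[P]_v \int[P]_w G m (v, w) <= N%:E)%E.
  rewrite IP//; last by move=> v; exact: integral_ge0.
  under eq_integral.
    move=> x _; rewrite IP; [|exact: (measurable_fun_pair2 _ (mG m))|by move=> w; exact: G0].
    over.
  apply: (Hf (fun v w => log_cut m (euclid_dist v w)) (expR m%:R * 4) N m%:R) => //.
  - by move=> v w; exact: log_cut_ge0.
  - move=> v w v' w' e h1 h2 h3 h4; rewrite -mulrA; apply: log_cut_lip; last first.
      by rewrite mulr_ge0// (le_trans (normr_ge0 _) h1).
    have t1 := euclid_dist_triangle v' v w'; have t2 := euclid_dist_triangle v w w'.
    have := euclid_dist_le v' v; have := euclid_dist_le w w'.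
    by move: h1 h2; rewrite (distrC v.1) (distrC v.2); lra.
  - exact: mGF.
(* The logarithmic kernel changes sign. Its positive part is the increasing limit of the
   truncations, and it suffices to bound the integral of that part. *)
pose kp v w : \bar R := maxe 0%E (log_kernel v w).
have kp0 v w : (0 <= kp v w)%E by rewrite le_max lexx.
have Gnd vw : {homo (fun m => G m vw) : m n / (m <= n)%N >-> (m <= n)%E}.
  by move=> m n mn; rewrite lee_fin; exact: log_cut_nd.
have mGs m v : measurable_fun setT (fun w => G m (v, w)) by exact: (measurable_fun_pair2 _ (mG m)).
have GI0 m v : (0 <= \int[P]_w G m (v, w))%E by apply: integral_ge0 => w _; exact: G0.
have GInd v : {homo (fun m => \int[P]_w G m (v, w))%E : m n / (m <= n)%N >-> (m <= n)%E}.
  move=> m n mn; apply: ge0_le_integral.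
  - exact: measurableT.
  - by move=> w _; exact: G0.
  - exact: mGs.
  - exact: mGs.
  - by move=> w _; exact: Gnd.
have kpE v : (\int[P]_w kp v w = limn (fun m => \int[P]_w G m (v, w)))%E.
  rewrite -monotone_convergence.
  - by apply: eq_integral => w _; apply/esym/cvg_lim => //; exact: log_cut_cvg.
  - exact: measurableT.
  - by move=> m; exact: mGs.
  - by move=> m w _; exact: G0.
  - by move=> w _; exact: Gnd.
have kpN : (\int[P]_v \int[P]_w kp v w <= N%:E)%E.
  under eq_integral do rewrite kpE.
  rewrite monotone_convergence.
  - apply: lime_le; last by apply: nearW => m; exact: GN.
    apply: ereal_nondecreasing_is_cvgn => m n mn; apply: ge0_le_integral.
    + exact: measurableT.
    + by move=> v _; exact: GI0.
    + exact: mGF.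
    + exact: mGF.
    + by move=> v _; exact: GInd.
  - exact: measurableT.
  - exact: mGF.
  - by move=> m v _; exact: GI0.
  - by move=> v _; exact: GInd.
have mlk : measurable_fun (setT : set (plane_mT R * plane_mT R)) (fun vw => log_kernel vw.1 vw.2).
  rewrite /log_kernel; apply: measurableT_comp; first exact: oppe_measurable.
  have ml : measurable_fun setT (fun d : measurableTypeR R => lne d%:E).
    rewrite (_ : (fun _ => _) = (fun d => if d <= 0 then -oo%E else (ln d)%:E)); last first.
      apply/funext => d; case: ifPn => [d0|]; first by rewrite le0_lneNy.
      by rewrite -ltNge => d0; rewrite lne_EFin.
    apply: measurable_fun_ifT => //.
    + by apply: measurable_fun_ler.
    + by apply/measurable_EFinP; exact: measurable_ln.
  exact: (measurableT_comp ml measurable_euclid_dist).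
have mkp : measurable_fun (setT : set (plane_mT R * plane_mT R)) (fun vw => kp vw.1 vw.2).
  by apply: measurable_maxe => //; exact: measurable_cst.
pose g v := (\int[P]_w log_kernel v w)%E.
have mg : measurable_fun setT g.
  rewrite (_ : g = (fun v => \int[P]_w (fun vw => log_kernel vw.1 vw.2)^\+ (v, w) -
                             \int[P]_w (fun vw => log_kernel vw.1 vw.2)^\- (v, w))%E); last first.
    apply/funext => v; rewrite /g integralE; congr (_ - _)%E; apply: eq_integral => w _.
      by rewrite !funeposE.
    by rewrite !funenegE.
  apply: emeasurable_funB.
  - have := @measurable_fun_fubini_tonelli_F _ _ _ _ R P _ (measurable_funepos mlk) (fun=> funepos_ge0 _ _).
    exact.
  - have := @measurable_fun_fubini_tonelli_F _ _ _ _ R P _ (measurable_funeneg mlk) (fun=> funeneg_ge0 _ _).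
    exact.
have int_le_pos (h : plane_mT R -> \bar R) : (\int[P]_v h v <= \int[P]_v h^\+ v)%E.
  rewrite integralE; have : (0 <= \int[P]_v h^\- v)%E by exact: integral_ge0.
  by case: (\int[P]_v h^\- v)%E => [r| |]// r0; rewrite ?oppeK; [rewrite leeBlDr// leeDl|rewrite addeNy leNye].
rewrite /log_energy; apply: le_trans kpN; apply: (le_trans (int_le_pos g)).
have kpI v : (\int[P]_w log_kernel v w <= \int[P]_w kp v w)%E.
  apply: (le_trans (int_le_pos _)); rewrite le_eqVlt; apply/orP; left; apply/eqP.
  by apply: eq_integral => w _; rewrite funeposE maxC.
apply: ge0_le_integral.
- exact: measurableT.
- by move=> v _; exact: funepos_ge0.
- exact: measurable_funepos.
- by have := @measurable_fun_fubini_tonelli_F _ _ _ _ R P _ mkp (fun vw => kp0 vw.1 vw.2); exact.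
move=> v _; rewrite funeposE ge_max kpI/=.
by apply: integral_ge0 => w _; exact: kp0.
Qed.

End euclid.

(** * Mean values with respect to [wt] *)

Section green.
Variable R : realType.
Local Notation mu := (@lebesgue_measure R).
Local Notation pT := (plane_mT R).

Definition rect (a b c d : R) : set (R * R) := `[a, b]%classic `*` `[c, d]%classic.

Lemma measurable_rect a b c d : measurable (rect a b c d : set pT).
Proof. by apply: measurableX; exact: measurable_itv. Qed.

Lemma compact_rect a b c d : compact (rect a b c d).
Proof. by apply: compact_setX; exact: segment_compact. Qed.

Lemma area_rect a b c d : (area (rect a b c d : set pT) < +oo)%E.
Proof.
rewrite /area product_measure1E; [|exact: measurable_itv|exact: measurable_itv].
have mf (s t : R) : (lebesgue_measure (`[s, t]%classic : set R) < +oo)%E.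
  by rewrite lebesgue_measure_itv/=; case: ifP => _; rewrite ?ltry// -EFinB ltry.
by apply: lte_mul_pinfty; [exact: measure_ge0|rewrite ge0_fin_numE|]; rewrite ?measure_ge0//; exact: mf.
Qed.

Variables (A : set (R * R)) (a b c d : R).
Hypotheses (oA : open A) (rA : rect a b c d `<=` A).
Local Notation Q := (rect a b c d : set pT).

Let rQ x y : (x \in (`[a, b]%classic : set R)) && (y \in (`[c, d]%classic : set R)) = ((x, y) \in (rect a b c d)).
Proof. by apply/andP/idP; rewrite !inE. Qed.

Lemma continuous_rect_integrable (h : R * R -> R) : (forall z, A z -> {for z, continuous h}) ->
  (@area R).-integrable Q (EFin \o h).
Proof.
move=> ch; apply: measurable_bounded_integrable.
- exact: measurable_rect.
- exact: area_rect.
- exact: (continuous_measurable_plane oA rA ch).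
have : compact (h @` rect a b c d).
  apply: continuous_compact; last exact: compact_rect.
  by apply: continuous_in_subspaceT => z /[!inE] /rA; exact: ch.
move=> /compact_bounded[M [Mr HM]]; exists M; split => // x Mx z Qz; apply: (HM x Mx).
by exists z.
Qed.

Lemma rect_integral (h : R * R -> R) : (forall z, A z -> {for z, continuous h}) ->
  (\int[@area R]_(z in Q) (h z)%:E = \int[mu]_(x in `[a, b]) \int[mu]_(y in `[c, d]) (h (x, y))%:E /\
   \int[@area R]_(z in Q) (h z)%:E = \int[mu]_(y in `[c, d]) \int[mu]_(x in `[a, b]) (h (x, y))%:E)%E.
Proof.
move=> ch; have iH : (@area R).-integrable setT ((EFin \o h : pT -> \bar R) \_ Q).
  by apply/(integrable_mkcond _ (measurable_rect a b c d)); exact: continuous_rect_integrable.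
split; rewrite integral_mkcond.
  rewrite /area -(integral12_prod_meas1 iH) [RHS]integral_mkcond; apply: eq_integral => x _ /=.
  rewrite patchE; case: ifPn => xab; last first.
    apply: integral0_eq => y _.
    by rewrite patchE -rQ (negbTE xab).
  rewrite [RHS]integral_mkcond; apply: eq_integral => y _; rewrite !patchE -rQ.
  by have -> : (x \in (`[a, b]%classic : set R)) by exact: xab.
rewrite /area -(integral21_prod_meas1 iH) [RHS]integral_mkcond; apply: eq_integral => y _ /=.
rewrite patchE; case: ifPn => xab; last first.
  apply: integral0_eq => x _.
  by rewrite patchE -rQ (negbTE xab) andbF.
rewrite [RHS]integral_mkcond; apply: eq_integral => x _; rewrite !patchE -rQ.
have -> : (y \in (`[c, d]%classic : set R)) by exact: xab.
by rewrite andbT.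
Qed.

Let slice1 (u : R * R -> R) (x y : R) e : is_derive ((x, y) : R * R) ((1, 0) : R * R) u e ->
  is_derive x 1 (fun t => u (t, y)) e.
Proof.
move=> /cvg_is_derive du; apply/cvg_is_derive; move: du.
suff -> : (fun h : R => h^-1 *: (u (h *: ((1, 0) : R * R) + (x, y)) - u (x, y))) =
  (fun h : R => h^-1 *: (u (h *: 1 + x, y) - u (x, y))) by [].
by apply/funext => h; congr (_ *: (u (_, _) - _)); rewrite /= scaler0 add0r.
Qed.

Let slice2 (u : R * R -> R) (x y : R) e : is_derive ((x, y) : R * R) ((0, 1) : R * R) u e ->
  is_derive y 1 (fun t => u (x, t)) e.
Proof.
move=> /cvg_is_derive du; apply/cvg_is_derive; move: du.
suff -> : (fun h : R => h^-1 *: (u (h *: ((0, 1) : R * R) + (x, y)) - u (x, y))) =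
  (fun h : R => h^-1 *: (u (x, h *: 1 + y) - u (x, y))) by [].
by apply/funext => h; congr (_ *: (u (_, _) - _)); rewrite /= scaler0 add0r.
Qed.

Let FTC (u u' : R -> R) (s t : R) : s < t -> (forall x, s <= x <= t -> is_derive x 1 u (u' x)) ->
  (forall x, s <= x <= t -> {for x, continuous u'}) -> u s = u t ->
  (\int[mu]_(x in `[s, t]) (u' x)%:E = 0)%E.
Proof.
move=> st du cu' ust; have cu x : s <= x <= t -> {for x, continuous u}.
  by move=> /du [dx _]; apply/differentiable_continuous/derivable1_diffP.
rewrite (@continuous_FTC2 _ u' u)//.
- by rewrite ust -EFinB subrr.
- by apply: continuous_in_subspaceT => x /[!inE]/=; rewrite in_itv/=; exact: cu'.
- split.
  + by move=> x; rewrite in_itv/= => /andP[x1 x2]; have [] := du x; rewrite ?(ltW x1) ?(ltW x2).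
  + by apply: cvg_at_right_filter; apply: cu; rewrite lexx ltW.
  + by apply: cvg_at_left_filter; apply: cu; rewrite lexx ltW.
- by move=> x; rewrite in_itv/= => /andP[x1 x2]; rewrite derive1E; case: (du x) => [|_ ->//]; rewrite (ltW x1) ltW.
Qed.

(** Second Green identity for a harmonic f: on each line f g' - f' g is an antiderivative of f g'' -
    f'' g, and it vanishes at both ends because g and its normal derivative do. *)
Lemma green (f g : R * R -> R) : a < b -> c < d -> Ck 2 A f -> Ck 2 A g ->
  (forall z, A z -> laplacian f z = 0) ->
  (forall y, c <= y <= d -> [/\ g (a, y) = 0, g (b, y) = 0, ddx g (a, y) = 0 & ddx g (b, y) = 0]) ->
  (forall x, a <= x <= b -> [/\ g (x, c) = 0, g (x, d) = 0, ddy g (x, c) = 0 & ddy g (x, d) = 0]) ->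
  (\int[@area R]_(z in Q) (f z * laplacian g z)%:E = 0)%E.
Proof.
move=> ab cd Cf Cg Lf gx gy.
have [fx fy] := Ck_der Cf; have [ggx ggy] := Ck_der Cg.
have [fxx _] := Ck_der fx; have [_ fyy] := Ck_der fy.
have [gxx _] := Ck_der ggx; have [_ gyy] := Ck_der ggy.
have cont k u : Ck k A u -> forall z, A z -> {for z, continuous u} := @Ck_continuous _ k A u.
pose hx z := f z * ddx (ddx g) z - ddx (ddx f) z * g z.
pose hy z := f z * ddy (ddy g) z - ddy (ddy f) z * g z.
have chx z : A z -> {for z, continuous hx}.
  by move=> Az; apply: cvgB; apply: cvgM; [exact: (cont _ _ Cf)|exact: (cont _ _ gxx)|exact: (cont _ _ fxx)|exact: (cont _ _ Cg)].
have chy z : A z -> {for z, continuous hy}.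
  by move=> Az; apply: cvgB; apply: cvgM; [exact: (cont _ _ Cf)|exact: (cont _ _ gyy)|exact: (cont _ _ fyy)|exact: (cont _ _ Cg)].
have inx y : continuous (fun x : R => (x, y) : R * R).
  move=> x; have h1 : {for x, continuous (fun t : R => t)} by exact: cvg_id.
  have h2 : {for x, continuous (fun _ : R => y)} by exact: cvg_cst.
  exact: (cvg_pair h1 h2).
have iny x : continuous (fun y : R => (x, y) : R * R).
  move=> y; have h1 : {for y, continuous (fun t : R => t)} by exact: cvg_id.
  have h2 : {for y, continuous (fun _ : R => x)} by exact: cvg_cst.
  exact: (cvg_pair h2 h1).
have inA x y : a <= x <= b -> c <= y <= d -> A (x, y).
  by move=> xab ycd; apply: rA; split; rewrite /= in_itv.
have Ix : (\int[@area R]_(z in Q) (hx z)%:E = 0)%E.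
  rewrite (rect_integral chx).2; apply: integral0_eq => y /=; rewrite in_itv/= => ycd.
  apply: (@FTC (fun x => f (x, y) * ddx g (x, y) - ddx f (x, y) * g (x, y))) => //.
  - move=> x xab; have Az := inA x y xab ycd.
    have [df _] := Ck_is_derive Cf Az; have [dg _] := Ck_is_derive Cg Az.
    have [dfx _] := Ck_is_derive fx Az; have [dgx _] := Ck_is_derive ggx Az.
    have D := is_derive_add (is_derive_mul df dgx) (is_derive_scale (-1) (is_derive_mul dfx dg)).
    have D' : is_derive ((x, y) : R * R) ((1, 0) : R * R) (fun z => f z * ddx g z - ddx f z * g z) (hx (x, y)).
      rewrite (_ : (fun z => _) = (fun z => f z * ddx g z + (-1) * (ddx f z * g z))).
        apply: is_derive_eq D _; rewrite /hx.
        by move: (f _) (g _) (ddx f _) (ddx g _) (ddx (ddx f) _) (ddx (ddx g) _) => *; ring.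
      by apply/funext => z; rewrite mulN1r.
    exact: slice1 D'.
  - move=> x xab; apply: (@continuous_comp _ _ _ (fun x => (x, y)) hx); first exact: inx.
    by apply: chx; exact: inA.
  - by have [-> -> -> ->] := gx y ycd; rewrite !mulr0.
have Iy : (\int[@area R]_(z in Q) (hy z)%:E = 0)%E.
  rewrite (rect_integral chy).1; apply: integral0_eq => x /=; rewrite in_itv/= => xab.
  apply: (@FTC (fun y => f (x, y) * ddy g (x, y) - ddy f (x, y) * g (x, y))) => //.
  - move=> y ycd; have Az := inA x y xab ycd.
    have [_ df] := Ck_is_derive Cf Az; have [_ dg] := Ck_is_derive Cg Az.
    have [_ dfx] := Ck_is_derive fy Az; have [_ dgx] := Ck_is_derive ggy Az.
    have D := is_derive_add (is_derive_mul df dgx) (is_derive_scale (-1) (is_derive_mul dfx dg)).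
    have D' : is_derive ((x, y) : R * R) ((0, 1) : R * R) (fun z => f z * ddy g z - ddy f z * g z) (hy (x, y)).
      rewrite (_ : (fun z => _) = (fun z => f z * ddy g z + (-1) * (ddy f z * g z))).
        apply: is_derive_eq D _; rewrite /hy.
        by move: (f _) (g _) (ddy f _) (ddy g _) (ddy (ddy f) _) (ddy (ddy g) _) => *; ring.
      by apply/funext => z; rewrite mulN1r.
    exact: slice2 D'.
  - move=> y ycd; apply: (@continuous_comp _ _ _ (fun y => (x, y)) hy); first exact: iny.
    by apply: chy; exact: inA.
  - by have [-> -> -> ->] := gy x xab; rewrite !mulr0.
transitivity (\int[@area R]_(z in Q) (hx z + hy z)%:E)%E.
  apply: eq_integral => z /[!inE] /rA Az; congr (_ %:E).
  have := Lf z Az; rewrite /laplacian /hx /hy.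
  move: (f z) (g z) (ddx (ddx f) z) (ddx (ddx g) z) (ddy (ddy f) z) (ddy (ddy g) z) => p q s t u v.
  by move/eqP; rewrite addr_eq0 => /eqP ->; ring.
rewrite (@integralD_EFin _ _ _ (@area R) Q (measurable_rect a b c d) hx hy).
- by transitivity (0 + 0 : \bar R)%E; [congr (_ + _)%E; [exact: Ix|exact: Iy]|exact: adde0].
- by have := continuous_rect_integrable chx; exact.
- by have := continuous_rect_integrable chy; exact.
Qed.

End green.

(** For extended reals oo - oo is -oo, so an integral equal to 0 can only be a difference of two
    finite parts. *)
Lemma integral0_integrable d (T : measurableType d) (R : realType) (mu : {measure set T -> \bar R})
    (D : set T) (f : T -> \bar R) : measurable D -> measurable_fun D f ->
  (\int[mu]_(x in D) f x = 0)%E -> mu.-integrable D f.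
Proof.
move=> mD mf; rewrite integralE.
have p0 : (0 <= \int[mu]_(x in D) f^\+ x)%E by apply: integral_ge0 => x _; exact: funepos_ge0.
have n0 : (0 <= \int[mu]_(x in D) f^\- x)%E by apply: integral_ge0 => x _; exact: funeneg_ge0.
move=> h; have [pf nf] : (\int[mu]_(x in D) f^\+ x < +oo)%E /\ (\int[mu]_(x in D) f^\- x < +oo)%E.
  move: p0 n0 h; case: (\int[mu]_(x in D) f^\+ x)%E => [p| |]//; case: (\int[mu]_(x in D) f^\- x)%E => [n| |]//.
  by move=> _ _ _; split; exact: ltry.
apply/integrableP; split => //.
rewrite (eq_integral (fun x => f^\+ x + f^\- x)%E); last first.
  by move=> x _; have := congr1 (@^~ x) (fune_abse f).
rewrite (ge0_integralD mu mD (fun x _ => funepos_ge0 f x) (measurable_funepos mf)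
  (fun x _ => funeneg_ge0 f x) (measurable_funeneg mf)).
exact: lte_add_pinfty.
Qed.

Section means.
Variables (R : realType) (k th : R -> R) (c : R).
Local Notation mu := (@lebesgue_measure R).
Local Notation pT := (plane_mT R).
Local Notation beta := (fun x : R => c * (flat 0 (x + 1) * flat 0 (- x))).
Hypothesis dk : forall x : R, is_derive x 1 k (th x).
Hypothesis dth : forall x : R, is_derive x 1 th (beta x).
Hypothesis c0 : 0 < c.
Hypothesis k_id : forall x : R, 0 <= x -> k x = x.
Hypothesis k_cst : forall x : R, x <= -1 -> k x = k (-1).

Let cb : continuous beta. Proof. exact: continuous_beta. Qed.
Let b0 x : 0 <= beta x. Proof. exact: beta_ge0. Qed.

Lemma mass_fin : exists2 m : R, 0 < m & ((2 * pi)%:E * mass beta = m%:E)%E.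
Proof.
have p0 : 0 < 2 * pi :> R by rewrite mulr_gt0 ?pi_gt0.
have f1 x : flat 0 x <= 1 :> R.
  rewrite /flat; case: ifPn => // x0; rewrite expr0 mul1r -expR0 ler_expR oppr_le0 invr_ge0 ltW//.
have ub : (mass beta <= (4 * c)%:E)%E.
  have -> : (4 * c)%:E = (\int[mu]_(x in `[(-1)%R, 0%R]) (cst (4 * c)%:E) x)%E.
    rewrite integral_cst; last exact: measurable_itv.
    have mE : lebesgue_measure (`[(-1)%R, 0%R]%classic : set R) = 1%E.
      by rewrite lebesgue_measure_itv/= lte_fin ltrN10 -EFinB sub0r opprK.
    by transitivity ((4 * c)%:E * 1)%E; [rewrite mule1|congr (_ * _)%E].
  rewrite [leRHS]integral_mkcond; apply: ge0_le_integral.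
  - exact: measurableT.
  - by move=> x _; rewrite lee_fin mulr_ge0.
  - apply/measurable_EFinP; apply: measurable_funM; first exact: measurable_cst.
    apply: (measurableT_comp (continuous_measurable_fun cb)).
    by apply: measurable_funM => //; exact: measurable_cst.
  - by apply/(measurable_restrictT _ (measurable_itv _)); exact: measurable_cst.
  move=> x _; rewrite patchE; case: ifPn => [_|]; rewrite ?lee_fin.
    rewrite ler_wpM2l// ler_piMr ?(ltW c0)//.
    by rewrite mulr_ile1 ?flat_ge0.
  rewrite notin_setE/= in_itv/= => /negP; rewrite negb_and -!ltNge => h.
  have [->|/beta_supp] := eqVneq (beta (2 * x)) 0; first by rewrite mulr0.
  by move=> /andP[h1 h2]; move: h => /orP[]; lra.
(* For x in [- 3/8, - 1/8] both 2 x + 1 and - 2 x are at least 1/4, where [flat 0] is at least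
   e^(-4). Hence beta (2 x) >= e on an interval of length 1/4. *)
pose e : R := c * (expR (- 4) * expR (- 4)).
have e0 : 0 < e by rewrite mulr_gt0// mulr_gt0 ?expR_gt0.
have fl x : 4^-1 <= x -> expR (- 4) <= flat 0 x :> R.
  move=> x4; have x0 : 0 < x by apply: lt_le_trans x4; rewrite invr_gt0.
  by rewrite /flat x0 expr0 mul1r ler_expR lerN2 -[leRHS]invrK lef_pV2 ?posrE// invr_gt0.
have lb : (((4 * e) * 4^-1)%:E <= mass beta)%E.
  have -> : (4 * e * 4^-1)%:E = (\int[mu]_(x in `[(- (3 / 8))%R, (- (1 / 8))%R]) (cst (4 * e)%:E) x)%E.
    rewrite integral_cst; last exact: measurable_itv.
    have mE : lebesgue_measure (`[(- (3 / 8))%R, (- (1 / 8))%R]%classic : set R) = (4^-1)%:E.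
      rewrite lebesgue_measure_itv/= lte_fin ifT; last by lra.
      by rewrite -EFinB; congr (_ %:E); lra.
    by transitivity ((4 * e)%:E * (4^-1)%:E)%E; [rewrite -EFinM|congr (_ * _)%E].
  rewrite [leLHS]integral_mkcond; apply: ge0_le_integral.
  - exact: measurableT.
  - by move=> x _; rewrite patchE; case: ifP => // _; rewrite lee_fin mulr_ge0// ltW.
  - by apply/(measurable_restrictT _ (measurable_itv _)); exact: measurable_cst.
  - apply/measurable_EFinP; apply: measurable_funM; first exact: measurable_cst.
    apply: (measurableT_comp (continuous_measurable_fun cb)).
    by apply: measurable_funM => //; exact: measurable_cst.
  move=> x _; rewrite patchE; case: ifPn => [|_]; rewrite ?lee_fin; last by rewrite mulr_ge0.
  rewrite inE/= in_itv/= => /andP[x1 x2]; rewrite /cst ler_wpM2l// /e ler_pM2l//.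
  by rewrite ler_pM ?expR_ge0//; apply: fl; lra.
move: ub lb; case: (mass beta) => [m| |]//; rewrite !lee_fin => ub lb.
by exists (2 * pi * m) => //; rewrite mulr_gt0//; lra.
Qed.

Variables (cm : R).
Hypotheses (cm0 : 0 < cm) (cmE : ((2 * pi)%:E * mass beta = cm%:E)%E).

Definition wt l z (w : R * R) : R := kernel beta l (cexp z) (cexp w) * expR w.1 ^+ 2.

Lemma wt_ge0 l z w : 0 <= wt l z w.
Proof. by rewrite /wt mulr_ge0 ?sqr_ge0// kernel_ge0. Qed.

(** The inner radius matters twice: it separates the supports for l and l' once l' < l - 1, and it
    is the source of the gain in [mean_sqr]. *)
Lemma wt_supp l z w : wt l z w != 0 -> expR (l - 1) <= sqd (cexp w) (cexp z) <= expR l.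
Proof.
rewrite /wt /kernel => h; have S0 : 0 < sqd (cexp w) (cexp z).
  rewrite lt_neqAle sqd_ge0 andbT; apply: contraNneq h => <-.
  by rewrite invr0 mulr0 mul0r.
have : beta (ln (sqd (cexp w) (cexp z)) - l) != 0.
  by apply: contraNneq h => ->; rewrite mulr0 !mul0r.
move=> /beta_supp/andP[h1 h2]; rewrite -{1 2}(@lnK _ (sqd _ _)) ?posrE// !ler_expR.
by apply/andP; split; lra.
Qed.

Let mcexp : measurable_fun (setT : set pT) (@cexp R : pT -> pT).
Proof.
have mexp : measurable_fun (setT : set pT) (fun z : pT => expR z.1).
  by apply: measurableT_comp; [exact: measurable_expR|exact: measurable_fst].
apply: measurable_fun_pair; apply: measurable_funM => //;
by apply: measurableT_comp; [apply: continuous_measurable_fun; first [exact: continuous_cos|exact: continuous_sin]|exact: measurable_snd].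
Qed.

Lemma measurable_wt l z : measurable_fun (setT : set pT) (wt l z : pT -> measurableTypeR R).
Proof.
apply: measurable_funM; first exact: (measurableT_comp (measurable_kernel cb l (cexp z)) mcexp).
apply: measurable_funX; exact: (measurableT_comp (@measurable_expR R) measurable_fst).
Qed.

Variables (z : R * R) (d : R).
Hypotheses (d0 : 0 < d) (dpi : d < pi).
Definition box : set (R * R) := rect (z.1 - d) (z.1 + d) (z.2 - d) (z.2 + d).
Local Notation D := (box : set pT).

(* Up to the period 2 pi i, the disc |e^w - e^z|^2 <= e^l lies in the box. *)
Definition fits l := forall w, `|w.2 - z.2| <= pi -> sqd (cexp w) (cexp z) <= expR l ->
  `|w.1 - z.1| < d /\ `|w.2 - z.2| < d.

Lemma fits_le l l' : l' <= l -> fits l -> fits l'.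
Proof. by move=> ll H w wpi h; apply: H => //; apply: le_trans h _; rewrite ler_expR. Qed.

Lemma boxP w : box w <-> `|w.1 - z.1| <= d /\ `|w.2 - z.2| <= d.
Proof.
rewrite /box /rect /= !in_itv/= !ler_norml; split => -[/andP[? ?] /andP[? ?]]; split; apply/andP; lra.
Qed.

Let mD : measurable D. Proof. exact: measurable_rect. Qed.

(** The disc fits into the box, so within a strip of height 2 pi the weight vanishes off the box and
    the integral is the full polar integral. *)
Lemma mean_annular l (f : R * R -> \bar R) : fits l -> measurable_fun (setT : set pT) f ->
  (forall v, 0 <= f v)%E ->
  (\int[@area R]_(w in D) (f (cexp w) * (wt l z w)%:E) = annular beta l f (cexp z))%E.
Proof.
move=> fl mf f0.
have mfw : measurable_fun (setT : set pT) (fun w => f (cexp w) * (wt l z w)%:E)%E.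
  apply: emeasurable_funM; first exact: (measurableT_comp mf mcexp).
  by apply/measurable_EFinP; exact: measurable_wt.
pose F := ((fun w : pT => f (cexp w) * (wt l z w)%:E)%E \_ D).
have mF : measurable_fun setT F.
  by apply/(measurable_restrictT _ mD); exact: measurable_funTS.
have F0 w : (0 <= F w)%E.
  by rewrite /F patchE; case: ifP => // _; apply: mule_ge0 => //; rewrite lee_fin wt_ge0.
rewrite integral_mkcond -/F /area (@fubini_tonelli2 _ _ _ _ R mu mu F mF F0).
rewrite -(annular_polar cb b0 l (cexp z) (z.2 - pi) mf f0) [RHS]integral_mkcond.
apply: eq_integral => y _; rewrite patchE; case: ifPn => [|] yI.
  apply: eq_integral => x _; rewrite /F patchE; case: ifPn => // xyD.
  have [e|/wt_supp/andP[_ h]] := eqVneq (wt l z (x, y)) 0.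
    by move: e; rewrite /wt/= => ->; rewrite mule0.
  exfalso; move: xyD; rewrite notin_setE; apply; apply/boxP.
  have [|/ltW ? /ltW ?] := fl (x, y) _ h; last by split.
  move: yI; rewrite inE/= in_itv/= ler_norml => /andP[? ?]; apply/andP; lra.
apply: integral0_eq => x _; rewrite /F patchE; case: ifPn => //.
rewrite inE => /boxP[_ /= h]; exfalso; move: yI; rewrite notin_setE; apply.
move: h; rewrite /= in_itv/= ler_norml => /andP[h1 h2]; have := dpi.
by move: h1 h2; move: (y : R) => t h1 h2 h3; apply/andP; split; lra.
Qed.

Lemma mean_cst l (a : R) : fits l -> 0 <= a -> (\int[@area R]_(w in D) (a * wt l z w)%:E = (a * cm)%:E)%E.
Proof.
move=> fl a0; have := @mean_annular l (cst a%:E) fl (measurable_cst _) (fun _ => a0).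
rewrite (_ : (fun w => _) = (fun w => (a * wt l z w)%:E)%E) => [->|//].
have p0 : 0 < 2 * pi :> R by rewrite mulr_gt0 ?pi_gt0.
have mcirc : (\int[mu]_(t in `[0%R, (2 * pi)%R[) (cst a%:E) t = (a * (2 * pi))%:E)%E.
  rewrite integral_cst; last exact: measurable_itv.
  have mE : lebesgue_measure (`[0%R, (2 * pi)%R[%classic : set R) = (2 * pi)%:E.
    by rewrite lebesgue_measure_itv/= lte_fin p0 sube0.
  by transitivity (a%:E * (2 * pi)%:E)%E; [congr (_ * _)%E|rewrite -EFinM].
have -> : (a * cm)%:E = ((a * (2 * pi))%:E * mass beta)%E by rewrite !EFinM -cmE muleA.
apply/eqP; rewrite eq_le; apply/andP; split.
  apply: annular_le => //; first by rewrite lee_fin mulr_ge0// ltW.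
  by move=> x _; rewrite mcirc.
apply: annular_ge => //; first by rewrite mulr_ge0// ltW.
by move=> x _; rewrite mcirc.
Qed.

(** Over a circle of radius r the mean of |v|^2 exceeds its central value by r^2, and r^2 >= e^(l -
    1) on the support of the weight. *)
Lemma mean_sqr l : fits l ->
  ((cm * (expR z.1 ^+ 2 + expR (l - 1)))%:E <=
   \int[@area R]_(w in D) (expR w.1 ^+ 2 * wt l z w)%:E)%E.
Proof.
move=> fl; have S0 (v : R * R) : (0 <= (sqd v (0, 0))%:E)%E by rewrite lee_fin sqd_ge0.
have mS : measurable_fun (setT : set pT) (fun v => (sqd v (0, 0))%:E).
  by apply/measurable_EFinP; exact: measurable_sqd.
have SE v : sqd (cexp v) (0, 0) = expR v.1 ^+ 2 :> R.
  by rewrite /sqd /cexp/= !subr0 !exprMn -mulrDr cos2Dsin2 mulr1.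
have := mean_annular fl mS S0.
rewrite (_ : (fun w => _) = (fun w => (expR w.1 ^+ 2 * wt l z w)%:E)%E); last first.
  by apply/funext => w; rewrite SE.
move=> ->.
have -> : (cm * (expR z.1 ^+ 2 + expR (l - 1)))%:E =
    ((2 * pi * (expR z.1 ^+ 2 + expR (l - 1)))%:E * mass beta)%E.
  by rewrite mulrC EFinM -cmE muleA -EFinM (mulrC _ (2 * pi)).
apply: annular_ge => //.
  by rewrite mulr_ge0 ?mulr_ge0 ?pi_ge0// addr_ge0 ?sqr_ge0 ?expR_ge0.
move=> x /beta_supp/andP[h1 h2]; rewrite circle_mean_sqr SE lee_fin ler_wpM2l ?mulr_ge0 ?pi_ge0//.
by rewrite lerD2l -expRM_natl ler_expR; lra.
Qed.

Lemma mean_subharmonic l (V : R * R -> \bar R) (C : R) : fits l -> subharmonic V ->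
  (forall v, sqd v (cexp z) <= expR l -> (V v <= C%:E)%E) ->
  (\int[@area R]_(w in D) (maxe 0 (C%:E - V (cexp w)) * (wt l z w)%:E) <= cm%:E * (C%:E - V (cexp z)))%E.
Proof.
move=> fl sV VC; have [Vfin lV _] := sV.
have mV : measurable_fun (setT : set pT) (fun v => maxe 0 (C%:E - V v))%E.
  apply: measurable_maxe; first exact: measurable_cst.
  by apply: emeasurable_funD; [exact: measurable_cst|exact: lsc_measurable_plane].
have V0 v : (0 <= maxe 0 (C%:E - V v))%E by rewrite le_max lexx.
rewrite (mean_annular fl mV V0) -cmE -muleA (muleC (mass _)) muleA.
apply: annular_le => //.
  apply: mule_ge0; first by rewrite lee_fin mulr_ge0 ?pi_ge0.
  rewrite sube_ge0; last by rewrite orbT.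
  by apply: VC; rewrite /sqd !subrr expr0n/= addr0 expR_ge0.
move=> x /beta_supp/andP[h1 h2].
apply: (subharmonic_circle sV (expR_gt0 x) _).2 => t; apply: VC.
by rewrite sqd_circle -expRM_natl ler_expR; lra.
Qed.

(** The supports for l and l' are disjoint, so the two integrals are those of the positive and
    negative parts of (C - h)(wt l - wt l'). That function has integral 0, which makes them finite
    and equal. *)
Lemma integral_wt_eq l l' (h : R * R -> \bar R) (C : R) : fits l -> l' < l - 1 ->
  measurable_fun D h -> (forall w, D w -> h w <= C%:E)%E ->
  (\int[@area R]_(w in D) (h w * (wt l z w - wt l' z w)%:E) = 0)%E ->
  (\int[@area R]_(w in D) (maxe 0 (C%:E - h w) * (wt l z w)%:E) =
   \int[@area R]_(w in D) (maxe 0 (C%:E - h w) * (wt l' z w)%:E))%E /\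
  (\int[@area R]_(w in D) (maxe 0 (C%:E - h w) * (wt l z w)%:E) < +oo)%E.
Proof.
move=> fl ll mh hC I0; have fl' : fits l' by apply: fits_le fl; lra.
have mw m : measurable_fun D (fun w => (wt m z w)%:E).
  by apply/measurable_EFinP; apply: measurable_funTS; exact: measurable_wt.
have mG : measurable_fun D (fun w => maxe 0 (C%:E - h w))%E.
  apply: measurable_maxe; first exact: measurable_cst.
  by apply: emeasurable_funB => //; exact: measurable_cst.
pose Dl w := wt l z w - wt l' z w.
have mDl : measurable_fun D (fun w => (Dl w)%:E).
  by apply/measurable_EFinP; apply: measurable_funB; apply/measurable_EFinP; exact: mw.
have iw m : fits m -> (@area R).-integrable D (fun w => (wt m z w)%:E).
  move=> fm; apply/integrableP; split; first exact: mw.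
  under eq_integral do rewrite gee0_abs ?lee_fin ?wt_ge0// -[wt _ _ _]mul1r.
  by rewrite mean_cst// ltry.
have iDl : (@area R).-integrable D (fun w => (C * Dl w)%:E).
  rewrite (_ : (fun w => _) = (fun w => C%:E * ((wt l z w)%:E - (wt l' z w)%:E))%E)//.
  by apply: integrableZl => //; apply: integrableB => //; exact: iw.
have IDl : (\int[@area R]_(w in D) (C * Dl w)%:E = 0)%E.
  rewrite (_ : (fun w => _) = (fun w => C%:E * ((wt l z w)%:E - (wt l' z w)%:E))%E)//.
  rewrite integralZl//; last by apply: integrableB => //; exact: iw.
  rewrite integralB//; [|exact: iw|exact: iw].
  have E m : fits m -> (\int[@area R]_(w in D) (wt m z w)%:E = cm%:E)%E.
    move=> fm; rewrite -[RHS]/(cm%:E) -(mul1r cm) -(mean_cst fm)//.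
    by apply: eq_integral => w _; rewrite mul1r.
  by rewrite !E// -EFinB subrr mule0.
have mF : measurable_fun D (fun w => h w * (Dl w)%:E)%E by exact: emeasurable_funM.
have iF := integral0_integrable mD mF I0.
pose G w := (maxe 0 (C%:E - h w) * (Dl w)%:E)%E.
have GE w : D w -> (G w = (C * Dl w)%:E - h w * (Dl w)%:E)%E.
  move=> Dw; rewrite /G (max_idPr _); last by rewrite sube_ge0 ?orbT// hC.
  move: (hC w Dw); case: (h w) => [r| |]// _; first by rewrite -!EFinM -!EFinB mulrBl.
  have [s0|s0|->] := ltgtP (Dl w) 0; rewrite /=.
  - by rewrite lt0_mulye ?lte_fin// lt0_mulNye ?lte_fin//.
  - by rewrite gt0_mulye ?lte_fin// gt0_mulNye ?lte_fin//.
  - by rewrite !mule0 mulr0 sube0.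
have iG : (@area R).-integrable D G.
  have := integrableB mD iDl iF; apply: eq_integrable; first exact: mD.
  by move=> w /[!inE] Dw; rewrite GE.
have IG : (\int[@area R]_(w in D) G w = 0)%E.
  transitivity (\int[@area R]_(w in D) ((C * Dl w)%:E - h w * (Dl w)%:E))%E.
    by apply: eq_integral => w /[!inE]; exact: GE.
  by rewrite integralB// IDl I0 sube0.
have disj w : wt l z w = 0 \/ wt l' z w = 0.
  have [|h1] := eqVneq (wt l z w) 0; first by left.
  have [|h2] := eqVneq (wt l' z w) 0; first by right.
  have /andP[h3 _] := wt_supp h1; have /andP[_ h4] := wt_supp h2.
  by have := le_trans h3 h4; rewrite ler_expR; lra.
have Gp w : (G^\+ w = maxe 0 (C%:E - h w) * (wt l z w)%:E)%E.
  have m0 : (0 <= maxe 0 (C%:E - h w))%E by rewrite le_max lexx.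
  rewrite funeposE /G /Dl; have [->|->] := disj w.
    rewrite sub0r mule0; apply/max_idPr; rewrite EFinN muleN oppe_le0.
    by apply: mule_ge0 => //; rewrite lee_fin wt_ge0.
  rewrite subr0; apply/max_idPl; apply: mule_ge0 => //; by rewrite lee_fin wt_ge0.
have Gn w : (G^\- w = maxe 0 (C%:E - h w) * (wt l' z w)%:E)%E.
  have m0 : (0 <= maxe 0 (C%:E - h w))%E by rewrite le_max lexx.
  rewrite funenegE /G /Dl; have [->|->] := disj w.
    rewrite sub0r EFinN muleN oppeK; apply/max_idPl; apply: mule_ge0 => //; by rewrite lee_fin wt_ge0.
  rewrite subr0 mule0; apply/max_idPr; rewrite oppe_le0.
  by apply: mule_ge0 => //; rewrite lee_fin wt_ge0.
have Ip := integrable_pos_fin_num mD iG; have In := integrable_neg_fin_num mD iG.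
have EIp : (\int[@area R]_(w in D) G^\+ w = \int[@area R]_(w in D) (maxe 0 (C%:E - h w) * (wt l z w)%:E))%E.
  by apply: eq_integral => w _; exact: Gp.
have EIn : (\int[@area R]_(w in D) G^\- w = \int[@area R]_(w in D) (maxe 0 (C%:E - h w) * (wt l' z w)%:E))%E.
  by apply: eq_integral => w _; exact: Gn.
have {}IG : (\int[@area R]_(w in D) G^\+ w - \int[@area R]_(w in D) G^\- w = 0)%E by rewrite -integralE.
move: IG Ip In; rewrite EIp EIn; move: (integral _ _ _) (integral _ _ _) => x y.
case: x => [x| |]//; case: y => [y| |]// [/eqP]; rewrite subr_eq0 => /eqP -> _ _.
by split => //; exact: ltry.
Qed.

(** The weighted mean is the same for all smaller discs. On a small enough one, semicontinuity keeps
    C - h above any number below C - h z, so the mean of h is at most its value at the centre. *)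
Lemma mean_usc l (h : R * R -> \bar R) (C : R) : fits l ->
  measurable_fun D h -> (forall w, D w -> h w <= C%:E)%E ->
  (forall a : R, a%:E < C%:E - h z -> \forall w \near z, a%:E < C%:E - h w)%E ->
  (forall l' : R, (l' < l - 1)%R -> \int[@area R]_(w in D) (h w * (wt l z w - wt l' z w)%:E) = 0)%E ->
  (\int[@area R]_(w in D) (maxe 0 (C%:E - h w) * (wt l z w)%:E) < +oo)%E /\
  (cm%:E * (C%:E - h z) <= \int[@area R]_(w in D) (maxe 0 (C%:E - h w) * (wt l z w)%:E))%E.
Proof.
move=> fl mh hC usc I0; set I := (\int[_]_(w in D) _)%E.
have Ifin : (I < +oo)%E.
  by apply: (integral_wt_eq fl _ mh hC (I0 (l - 2) _)).2; lra.
split => //.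
have key (a : R) : 0 <= a -> (a%:E < C%:E - h z)%E -> ((a * cm)%:E <= I)%E.
  move=> a0 /usc /nbhs_ballP[e /= e0 He].
  pose d' := Num.min (e / 2) d; have d'0 : 0 < d' by rewrite lt_min d0 divr_gt0.
  have d'pi : d' < pi by apply: le_lt_trans dpi; rewrite ge_min lexx orbT.
  have [l0 Hl0] := log_disc d'0 d'pi.
  (* The first bound separates the two annuli, the second puts the smaller one into the
     neighbourhood given by semicontinuity. *)
  pose l' := Num.min (l - 2) (l0 + 2 * z.1).
  have l'l : l' < l - 1 by apply: (@le_lt_trans _ _ (l - 2)); [rewrite ge_min lexx|lra].
  rewrite /I (integral_wt_eq fl l'l mh hC (I0 _ l'l)).1.
  have fl' : fits l' by apply: fits_le fl; lra.
  rewrite -(mean_cst fl' a0); apply: ge0_le_integral.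
  - exact: mD.
  - by move=> w _; rewrite lee_fin mulr_ge0// wt_ge0.
  - by apply/measurable_EFinP; apply: measurable_funM; [exact: measurable_cst|apply: measurable_funTS; exact: measurable_wt].
  - apply: emeasurable_funM; last by apply/measurable_EFinP; apply: measurable_funTS; exact: measurable_wt.
    apply: measurable_maxe; first exact: measurable_cst.
    by apply: emeasurable_funB => //; exact: measurable_cst.
  move=> w /boxP[_ w2]; have [->|/wt_supp/andP[_ h']] := eqVneq (wt l' z w) 0.
    by rewrite mulr0 mule0.
  rewrite EFinM; apply: lee_wpmul2r; first by rewrite lee_fin wt_ge0.
  rewrite le_max; apply/orP; right; apply/ltW/He.
  have [||v1 v2] := Hl0 z w; first by rewrite (le_trans w2)// ltW.
    by apply: le_trans h' _; rewrite ler_expR ge_min lexx orbT.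
  have de : d' <= e / 2 by rewrite ge_min lexx.
  by split; rewrite /ball/= distrC; lra.
have I_0 : (0 <= I)%E.
  by apply: integral_ge0 => w _; apply: mule_ge0; [rewrite le_max lexx|rewrite lee_fin wt_ge0].
move: Ifin I_0 key; case: I => [i| |]// _; rewrite lee_fin => i0 key.
have hzC : (h z <= C%:E)%E by apply: hC; apply/boxP; rewrite !subrr normr0 ltW.
rewrite leNgt; apply/negP => hlt.
(* A contradiction comes from a number strictly between i / cm and C - h z: the midpoint if h z is
   finite, and i / cm + 1 if h z = -oo. *)
case: (h z) hzC hlt key => [r| |]//; rewrite ?lee_fin.
  rewrite -EFinB -EFinM lte_fin => rC hlt key.
  have : (((C - r + i / cm) / 2 * cm)%:E <= i%:E)%E.
    apply: key; first by rewrite divr_ge0// addr_ge0 ?subr_ge0// divr_ge0// ltW.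
    have : i / cm < C - r by rewrite ltr_pdivrMr// mulrC.
    by rewrite lte_fin; lra.
  rewrite lee_fin mulrAC mulrDl mulfVK ?gt_eqF//.
  by rewrite (mulrC (C - r)); lra.
move=> _ _ key; have : (((i / cm + 1) * cm)%:E <= i%:E)%E.
  by apply: key; [rewrite addr_ge0// divr_ge0// ltW|rewrite ltry].
by rewrite lee_fin mulrDl mulfVK ?gt_eqF// mul1r => h2; have := cm0; lra.
Qed.

(** The difference of the weights is the Laplacian of [log_bump], which vanishes near the sides of
    the box, so Green's identity has no boundary terms. *)
Lemma harmonic_wt l l' (A : set (R * R)) (f : R * R -> R) : open A -> box `<=` A -> Ck 2 A f ->
  (forall w, A w -> laplacian f w = 0) -> fits l -> l' < l - 1 ->
  (\int[@area R]_(w in D) ((f w)%:E * (wt l z w - wt l' z w)%:E) = 0)%E.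
Proof.
move=> oA DA Cf Lf fl ll; pose g := log_bump k l l' (cexp z).
have g0 w : expR l < sqd (cexp w) (cexp z) -> g w = 0.
  move=> h; apply: log_bump_far => //; first exact: ltW.
  by apply/ltW; apply: le_lt_trans h; rewrite ler_expR; lra.
have cS : continuous (fun w => sqd (cexp w) (cexp z)).
  have ce : continuous (fun w : R * R => expR w.1) by move=> w; apply: continuous_comp; [exact: cvg_fst|exact: continuous_expR].
  have cc : continuous (fun w : R * R => cos w.2) by move=> w; apply: continuous_comp; [exact: cvg_snd|exact: continuous_cos].
  have cs : continuous (fun w : R * R => sin w.2) by move=> w; apply: continuous_comp; [exact: cvg_snd|exact: continuous_sin].
  have sq (u : R * R -> R) (a : R) : continuous u -> continuous (fun w => (u w - a) ^+ 2).
    move=> cu w; rewrite (_ : (fun w => _) = (fun w => (u w - a) * (u w - a))); last by apply/funext => t; rewrite expr2.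
    by apply: cvgM; apply: cvgB; [exact: cu|exact: cvg_cst|exact: cu|exact: cvg_cst].
  have s1 : continuous (fun w : R * R => (expR w.1 * cos w.2 - (cexp z).1) ^+ 2).
    by apply: (sq (fun w => expR w.1 * cos w.2)) => t; apply: cvgM; [exact: ce|exact: cc].
  have s2 : continuous (fun w : R * R => (expR w.1 * sin w.2 - (cexp z).2) ^+ 2).
    by apply: (sq (fun w => expR w.1 * sin w.2)) => t; apply: cvgM; [exact: ce|exact: cs].
  by move=> w; exact: cvgD (s1 w) (s2 w).
have oS : open [set w | expR l < sqd (cexp w) (cexp z)].
  by apply: (@open_comp _ _ (fun w => sqd (cexp w) (cexp z)) [set x | expR l < x]); [move=> w _; exact: cS|exact: open_gt].
have Dg0 (e w : R * R) : expR l < sqd (cexp w) (cexp z) -> 'D_e g w = 0.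
  move=> h; transitivity ('D_e (cst 0 : R * R -> R) w); last exact: derive_cst.
  by apply: near_eq_derive; apply: filterS (open_near oS h) => t; exact: g0.
(* By [fits], points of the closed box on its sides lie outside the disc that carries the bump. *)
have far w : `|w.2 - z.2| <= d -> (d <= `|w.1 - z.1|) || (d <= `|w.2 - z.2|) ->
    expR l < sqd (cexp w) (cexp z).
  move=> w2 h; rewrite ltNge; apply/negP => /fl[]; first exact: le_trans w2 (ltW dpi).
  by move=> h1 h2; move: h; rewrite leNgt h1 leNgt h2.
have Cg : Ck 2 A g.
  apply: (@Ck_subset _ _ setT) => //; apply: locally_sm_Ck.
  have := smooth_log_bump dk dth k_cst l l' (cexp z) 0 (0, 0).
  rewrite (_ : (fun w => _) = g)//; apply/funext => -[w1 w2].
  by rewrite /= mul0r expR0 mul1r !addr0.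
have ab1 : z.1 - d < z.1 + d by have := d0; move: (z.1) => t; lra.
have ab2 : z.2 - d < z.2 + d by have := d0; move: (z.2) => t; lra.
rewrite -(@green _ A _ _ _ _ oA DA f g ab1 ab2 Cf Cg Lf).
- by apply: eq_integral => w _; rewrite -EFinM /g (laplacian_log_bump dk dth k_cst).
- move=> y /andP[y1 y2]; have yd : `|y - z.2| <= d by rewrite ler_norml; apply/andP; lra.
  have e1 : (d <= `|(z.1 - d) - z.1|) by rewrite addrAC subrr add0r normrN ger0_norm// ltW.
  have e2 : (d <= `|(z.1 + d) - z.1|) by rewrite addrAC subrr add0r ger0_norm// ltW.
  by split; [apply: g0|apply: g0|apply: Dg0|apply: Dg0]; apply: far => //=; rewrite ?e1 ?e2.
- move=> x _.
  have e1 : (`|(z.2 - d) - z.2| = d) by rewrite addrAC subrr add0r normrN ger0_norm// ltW.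
  have e2 : (`|(z.2 + d) - z.2| = d) by rewrite addrAC subrr add0r ger0_norm// ltW.
  by split; [apply: g0|apply: g0|apply: Dg0|apply: Dg0]; apply: far; rewrite /= ?e1 ?e2 ?lexx ?orbT.
Qed.

End means.

(** * The torus *)

Local Open Scope quotient_scope.

Section torus_topology.
Variables (R : realType) (P : R).
Local Notation pr := (@tproj R P).
Local Notation tor := (torus P).

Lemma tprojP (z w : R * R) : pr z = pr w <->
  exists m n : int, w.1 - z.1 = m%:~R * P /\ w.2 - z.2 = n%:~R * (2 * pi).
Proof.
split=> [|h].
  by move/(@eqmodP _ (lattice_equiv P) z w) => /asboolP.
by apply/(@eqmodP _ (lattice_equiv P) z w)/asboolP.
Qed.

Lemma tproj_surj (p : tor) : exists z, pr z = p.
Proof. by exists (repr p); rewrite /tproj reprK. Qed.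

Lemma continuous_tproj : continuous pr.
Proof. exact: pi_continuous. Qed.

Lemma open_tprojE (U : set tor) : open U = open (pr @^-1` U).
Proof. by []. Qed.

Definition lattice (lam : R * R) : Prop := exists m n : int, lam.1 = m%:~R * P /\ lam.2 = n%:~R * (2 * pi).

Lemma tproj_add (z lam : R * R) : lattice lam -> pr (z.1 + lam.1, z.2 + lam.2) = pr z.
Proof.
by move=> [m [n [e1 e2]]]; apply/esym/tprojP; exists m, n; rewrite !(addrC z.1) !(addrC z.2) !addrK.
Qed.

Lemma tproj_lattice (z w : R * R) : pr z = pr w -> lattice (w.1 - z.1, w.2 - z.2).
Proof. by move/tprojP => [m [n [e1 e2]]]; exists m, n. Qed.

Lemma continuous_translation (lam : R * R) : continuous (fun z : R * R => (z.1 + lam.1, z.2 + lam.2)).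
Proof.
move=> z; have c1 : {for z, continuous (fun z : R * R => z.1 + lam.1)}.
  by apply: cvgD; [exact: cvg_fst|exact: cvg_cst].
have c2 : {for z, continuous (fun z : R * R => z.2 + lam.2)}.
  by apply: cvgD; [exact: cvg_snd|exact: cvg_cst].
exact: (cvg_pair c1 c2).
Qed.

Lemma tproj_open (A : set (R * R)) : open A -> open (pr @` A).
Proof.
move=> oA; rewrite open_tprojE.
have -> : pr @^-1` (pr @` A) = \bigcup_(lam in [set lam | lattice lam])
    (fun z : R * R => (z.1 + lam.1, z.2 + lam.2)) @^-1` A.
  apply/seteqP; split=> z.
    move=> [w Aw /esym/tproj_lattice e]; exists (w.1 - z.1, w.2 - z.2) => //=.
    by rewrite !subrKC; case: w Aw {e}.
  by move=> [lam /= L h]; exists (z.1 + lam.1, z.2 + lam.2) => //; rewrite tproj_add.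
apply: bigcup_open => lam _; apply: open_comp => // z _; exact: continuous_translation.
Qed.

Lemma near_ball (z : R * R) (A : set (R * R)) : nbhs z A <->
  exists2 e : R, 0 < e & forall w, `|w.1 - z.1| < e -> `|w.2 - z.2| < e -> A w.
Proof.
split=> [/nbhs_ballP[e /= e0 H]|[e e0 H]].
  by exists e => // w w1 w2; apply: H; split; rewrite /ball/= distrC.
apply/nbhs_ballP; exists e => //= w [/= w1 w2].
by apply: H; rewrite distrC.
Qed.

End torus_topology.

(** Near each point of U small straight segments of the plane project to connected sets inside U, so
    the component contains a neighbourhood. *)
Lemma open_component (R : realType) (T : R) (U M : set (torus (ln T))) : open U -> is_component M U -> open M.
Proof.
move=> oU [p Up ->]; rewrite open_tprojE openE => z /= Mz.
have Uz : U (@tproj R (ln T) z) := connected_component_sub Mz.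
have /near_ball[e e0 He] : nbhs z (@tproj R (ln T) @^-1` U) by apply: open_nbhs_nbhs.
apply/near_ball; exists e => // w w1 w2 /=.
apply: connected_component_trans Mz _.
pose f (t : R) : R * R := (z.1 + t * (w.1 - z.1), z.2 + t * (w.2 - z.2)).
have cf : continuous f.
  have c (a b : R) t : {for t, continuous (fun t : R => a + t * b)}.
    by apply: cvgD; [exact: cvg_cst|apply: cvgM; [exact: cvg_id|exact: cvg_cst]].
  by move=> t; exact: (cvg_pair (c _ _ t) (c _ _ t)).
exists ((@tproj R (ln T) \o f) @` `[0, 1]%classic); last first.
  by exists 1; rewrite /= ?in_itv/= ?ler01 ?lexx// /f !mul1r !subrKC; case: (w).
split.
- by exists 0; rewrite /= ?in_itv/= ?ler01 ?lexx// /f !mul0r !addr0; case: (z).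
- move=> y [t]; rewrite /= in_itv/= => /andP[t0 t1] <-; apply: He => /=.
    by rewrite addrAC subrr add0r normrM ger0_norm//; apply: le_lt_trans w1; rewrite ler_piMl.
  by rewrite addrAC subrr add0r normrM ger0_norm//; apply: le_lt_trans w2; rewrite ler_piMl.
- apply: connected_continuous_connected; first exact: segment_connected.
  apply: continuous_subspaceT => t; apply: continuous_comp; first exact: cf.
  exact: continuous_tproj.
Qed.


(** * Moving the fundamental domain of a doubly periodic integral *)

Section periodic_integral.
Variable R : realType.
Local Notation mu := (@lebesgue_measure R).
Local Notation pT := (plane_mT R).
Local Open Scope ereal_scope.

Lemma ge0_integral_rect (I J : set (measurableTypeR R)) (F : pT -> \bar R) :
  measurable I -> measurable J -> measurable_fun setT F -> (forall w, 0 <= F w) ->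
  \int[@area R]_(w in (I `*` J : set pT)) F w = \int[mu]_(x in I) \int[mu]_(y in J) F (x, y).
Proof.
move=> mI mJ mF F0; rewrite integral_mkcond.
pose G := F \_ (I `*` J : set pT).
have mG : measurable_fun setT G.
  by apply/(measurable_restrictT _ (measurableX mI mJ)); exact: measurable_funTS.
have G0 w : 0 <= G w by rewrite /G patchE; case: ifP.
rewrite /area (@fubini_tonelli1 _ _ _ _ R mu mu G mG G0) [RHS]integral_mkcond.
apply: eq_integral => x _; rewrite /fubini_F patchE; case: ifPn => xI; last first.
  apply: integral0_eq => y _; rewrite /G patchE ifN//.
  by apply: contra xI; rewrite !inE => -[].
rewrite [RHS]integral_mkcond; apply: eq_integral => y _; rewrite /G !patchE.
congr (if _ then _ else _); rewrite inE in xI.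
by apply/idP/idP => [/set_mem[_ yJ]|/set_mem yJ]; apply/mem_set.
Qed.

Lemma ge0_integral_cell (F : pT -> \bar R) (P a b : R) : (0 < P)%R -> measurable_fun setT F ->
  (forall w, 0 <= F w) -> (forall x y, F (x + P, y)%R = F (x, y)) ->
  (forall x y, F (x, y + 2 * pi)%R = F (x, y)) ->
  \int[@area R]_(w in (`[0%R, P]%classic `*` `[0%R, (2 * pi)%R]%classic : set pT)) F w =
  \int[@area R]_(w in (`[a, (a + P)%R[%classic `*` `[b, (b + 2 * pi)%R[%classic : set pT)) F w.
Proof.
move=> P0 mF F0 Fx Fy; have p0 : (0 < 2 * pi :> R)%R by rewrite mulr_gt0 ?pi_gt0.
have E I J mI mJ := @ge0_integral_rect I J F mI mJ mF F0.
rewrite (E _ _ (measurable_itv _) (measurable_itv _)) (E _ _ (measurable_itv _) (measurable_itv _)).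
have mFx x : measurable_fun setT (fun y : measurableTypeR R => F (x, y)).
  exact: (measurable_fun_pair2 x mF).
pose H (x : measurableTypeR R) := \int[mu]_(y in `[b, (b + 2 * pi)%R[) F (x, y).
have EH x : \int[mu]_(y in `[0%R, (2 * pi)%R]) F (x, y) = H x.
  have mx : measurable_fun (`[0%R, (2 * pi)%R[%classic : set (measurableTypeR R)) (fun y => F (x, y)) by exact: measurable_funTS.
  rewrite -(@integral_itv_bndo_bndc R); last exact: mx.
  by have := @ge0_integral_period R (fun y => F (x, y)) (2 * pi)%R 0%R b p0 (Fy x) (mFx x) (fun y => F0 (x, y)); rewrite add0r.
under eq_integral do rewrite EH.
have mH : measurable_fun setT H.
  pose G (w : pT) := F w * (\1_(`[b, (b + 2 * pi)%R[%classic : set R) w.2)%:E.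
  have mG : measurable_fun setT G.
    apply: emeasurable_funM => //; apply/measurable_EFinP.
    have mi : measurable_fun setT (\1_(`[b, (b + 2 * pi)%R[%classic : set R) : measurableTypeR R -> R).
      by apply: measurable_indic; exact: measurable_itv.
    exact: (measurableT_comp mi measurable_snd).
  have G0 w : 0 <= G w by rewrite mule_ge0// lee_fin indicE; case: (_ \in _).
  rewrite (_ : H = fun x => \int[mu]_y G (x, y)).
    by have := @measurable_fun_fubini_tonelli_F _ _ _ _ R mu G mG G0; exact.
  by apply/funext => x; rewrite /H integral_mkcond epatch_indic.
have H0 x : 0 <= H x by apply: integral_ge0 => y _.
have mHP : measurable_fun (`[0%R, P[%classic : set (measurableTypeR R)) H by exact: measurable_funTS.
rewrite -(@integral_itv_bndo_bndc R); last exact: mHP.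
have := @ge0_integral_period R H P 0%R a P0 _ mH H0; rewrite add0r; apply => x.
by apply: eq_integral => y _; rewrite Fx.
Qed.

Lemma integral_cell (F : pT -> \bar R) (P a b : R) : (0 < P)%R -> measurable_fun setT F ->
  (forall x y, F (x + P, y)%R = F (x, y)) ->
  (forall x y, F (x, y + 2 * pi)%R = F (x, y)) ->
  \int[@area R]_(w in (`[0%R, P]%classic `*` `[0%R, (2 * pi)%R]%classic : set pT)) F w =
  \int[@area R]_(w in (`[a, (a + P)%R[%classic `*` `[b, (b + 2 * pi)%R[%classic : set pT)) F w.
Proof.
move=> P0 mF Fx Fy; rewrite [LHS]integralE [RHS]integralE; congr (_ - _).
- apply: ge0_integral_cell => //.
  + exact: measurable_funepos.
  + by move=> x y; rewrite !funeposE Fx.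
  + by move=> x y; rewrite !funeposE Fy.
- apply: ge0_integral_cell => //.
  + exact: measurable_funeneg.
  + by move=> x y; rewrite !funenegE Fx.
  + by move=> x y; rewrite !funenegE Fy.
Qed.

End periodic_integral.

(** * Test functions on the torus built from logarithms *)

Section test_functions.
Variables (R : realType) (T : R) (T1 : 1 < T).
Variables (k th : R -> R) (c : R).
Local Notation P := (ln T).
Local Notation pr := (@tproj R P).
Local Notation tor := (torus P).
Local Notation pT := (plane_mT R).
Local Notation beta := (fun x : R => c * (flat 0 (x + 1) * flat 0 (- x))).
Hypothesis dk : forall x : R, is_derive x 1 k (th x).
Hypothesis dth : forall x : R, is_derive x 1 th (beta x).
Hypothesis k_id : forall x : R, 0 <= x -> k x = x.
Hypothesis k_cst : forall x : R, x <= -1 -> k x = k (-1).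

Lemma sm_subset (O O' : set (R * R)) g : O' `<=` O -> sm O g -> sm O' g.
Proof.
move=> OO; elim=> [a| | |f h _ sf _ sh|f h _ sf _ sh|f _ sf|f _ sf|f _ sf|f _ sf p|f _ sf p|m f _ sf|t e f H _ sf|t e a f H1 H2 _ sf].
- exact: sm_cst.
- exact: sm_fst.
- exact: sm_snd.
- exact: sm_add.
- exact: sm_mul.
- exact: sm_exp.
- exact: sm_cos.
- exact: sm_sin.
- by apply: sm_ln => // v /OO; exact: p.
- by apply: sm_inv => // v /OO; exact: p.
- exact: sm_flat.
- exact: (sm_prim1 H).
- exact: (sm_prim2 H1 H2).
Qed.

Lemma P_gt0 : 0 < P. Proof. exact: ln_gt0. Qed.

Variables (rho : R) (V : R * R -> \bar R) (u : tor -> \bar R) (U : set tor).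
Hypothesis lV : lower_semicontinuous (fun v => - V v)%E.
Hypothesis uE : forall v, u (pr v) = (V (cexp v) * (expR (- rho * v.1))%:E)%E.
Hypothesis uU : Lop_zero_on rho u U.

Variables (z : R * R) (d : R).
Hypotheses (d0 : 0 < d) (dP : 2 * d <= P / 2) (dpi : 2 * d <= pi).
Let B (w : R * R) := `|w.1 - z.1| < 2 * d /\ `|w.2 - z.2| < 2 * d.
Hypothesis BU : forall w, B w -> U (pr w).
Variables (l l' : R).
Hypotheses (fl : fits z d l) (ll : l' < l - 1).

Local Notation g := (log_bump k l l' (cexp z)).

Let g0 w : B w -> g w != 0 -> `|w.1 - z.1| < d /\ `|w.2 - z.2| < d.
Proof.
move=> [_ w2] gw; apply: fl; first by rewrite (le_trans (ltW w2)).
rewrite leNgt; apply: contra gw => h; apply/eqP; apply: log_bump_far => //; first exact: ltW.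
by apply/ltW; apply: le_lt_trans h; rewrite ler_expR; have := ll; lra.
Qed.

Let int_small (n : int) (q : R) : 0 < q -> `|n%:~R * q| < q -> n = 0.
Proof.
move=> q0; rewrite normrM (gtr0_norm q0) -{2}(mul1r q) ltr_pM2r// -intr_norm.
by rewrite (_ : 1 = 1%:~R)// ltr_int; case: n => -[].
Qed.

Let B_uniq v w : B v -> B w -> pr v = pr w -> v = w.
Proof.
move=> [v1 v2] [w1 w2] /tproj_lattice[m [n /= [e1 e2]]].
have m0 : m = 0.
  apply: (@int_small _ P P_gt0); rewrite -e1.
  rewrite (_ : w.1 - v.1 = (w.1 - z.1) - (v.1 - z.1)); last by ring.
  by apply: (le_lt_trans (ler_normB _ _)); have := dP; have := dpi; lra.
have n0 : n = 0.
  apply: (@int_small _ (2 * pi)); first by rewrite mulr_gt0 ?pi_gt0.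
  rewrite -e2 (_ : w.2 - v.2 = (w.2 - z.2) - (v.2 - z.2)); last by ring.
  by apply: (le_lt_trans (ler_normB _ _)); have := dP; have := dpi; lra.
move: e1 e2; rewrite m0 n0 !mul0r => /eqP + /eqP.
by rewrite !subr_eq0 => /eqP e1 /eqP e2; rewrite [v]surjective_pairing [w]surjective_pairing e1 e2.
Qed.

(** Differences within B are smaller than the periods, so a class has at most one representative in
    B and [xget] finds it; classes without one get 0. The factor e^(rho x) makes L_(- rho) act as
    the Laplacian on the logarithmic bump. *)
Definition bump_at (p : tor) : R :=
  let w := xget (0, 0) [set w | B w /\ pr w = p] in
  if `[< B w /\ pr w = p >] then expR (rho * w.1) * g w else 0.

Let phiE w : B w -> bump_at (pr w) = expR (rho * w.1) * g w.
Proof.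
move=> Bw; rewrite /bump_at; set w' := xget _ _.
have [Bw' e] : B w' /\ pr w' = pr w.
  by have := @xgetPex _ (0, 0) [set v | B v /\ pr v = pr w] (ex_intro _ w (conj Bw erefl)).
by rewrite (B_uniq Bw' Bw e); case: asboolP => // -[].
Qed.

Let phi0 p : (forall w, B w -> pr w = p -> g w = 0) -> bump_at p = 0.
Proof.
move=> h; rewrite /bump_at; case: asboolP => // -[Bw /(h _ Bw) ->].
by rewrite mulr0.
Qed.

(** The bump lives in the box of half-width d, while B has half-width 2 d. This margin makes the
    function vanish near every class that misses B, which gives smoothness there and puts the closed
    support inside U. *)
Let phi_far v : (forall w, B w -> pr w != pr v) ->
  forall v', `|v'.1 - v.1| < d -> `|v'.2 - v.2| < d -> bump_at (pr v') = 0.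
Proof.
move=> nv v' v1 v2; apply: phi0 => w Bw e; apply/eqP/negPn/negP => gw.
have [w1 w2] := g0 Bw gw; have /tproj_lattice L := esym e.
have := nv (v.1 + (w.1 - v'.1), v.2 + (w.2 - v'.2)); rewrite (tproj_add v L) eqxx => /(_ _)/negP[] //.
split => /=.
  rewrite (_ : _ - z.1 = (w.1 - z.1) - (v'.1 - v.1)); last by ring.
  by apply: (le_lt_trans (ler_normB _ _)); have := dP; have := dpi; lra.
rewrite (_ : _ - z.2 = (w.2 - z.2) - (v'.2 - v.2)); last by ring.
by apply: (le_lt_trans (ler_normB _ _)); have := dP; have := dpi; lra.
Qed.

Let open_square v e : open [set w : R * R | `|w.1 - v.1| < e /\ `|w.2 - v.2| < e].
Proof.
rewrite openE => w /= [w1 w2].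
apply/near_ball; exists (Num.min (e - `|w.1 - v.1|) (e - `|w.2 - v.2|)).
  by rewrite lt_min !subr_gt0 w1.
move=> t; rewrite !lt_min => /andP[t1 _] /andP[_ t2]; split.
  rewrite (_ : t.1 - v.1 = (t.1 - w.1) + (w.1 - v.1)); last by ring.
  by apply: (le_lt_trans (ler_normD _ _)); lra.
rewrite (_ : t.2 - v.2 = (t.2 - w.2) + (w.2 - v.2)); last by ring.
by apply: (le_lt_trans (ler_normD _ _)); lra.
Qed.

Let oB : open B. Proof. exact: open_square. Qed.

Let rep v : (exists2 w, B w & pr w = pr v) \/ (forall w, B w -> pr w != pr v).
Proof.
have [[w [Bw e]]|h] := pselect (exists w, B w /\ pr w = pr v); first by left; exists w.
by right => w Bw; apply/eqP => e; apply: h; exists w.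
Qed.

Lemma smooth_bump_at : locally_sm setT (bump_at \o pr).
Proof.
move=> v _; have [[w Bw e]|nv] := rep v.
  have L := tproj_lattice (esym e); set lam := (w.1 - v.1, w.2 - v.2) in L.
  pose tr (v : R * R) := (v.1 + lam.1, v.2 + lam.2).
  have /(_ v I)[W [oW Wv [f sf fE]]] := smooth_log_bump dk dth k_cst l l' (cexp z) rho lam.
  exists (W `&` tr @^-1` B); split.
  - apply: openI => //; apply: open_comp; last exact: oB.
    by move=> t _; exact: continuous_translation.
  - by split => //; rewrite /tr /= /lam /= !subrKC; case: (w) Bw.
  - exists f; first by apply: sm_subset sf => t [].
    by move=> t [/fE <- Bt]; rewrite /= -(tproj_add t L) phiE.
exists [set w : R * R | `|w.1 - v.1| < d /\ `|w.2 - v.2| < d]; split.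
- exact: open_square.
- by rewrite /= !subrr normr0.
- by exists (fun=> 0); [exact: sm_cst|move=> t [t1 t2]; exact: (phi_far nv)].
Qed.

Lemma test_bump_at : test_function U bump_at.
Proof.
split; first by move=> n; exact: locally_sm_Ck smooth_bump_at.
move=> p cp; have [v vp] := tproj_surj p; rewrite -vp in cp *.
have [[w Bw <-]|nv] := rep v; first exact: BU.
have := cp (pr @` [set w : R * R | `|w.1 - v.1| < d /\ `|w.2 - v.2| < d]) => -[].
  apply: open_nbhs_nbhs; split; first by apply: tproj_open; exact: open_square.
  by exists v => //=; rewrite !subrr normr0.
by move=> q [/= + [t [t1 t2] tq]]; rewrite -tq (phi_far nv t1 t2) eqxx.
Qed.

Let near_D (f1 f2 : R * R -> R) (O : set (R * R)) (e w : R * R) : open O -> O w ->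
  (forall t, O t -> f1 t = f2 t) -> 'D_e f1 w = 'D_e f2 w.
Proof.
move=> oO Ow fe; apply: near_eq_derive.
by apply: filterS (open_near oO Ow) => t; exact: fe.
Qed.

Lemma Lop_ext (r : R) (f1 f2 : R * R -> R) (O : set (R * R)) w : open O -> O w ->
  (forall t, O t -> f1 t = f2 t) -> Lop r f1 w = Lop r f2 w.
Proof.
move=> oO Ow fe; rewrite /Lop /ddx /ddy.
have E e t : O t -> 'D_e f1 t = 'D_e f2 t by move=> Ot; exact: near_D oO Ot fe.
by rewrite !(near_D _ oO Ow (E _)) (E _ _ Ow) (fe _ Ow).
Qed.

Let Lop_zero r (w : R * R) : Lop r (fun=> 0) w = 0.
Proof.
rewrite /Lop /ddx /ddy.
have E (e t : R * R) : 'D_e (fun _ : R * R => (0 : R)) t = 0 by exact: derive_cst.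
have EE (e : R * R) : 'D_e (fun _ : R * R => (0 : R)) = (fun=> 0) by apply/funext => t; exact: E.
by rewrite !EE !E !mulr0 !addr0.
Qed.

Let Cg : Ck 2 setT g.
Proof.
apply: locally_sm_Ck.
have := smooth_log_bump dk dth k_cst l l' (cexp z) 0 (0, 0).
rewrite (_ : (fun w => _) = g)//; apply/funext => -[w1 w2].
by rewrite /= mul0r expR0 mul1r !addr0.
Qed.

Let LopB w : B w -> Lop (- rho) (bump_at \o pr) w =
  expR (rho * w.1) * (wt c l z w - wt c l' z w).
Proof.
move=> Bw; rewrite (Lop_ext _ (f2 := fun w => expR (rho * w.1) * g w) oB Bw); last by move=> t; exact: phiE.
have Ce : Ck 2 setT (fun w => expR (rho * w.1) * g w) by apply: Ck_exp_mul => //; exact: openT.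
have := @laplacian_exp R setT (- rho) (fun w => expR (rho * w.1) * g w) w openT I Ce.
rewrite (_ : (fun w => _) = g); last first.
  by apply/funext => t; rewrite mulrA -expRD mulNr addNr expR0 mul1r.
rewrite (laplacian_log_bump dk dth k_cst) => ->.
by rewrite mulrA -expRD mulNr subrr expR0 mul1r.
Qed.

Let periodic (f : R * R -> R) lam : (forall t, f (t.1 + lam.1, t.2 + lam.2) = f t) ->
  forall (e : R * R) t, 'D_e f (t.1 + lam.1, t.2 + lam.2) = 'D_e f t.
Proof.
move=> fp e t; rewrite /derive.
have -> : (fun h : R => h^-1 *: ((f \o shift (t.1 + lam.1, t.2 + lam.2)) (h *: e) - f (t.1 + lam.1, t.2 + lam.2))) =
    (fun h : R => h^-1 *: ((f \o shift t) (h *: e) - f t)); last by [].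
apply/funext => h /=; congr (_ *: (_ - _)); last exact: fp.
by rewrite -[RHS]fp; congr (f (_, _)); rewrite /= addrA.
Qed.

Let Lop_shift r (f : R * R -> R) lam t : (forall s, f (s.1 + lam.1, s.2 + lam.2) = f s) ->
  Lop r f (t.1 + lam.1, t.2 + lam.2) = Lop r f t.
Proof.
move=> p0; have px := periodic p0 ((1, 0) : R * R); have py := periodic p0 ((0, 1) : R * R).
have pxx := periodic px ((1, 0) : R * R); have pyy := periodic py ((0, 1) : R * R).
by rewrite /Lop /ddx /ddy (pxx t) (pyy t) (px t) (p0 t).
Qed.

Let Lop_periodic lam : lattice P lam ->
  forall t, Lop (- rho) (bump_at \o pr) (t.1 + lam.1, t.2 + lam.2) = Lop (- rho) (bump_at \o pr) t.
Proof. by move=> L t; apply: Lop_shift => s; rewrite /= tproj_add. Qed.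

(** The weak equation tested with [bump_at]: the factors e^(- rho x) of u and e^(rho x) of the test
    function cancel, leaving V against the difference of the weights. *)
Lemma integral_log_bump :
  (\int[@area R]_(w in (box z d : set pT)) (V (cexp w) * (wt c l z w - wt c l' z w)%:E) = 0)%E.
Proof.
have p0 : 0 < 2 * pi :> R by rewrite mulr_gt0 ?pi_gt0.
pose f (w : pT) := (u (pr w) * (Lop (- rho) (bump_at \o pr) w)%:E)%E.
have fper lam t : lattice P lam -> f (t.1 + lam.1, t.2 + lam.2) = f t.
  by move=> L; rewrite /f tproj_add// Lop_periodic.
have mf : measurable_fun setT f.
  apply: emeasurable_funM.
    rewrite (_ : (fun w => u (pr w)) = (fun w : pT => V (cexp w) * (expR (- rho * w.1))%:E)%E); last by apply/funext.
    have mexp : measurable_fun (setT : set pT) (fun z : pT => expR z.1).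
      by apply: measurableT_comp; [exact: measurable_expR|exact: measurable_fst].
    have mcexp : measurable_fun (setT : set pT) (@cexp R : pT -> pT).
      apply: measurable_fun_pair; apply: measurable_funM => //;
      by apply: measurableT_comp; [apply: continuous_measurable_fun; first [exact: continuous_cos|exact: continuous_sin]|exact: measurable_snd].
    have mV : measurable_fun (setT : set pT) V.
      rewrite (_ : V = (fun v => - - V v)%E); last by apply/funext => v; rewrite oppeK.
      by apply: measurableT_comp => //; exact: lsc_measurable_plane.
    apply: emeasurable_funM; first exact: (measurableT_comp mV mcexp).
    apply/measurable_EFinP; apply: (measurableT_comp (@measurable_expR R)).
    by apply: measurable_funM; [exact: measurable_cst|exact: measurable_fst].
  apply/measurable_EFinP; apply: (@continuous_measurable_plane R setT) => //; first exact: openT.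
  have C2 := locally_sm_Ck 2 smooth_bump_at; have C0 := Ck_continuous C2; have [Cx Cy] := Ck_der C2.
  have [Cxx _] := Ck_der Cx; have [_ Cyy] := Ck_der Cy.
  move=> w _; rewrite /Lop; apply: cvgD; [apply: cvgD; [apply: cvgD|]|].
  - exact: (Ck_continuous Cxx).
  - exact: (Ck_continuous Cyy).
  - by apply: cvgM; [exact: cvg_cst|exact: (Ck_continuous Cx)].
  - by apply: cvgM; [exact: cvg_cst|exact: C0].
have := uU test_bump_at; rewrite /fundamental_domain /angles.
(* The cell is centred at z, so that it contains the box and meets no second copy of the support. *)
rewrite (@integral_cell R f P (z.1 - P / 2) (z.2 - pi) P_gt0 mf); last 2 first.
- move=> x y; have := fper (P, 0) (x, y); rewrite /= addr0; apply.
  by exists 1, 0; rewrite mul1r mul0r.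
- move=> x y; have := fper (0, 2 * pi) (x, y); rewrite /= addr0; apply.
  by exists 0, 1; rewrite mul1r mul0r.
move=> <-; rewrite [LHS]integral_mkcond [RHS]integral_mkcond; apply: eq_integral => w _.
rewrite !patchE.
have fB : B w -> f w = (V (cexp w) * (wt c l z w - wt c l' z w)%:E)%E.
  move=> Bw; rewrite /f uE LopB// -muleA -EFinM mulrA -expRD mulNr addNr expR0 mul1r.
  by [].
have inB : box z d w -> B w by move=> /boxP[w1 w2]; split; have := d0; lra.
case: ifPn => [|wD].
  rewrite inE => Dw; have Bw := inB Dw; rewrite ifT ?fB//.
  rewrite inE; case: Bw => /ltW + /ltW; rewrite !ler_norml => /andP[? ?] /andP[? ?].
  have := P_gt0; have := @pi_gt0 R; have [h1 h2] := (boxP z d w).1 Dw.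
  move: h1 h2; rewrite !ler_norml => /andP[? ?] /andP[? ?] ? ?.
  by split; rewrite /= in_itv/=; apply/andP; have := d0; have := dP; have := dpi; lra.
case: ifPn => //; rewrite inE => -[/=]; rewrite !in_itv/= => /andP[w1 w2] /andP[w3 w4].
(* Outside the box the integrand vanishes: in B because the discs fit into the box, and elsewhere in
   the cell because no representative in B exists. *)
have [Bw|nB] := pselect (B w).
  have gz m : fits z d m -> wt c m z w = 0.
    move=> fm; apply/eqP/negPn/negP => /wt_supp/andP[_ h].
    move: wD; rewrite notin_setE; apply; apply/boxP.
    by have [|/ltW ? /ltW ?] := fm w _ h; first by rewrite ler_norml; apply/andP; lra.
  rewrite fB// !gz ?subrr ?mule0//; apply: fits_le fl; have := ll; lra.
have nw t : B t -> pr t != pr w.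
  move=> Bt; apply/eqP => /tproj_lattice[m [n /= [e1 e2]]]; apply: nB.
  have [t1 t2] := Bt; move: t1 t2; rewrite !ltr_norml => /andP[? ?] /andP[? ?].
  have m0 : m = 0.
    by apply: (@int_small _ P P_gt0); rewrite -e1 ltr_norml; apply/andP; have := dP; lra.
  have n0 : n = 0.
    by apply: (@int_small _ (2 * pi) p0); rewrite -e2 ltr_norml; apply/andP; have := dpi; lra.
  move: e1 e2; rewrite m0 n0 !mul0r => /eqP + /eqP.
  rewrite !subr_eq0 => /eqP e1 /eqP e2.
  by rewrite (_ : w = t)// [w]surjective_pairing [t]surjective_pairing e1 e2.
have L0 : Lop (- rho) (bump_at \o pr) w = 0.
  rewrite -(Lop_zero (- rho) w); apply: (@Lop_ext _ _ _ _ w (@open_square w d)).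
    by rewrite /= !subrr normr0.
  by move=> t [t1 t2]; exact: (phi_far nw).
by rewrite /f L0 mule0.
Qed.

End test_functions.

Lemma usc_bounded (R : realType) (X : topologicalType) (K : set X) (V : X -> \bar R) :
  compact K -> lower_semicontinuous (fun v => - V v)%E -> (forall v, V v < +oo)%E ->
  exists C : R, forall v, K v -> (V v <= C%:E)%E.
Proof.
move=> cK lV Vfin; apply: contrapT => Hn.
have /boolp.choice[y Hy] : forall n : nat, exists v, K v /\ (n%:R%:E < V v)%E.
  move=> n; apply: contrapT => h; apply: Hn; exists n%:R => v Kv.
  by rewrite leNgt; apply/negP => h'; apply: h; exists v.
have [|p [Kp cp]] := cK (y @ \oo) _; first by exists 0%N => // n _; exact: (Hy n).1.
have [a Va] : exists a : R, (V p < a%:E)%E.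
  move: (Vfin p); case: (V p) => [r| |]// _; last by exists 0; rewrite ltNyr.
  by exists (r + 1); rewrite lte_fin ltrDl.
have [|W nW HW] := lV p (- a); first by rewrite EFinN lteN2.
have evy : (y @ \oo) [set v | exists n, (Num.truncn a < n)%N /\ v = y n].
  by exists (Num.truncn a).+1 => // n /= an; exists n.
have [v [[n [an ->]] Wv]] := cp _ _ evy nW.
have := HW _ Wv; rewrite EFinN lteN2 => h; have := lt_trans (Hy n).2 h.
rewrite lte_fin ltNge => /negP; apply; apply: ltW.
by apply: (lt_le_trans (truncnS_gt a)); rewrite ler_nat.
Qed.

(** * A quantitative mean value inequality for V_u - V_w *)

Section local_gain.
Variables (R : realType) (k th : R -> R) (c : R).
Local Notation pT := (plane_mT R).
Local Notation beta := (fun x : R => c * (flat 0 (x + 1) * flat 0 (- x))).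
Hypothesis dk : forall x : R, is_derive x 1 k (th x).
Hypothesis dth : forall x : R, is_derive x 1 th (beta x).
Hypothesis c0 : 0 < c.
Hypothesis k_id : forall x : R, 0 <= x -> k x = x.
Hypothesis k_cst : forall x : R, x <= -1 -> k x = k (-1).
Variables (cm : R).
Hypotheses (cm0 : 0 < cm) (cmE : ((2 * pi)%:E * mass beta = cm%:E)%E).

Lemma continuous_cexp : continuous (@cexp R).
Proof.
move=> w; have ce : {for w, continuous (fun w : R * R => expR w.1)} by apply: continuous_comp; [exact: cvg_fst|exact: continuous_expR].
have cc : {for w, continuous (fun w : R * R => cos w.2)} by apply: continuous_comp; [exact: cvg_snd|exact: continuous_cos].
have cs : {for w, continuous (fun w : R * R => sin w.2)} by apply: continuous_comp; [exact: cvg_snd|exact: continuous_sin].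
have h1 : {for w, continuous (fun w : R * R => expR w.1 * cos w.2)} by apply: cvgM; [exact: ce|exact: cc].
have h2 : {for w, continuous (fun w : R * R => expR w.1 * sin w.2)} by apply: cvgM; [exact: ce|exact: cs].
exact: (cvg_pair h1 h2).
Qed.

Lemma measurable_usc (V : R * R -> \bar R) : lower_semicontinuous (fun v => - V v)%E ->
  measurable_fun (setT : set pT) V.
Proof.
move=> lV; rewrite (_ : V = (fun v => - - V v)%E); last by apply/funext => v; rewrite oppeK.
by apply: measurableT_comp => //; exact: lsc_measurable_plane.
Qed.

Variables (z : R * R) (d l : R).
Hypotheses (d0 : 0 < d) (dpi : d < pi) (fl : fits z d l).
Local Notation D := (box z d : set pT).
Variable Vu : R * R -> \bar R.
Hypotheses (lVu : lower_semicontinuous (fun v => - Vu v)%E) (Vufin : forall v, (Vu v < +oo)%E).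
Hypothesis Vu0 : forall l' : R, l' < l - 1 ->
  (\int[@area R]_(w in D) (Vu (cexp w) * (wt c l z w - wt c l' z w)%:E) = 0)%E.

Let lVue : lower_semicontinuous (fun w => - Vu (cexp w))%E.
Proof. exact: (lsc_comp continuous_cexp lVu). Qed.

Let Vu_usc C (a : R) : (a%:E < C%:E - Vu (cexp z))%E -> \forall w \near z, (a%:E < C%:E - Vu (cexp w))%E.
Proof.
have E w (x : R) : (x%:E < C%:E - Vu (cexp w))%E = ((x - C)%:E < - Vu (cexp w))%E.
  by rewrite EFinB lteBlDl// addeC.
rewrite E => /lVue[W nW HW]; apply: filterS nW => w /HW.
by rewrite E.
Qed.

Let mVu : measurable_fun D (fun w => Vu (cexp w)).
Proof. by apply: measurable_funTS; exact: measurable_usc. Qed.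

Lemma mean_upper (C : R) : (forall w, box z d w -> Vu (cexp w) <= C%:E)%E ->
  (\int[@area R]_(w in D) (maxe 0 (C%:E - Vu (cexp w)) * (wt c l z w)%:E) < +oo)%E /\
  (cm%:E * (C%:E - Vu (cexp z)) <= \int[@area R]_(w in D) (maxe 0 (C%:E - Vu (cexp w)) * (wt c l z w)%:E))%E.
Proof.
move=> VC; apply: (mean_usc c0 cm0 cmE d0 dpi fl mVu VC) => //; exact: Vu_usc.
Qed.

Let bnd : exists C : R, forall w, box z d w -> (Vu (cexp w) <= C%:E)%E.
Proof. by apply: (usc_bounded _ lVue) => [|w]; [exact: compact_rect|exact: Vufin]. Qed.

(** If the value were -oo, the defect at the centre would be infinite although its mean is
    finite. *)
Lemma harmonic_finite : Vu (cexp z) != -oo%E.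
Proof.
have [C HC] := bnd; have [h1 h2] := mean_upper HC.
apply/eqP => e; move: h2; rewrite e gt0_muley ?lte_fin// => h2.
by have := le_lt_trans h2 h1.
Qed.

(* The term kap |e^w|^2 yields a gain at z that does not depend on z, so that a
   supremum which is only approached at z is contradicted as well. *)
Lemma local_gain (Vw : R * R -> \bar R) (A : set (R * R)) (H : R * R -> R) (del kap m : R) :
  subharmonic Vw -> open A -> box z d `<=` A -> Ck 2 A H -> (forall w, A w -> laplacian H w = 0) ->
  0 < del -> 0 <= kap ->
  (forall w, box z d w -> (H w + kap * expR w.1 ^+ 2)%:E + del%:E * Vw (cexp w) <= m%:E + del%:E * Vu (cexp w))%E ->
  ((H z + kap * (expR z.1 ^+ 2 + expR (l - 1)))%:E + del%:E * Vw (cexp z) <= m%:E + del%:E * Vu (cexp z))%E.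
Proof.
move=> sVw oA DA CH LH del0 kap0 HD; have [Vwfin lVw _] := sVw.
have mD : measurable D by exact: measurable_rect.
have [C1 HC1] := bnd.
have [C2 HC2] : exists C : R, forall v, sqd v (cexp z) <= expR l -> (Vw v <= C%:E)%E.
  have [C HC] := usc_bounded (@compact_rect R ((cexp z).1 - (expR l + 1)) ((cexp z).1 + (expR l + 1))
    ((cexp z).2 - (expR l + 1)) ((cexp z).2 + (expR l + 1))) lVw Vwfin.
  exists C => v h; apply: HC; have := expR_gt0 l; move: h; rewrite /sqd.
  move: (expR l) (cexp z) => r Z h r0.
  have h1 := sqr_ge0 (v.1 - Z.1); have h2 := sqr_ge0 (v.2 - Z.2).
  have e1 : `|v.1 - Z.1| <= r + 1.
    rewrite -ler_sqr ?nnegrE//; last by lra.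
    by rewrite real_normK ?num_real//; nra.
  have e2 : `|v.2 - Z.2| <= r + 1.
    rewrite -ler_sqr ?nnegrE//; last by lra.
    by rewrite real_normK ?num_real//; nra.
  by move: e1 e2; rewrite !ler_norml => /andP[? ?] /andP[? ?]; split; rewrite /= in_itv/=; apply/andP; lra.
pose C := Num.max C1 C2.
have VuC w : box z d w -> (Vu (cexp w) <= C%:E)%E.
  by move=> /HC1 h; apply: (le_trans h); rewrite lee_fin le_max lexx.
have VwC v : sqd v (cexp z) <= expR l -> (Vw v <= C%:E)%E.
  by move=> /HC2 h; apply: (le_trans h); rewrite lee_fin le_max lexx orbT.
have [B HB] : exists B : R, forall w, box z d w -> `|H w| <= B.
  have : compact (H @` box z d).
    apply: continuous_compact; last exact: compact_rect.
    by apply: continuous_in_subspaceT => w /[!inE] /DA; exact: (Ck_continuous CH).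
  move=> /compact_bounded[M [Mr HM]]; exists (M + 1) => w Dw.
  by apply: (HM (M + 1)); [rewrite ltrDl|exists w].
(* This constant makes both C' + H and m + C' nonnegative, so that every term of the inequality can
   be integrated separately. *)
pose C' := Num.max B `|m|.
have HC' w : box z d w -> 0 <= C' + H w.
  move=> /HB h; have : B <= C' by rewrite le_max lexx.
  by have := ler_norm (- H w); rewrite normrN; lra.
have mC' : 0 <= m + C'.
  have : `|m| <= C' by rewrite le_max lexx orbT.
  by have := ler_norm (- m); rewrite normrN; lra.
pose W w := (wt c l z w)%:E.
have W0 w : (0 <= W w)%E by rewrite lee_fin wt_ge0// ltW.
have mW : measurable_fun D W.
  by apply/measurable_EFinP; apply: measurable_funTS; exact: measurable_wt.
pose Gu w := maxe 0%E (C%:E - Vu (cexp w))%E; pose Gw w := maxe 0%E (C%:E - Vw (cexp w))%E.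
have Gu0 w : (0 <= Gu w)%E by rewrite le_max lexx.
have Gw0 w : (0 <= Gw w)%E by rewrite le_max lexx.
have mGu : measurable_fun D Gu.
  apply: measurable_maxe; first exact: measurable_cst.
  by apply: emeasurable_funB => //; exact: measurable_cst.
have mGw : measurable_fun D Gw.
  apply: measurable_maxe; first exact: measurable_cst.
  apply: emeasurable_funB; first exact: measurable_cst.
  by apply: measurable_funTS; exact: (measurable_usc (lsc_comp continuous_cexp lVw)).
have mH : measurable_fun D (H : pT -> measurableTypeR R).
  exact: (continuous_measurable_plane oA DA (Ck_continuous CH)).
pose f1 w := ((C' + H w) * wt c l z w)%:E; pose f2 w := (kap%:E * (expR w.1 ^+ 2 * wt c l z w)%:E)%E.
pose f3 w := (del%:E * (Gu w * W w))%E.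
have mf1 : measurable_fun D f1.
  apply/measurable_EFinP; apply: measurable_funM; last by apply/measurable_EFinP.
  by apply: measurable_funD => //; exact: measurable_cst.
have me : measurable_fun D (fun w : pT => (expR w.1 ^+ 2 * wt c l z w)%:E).
  apply/measurable_EFinP; apply: measurable_funM; last by apply/measurable_EFinP.
  by apply: measurable_funX; apply: measurable_funTS; exact: (measurableT_comp (@measurable_expR R) measurable_fst).
have mf2 : measurable_fun D f2 by apply: emeasurable_funM => //; exact: measurable_cst.
have mGuW : measurable_fun D (fun w => Gu w * W w)%E by exact: emeasurable_funM.
have mGwW : measurable_fun D (fun w => Gw w * W w)%E by exact: emeasurable_funM.
have mf3 : measurable_fun D f3 by apply: emeasurable_funM => //; exact: measurable_cst.
have f10 w : D w -> (0 <= f1 w)%E by move=> Dw; rewrite lee_fin mulr_ge0 ?HC'// -lee_fin W0.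
have f20 w : D w -> (0 <= f2 w)%E.
  by move=> _; rewrite mule_ge0// lee_fin// mulr_ge0 ?sqr_ge0// -lee_fin W0.
have f30 w : D w -> (0 <= f3 w)%E by move=> _; rewrite !mule_ge0// lee_fin ltW.
have r10 w : D w -> (0 <= ((m + C') * wt c l z w)%:E)%E by move=> _; rewrite lee_fin mulr_ge0// -lee_fin W0.
have r20 w : D w -> (0 <= del%:E * (Gw w * W w))%E by move=> _; rewrite !mule_ge0// lee_fin ltW.
have mr1 : measurable_fun D (fun w => ((m + C') * wt c l z w)%:E).
  apply/measurable_EFinP; apply: measurable_funM; last by apply/measurable_EFinP.
  exact: measurable_cst.
have mr2 : measurable_fun D (fun w => del%:E * (Gw w * W w))%E by apply: emeasurable_funM => //; exact: measurable_cst.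
(* The hypothesis is rewritten with defects and multiplied by the weight. Where the weight is 0 both
   sides vanish, which matters because the bound on Vw is only known on the disc. *)
have ineq w : D w -> (f1 w + f2 w + f3 w <= ((m + C') * wt c l z w)%:E + del%:E * (Gw w * W w))%E.
  move=> Dw; rewrite /f1 /f2 /f3 /W.
  have [->|w0] := eqVneq (wt c l z w) 0; first by rewrite !mulr0 !mule0 !adde0.
  have /andP[_ S] := wt_supp w0; have {w0} p0 : 0 < wt c l z w by rewrite lt_neqAle eq_sym w0 -lee_fin W0.
  have -> : Gw w = (C%:E - Vw (cexp w))%E by apply/max_idPr; rewrite sube_ge0 ?orbT// VwC.
  have -> : Gu w = (C%:E - Vu (cexp w))%E by apply/max_idPr; rewrite sube_ge0 ?orbT// VuC.
  have := HD w Dw; have := VwC _ S; have := VuC w Dw; move: p0.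
  move: (wt c l z w) (expR w.1 ^+ 2) (H w) => p e h p0.
  case: (Vu (cexp w)) => [a| |]// _; case: (Vw (cexp w)) => [b| |]// _.
  - move=> i; rewrite -!EFinM -!EFinD lee_fin in i.
    rewrite -!EFinB -!EFinM -!EFinD lee_fin.
    rewrite -subr_ge0 (_ : _ - _ = p * (m + del * a - (h + kap * e + del * b))); last by ring.
    by rewrite mulr_ge0 ?(ltW p0)// subr_ge0.
  - by move=> _; rewrite /= gt0_mulye ?lte_fin// gt0_muley ?lte_fin// addey// leey.
  - by rewrite gt0_muleNy ?lte_fin// addeNy leeNy_eq.
  - by move=> _; rewrite /= gt0_mulye ?lte_fin// gt0_muley ?lte_fin// addey// leey.
have := ge0_le_integral (@area R) mD (fun w Dw => adde_ge0 (adde_ge0 (f10 w Dw) (f20 w Dw)) (f30 w Dw))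
  (emeasurable_funD (emeasurable_funD mf1 mf2) mf3) (emeasurable_funD mr1 mr2) ineq.
rewrite (ge0_integralD (@area R) mD (fun w Dw => adde_ge0 (f10 w Dw) (f20 w Dw)) (emeasurable_funD mf1 mf2) f30 mf3).
rewrite (ge0_integralD (@area R) mD f10 mf1 f20 mf2) (ge0_integralD (@area R) mD r10 mr1 r20 mr2).
rewrite (mean_cst c0 cmE dpi fl mC').
have E2 : (\int[@area R]_(w in D) f2 w = kap%:E * \int[@area R]_(w in D) (expR w.1 ^+ 2 * wt c l z w)%:E)%E.
  by apply: ge0_integralZl => // w _; rewrite lee_fin mulr_ge0 ?sqr_ge0// -lee_fin W0.
have E3 : (\int[@area R]_(w in D) f3 w = del%:E * \int[@area R]_(w in D) (Gu w * W w))%E.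
  by apply: ge0_integralZl => //; [move=> w _; rewrite mule_ge0|rewrite lee_fin ltW].
have E4 : (\int[@area R]_(w in D) (del%:E * (Gw w * W w)) = del%:E * \int[@area R]_(w in D) (Gw w * W w))%E.
  by apply: ge0_integralZl => //; [move=> w _; rewrite mule_ge0|rewrite lee_fin ltW].
rewrite E2 E3 E4.
have I2 := mean_sqr c0 cmE dpi fl.
have [_ I3] := mean_upper VuC.
have I4 := mean_subharmonic c0 cmE dpi fl sVw VwC.
(* A lower bound for the mean of H is what [mean_usc] gives for - H, whose defect is C' + H. *)
have I1 : ((cm * (C' + H z))%:E <= \int[@area R]_(w in D) f1 w)%E.
  have zD : box z d z by apply/boxP; rewrite !subrr normr0 ltW.
  have HN w : box z d w -> (- (H w)%:E <= C'%:E)%E.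
    by move=> /HC' h; rewrite -EFinN lee_fin; lra.
  have mN : measurable_fun D (fun w => - (H w)%:E)%E.
    by apply: measurableT_comp => //; apply/measurable_EFinP.
  have [||_] := @mean_usc R c c0 cm cm0 cmE z d d0 dpi l (fun w => - (H w)%:E)%E C' fl mN HN.
  - move=> a; rewrite -EFinN -EFinB lte_fin opprK => aH.
    have cH := Ck_continuous CH (DA _ zD).
    have hz : a - C' < H z by lra.
    have nH : nbhs z [set w | a - C' < H w] by exact: (cvgr_gt (H z) cH _ hz).
    move: nH; apply: filterS => w /=.
    by rewrite -?EFinN -?EFinD lte_fin opprK; lra.
  - move=> l' ll'; have := harmonic_wt dk dth k_id k_cst d0 dpi oA DA CH LH fl ll'.
    move=> I0; transitivity (\int[@area R]_(w in D) (- ((H w)%:E * (wt c l z w - wt c l' z w)%:E)))%E.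
      by apply: eq_integral => w _; rewrite mulNe.
    have mF : measurable_fun D (fun w => (H w)%:E * (wt c l z w - wt c l' z w)%:E)%E.
      apply: emeasurable_funM; apply/measurable_EFinP => //.
      by apply: measurable_funB; apply: measurable_funTS; exact: measurable_wt.
    have iF := integral0_integrable mD mF I0.
    by rewrite (integralN (integrable_add_def mD iF)) I0 oppe0.
  rewrite -EFinN -EFinB opprK -EFinM => h; apply: (le_trans h).
  rewrite le_eqVlt; apply/orP; left; apply/eqP; apply: eq_integral => w /[!inE] Dw.
  transitivity ((C' + H w)%:E * (wt c l z w)%:E)%E; last by rewrite -EFinM.
  congr (_ * _)%E; rewrite -EFinN -EFinB opprK.
  by apply/max_idPr; rewrite lee_fin HC'.
have Vun := harmonic_finite.
have VuCz : (Vu (cexp z) <= C%:E)%E by apply: VuC; apply/boxP; rewrite !subrr normr0 ltW.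
have VwCz : (Vw (cexp z) <= C%:E)%E by apply: VwC; rewrite /sqd !subrr expr0n/= addr0 expR_ge0.
suff fin (J1 J2 J3 J4 : \bar R) : (J1 + kap%:E * J2 + del%:E * J3 <= ((m + C') * cm)%:E + del%:E * J4)%E ->
    ((cm * (C' + H z))%:E <= J1)%E -> ((cm * (expR z.1 ^+ 2 + expR (l - 1)))%:E <= J2)%E ->
    (cm%:E * (C%:E - Vu (cexp z)) <= J3)%E -> (J4 <= cm%:E * (C%:E - Vw (cexp z)))%E ->
    ((H z + kap * (expR z.1 ^+ 2 + expR (l - 1)))%:E + del%:E * Vw (cexp z) <= m%:E + del%:E * Vu (cexp z))%E.
  by move=> I5; exact: (fin _ _ _ _ I5 I1 I2 I3 I4).
move: VuCz VwCz Vun {I1 I2 I3 I4}; case: (Vu (cexp z)) => [a| |]// _; case: (Vw (cexp z)) => [b| |]// _ _.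
  rewrite -!EFinB -!EFinM => I5 I1 I2 I3 I4.
  have step : ((cm * (C' + H z) + kap * (cm * (expR z.1 ^+ 2 + expR (l - 1))) + del * (cm * (C - a)))%:E <=
      ((m + C') * cm + del * (cm * (C - b)))%:E)%E.
    rewrite 2!EFinD; apply: (@le_trans _ _ (J1 + kap%:E * J2 + del%:E * J3)%E).
      apply: leeD; [apply: leeD => //|]; rewrite EFinM; apply: lee_wpmul2l => //; rewrite lee_fin// ltW//.
    apply: (le_trans I5); rewrite EFinD; apply: leeD => //.
    by rewrite [leRHS]EFinM; apply: lee_wpmul2l => //; rewrite lee_fin ltW.
  rewrite -!EFinD lee_fin; move: step; rewrite lee_fin => step.
  rewrite -(ler_pM2l cm0); lra.
by move=> _ _ _ _ _; rewrite gt0_muleNy ?lte_fin// addeNy leNye.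
Qed.

End local_gain.

(** * The complex exponential and the points where a subharmonic function is finite *)

Section complex_log.
Variable R : realType.
Local Notation mu := (@lebesgue_measure R).

Lemma cexpD2pi (n : int) (w : R * R) : cexp (w.1, w.2 + n%:~R * (2 * pi)) = cexp w.
Proof.
have step x y : cexp (x, y + 2 * pi) = cexp (x, y) :> R * R.
  by rewrite /cexp/= mulr_natl cosD2pi sinD2pi.
have nat_case (m : nat) x y : cexp (x, y + m%:R * (2 * pi)) = cexp (x, y) :> R * R.
  elim: m => [|m IH]; first by rewrite mul0r addr0.
  by rewrite -natr1 mulrDl mul1r addrA step IH.
case: n => m; first exact: nat_case.
rewrite NegzE mulrNz -[LHS](nat_case m.+1).
by rewrite mulNr -pmulrn subrK; case: w.
Qed.

Lemma window (a y : R) : exists n : int, `|y + n%:~R * (2 * pi) - a| <= pi.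
Proof.
have p0 : 0 < 2 * pi :> R by rewrite mulr_gt0 ?pi_gt0.
pose m := Num.floor ((y - a + pi) / (2 * pi)).
have /andP[m1 m2] : m%:~R * (2 * pi) <= y - a + pi < (m + 1)%:~R * (2 * pi).
  by rewrite -ler_pdivlMr// -ltr_pdivrMr// ge_floor/= floorD1_gt.
exists (- m); rewrite mulrNz mulNr ler_norml; move: m2; rewrite intrD mulrDl mul1r => m2.
by apply/andP; split; lra.
Qed.

Lemma log_disc_lattice (d : R) : 0 < d -> d < pi -> exists l0, forall z p : R * R,
  sqd (cexp p) (cexp z) <= expR (l0 + 2 * z.1) ->
  exists n : int, `|p.1 - z.1| < d /\ `|p.2 + n%:~R * (2 * pi) - z.2| < d.
Proof.
move=> d0 dpi; have [l0 H] := log_disc d0 dpi; exists l0 => z p h.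
have [n hn] := window z.2 p.2; exists n.
by apply: (H z (p.1, p.2 + n%:~R * (2 * pi))) => //; rewrite cexpD2pi.
Qed.

Lemma cexp_surj (Z : R * R) : Z != (0, 0) -> exists w, cexp w = Z.
Proof.
case: Z => X Y Z0; pose r := Num.sqrt (X ^+ 2 + Y ^+ 2).
have r2 : r ^+ 2 = X ^+ 2 + Y ^+ 2 by rewrite sqr_sqrtr// addr_ge0 ?sqr_ge0.
have r0 : 0 < r.
  rewrite sqrtr_gt0 lt_neqAle addr_ge0 ?sqr_ge0// andbT eq_sym paddr_eq0 ?sqr_ge0// !sqrf_eq0.
  by apply: contra Z0 => /andP[/eqP -> /eqP ->].
have rn : r != 0 by rewrite gt_eqF.
have Xr : -1 <= X / r <= 1.
  rewrite -ler_norml -(@ler_sqr _ `|_|) ?nnegrE// real_normK ?num_real// expr1n exprMn exprVn.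
  by rewrite ler_pdivrMr ?exprn_gt0// mul1r r2 lerDl sqr_ge0.
have E : Num.sqrt (1 - (X / r) ^+ 2) = `|Y| / r.
  have -> : 1 - (X / r) ^+ 2 = (`|Y| / r) ^+ 2.
    by rewrite !exprMn !exprVn real_normK ?num_real// r2; field; rewrite -r2 expf_neq0.
  by rewrite sqrtr_sqr ger0_norm// divr_ge0// ltW.
have c1 : cos (acos (X / r)) = X / r by rewrite acosK// in_itv/=.
have s1 : sin (acos (X / r)) = `|Y| / r by rewrite sin_acos.
have [Y0|Y0] := leP 0 Y.
  exists (ln r, acos (X / r)); rewrite /cexp/= lnK ?posrE// c1 s1 ger0_norm//.
  by congr pair; field.
exists (ln r, - acos (X / r)); rewrite /cexp/= lnK ?posrE// cosN sinN c1 s1 ltr0_norm//.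
by congr pair; field.
Qed.

(** If V were -oo near e^z, the circle through e^z about a point Z0 where V is finite would contain
    an arc on which V = -oo, and the sub-mean value inequality would force V(Z0) = -oo. *)
Lemma subharmonic_dense (V : R * R -> \bar R) : subharmonic V -> (exists Z, V Z != -oo%E) ->
  forall z d, 0 < d -> exists w, [/\ `|w.1 - z.1| < d, `|w.2 - z.2| < d & V (cexp w) != -oo%E].
Proof.
move=> sV [Z0 VZ0] z d0 d0_gt0; apply: contrapT => Hn.
have Hinf w : `|w.1 - z.1| < d0 -> `|w.2 - z.2| < d0 -> V (cexp w) = -oo%E.
  by move=> w1 w2; apply/eqP/negPn/negP => h; apply: Hn; exists w.
pose d := Num.min d0 1.
have d_gt0 : 0 < d by rewrite lt_min d0_gt0 ltr01.
have dd : d <= d0 by rewrite ge_min lexx.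
have dpi : d < pi.
  by apply: (@le_lt_trans _ _ 1); [rewrite ge_min lexx orbT|have := @pi_ge2 R; lra].
have [l0 Hl0] := log_disc_lattice d_gt0 dpi.
(* The bound |e^z|^2 keeps v away from 0, the only point that [cexp] misses. *)
have Hnear v : sqd v (cexp z) < Num.min (expR (l0 + 2 * z.1)) (expR z.1 ^+ 2) -> V v = -oo%E.
  rewrite lt_min => /andP[v1 v2].
  have [|p pv] := @cexp_surj v.
    apply: contraTneq v2 => ->; rewrite -leNgt /sqd /cexp/= !sub0r !sqrrN !exprMn -mulrDr.
    by rewrite cos2Dsin2 mulr1.
  have [|n [n1 n2]] := Hl0 z p; first by rewrite pv ltW.
  rewrite -pv -(cexpD2pi n p); apply: Hinf => /=; lra.
have [|[x t1] xt] := @cexp_surj ((cexp z).1 - Z0.1, (cexp z).2 - Z0.2).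
  apply: contraNneq VZ0 => -[/eqP + /eqP]; rewrite !subr_eq0 => /eqP e1 /eqP e2.
  rewrite (_ : Z0 = cexp z); last by rewrite [Z0]surjective_pairing -e1 -e2.
  by apply/eqP; apply: Hinf; rewrite subrr normr0.
have [n hn] := window pi t1; set t0 := t1 + n%:~R * (2 * pi) in hn.
have circ : circle Z0 (expR x) t0 = cexp z.
  have := cexpD2pi n (x, t1); rewrite xt /cexp/= => -[e1 e2].
  by rewrite /circle /t0 e1 e2 !subrKC.
pose r := expR x; have r0 : 0 < r by exact: expR_gt0.
have [e e0 He] : exists2 e : R, 0 < e & forall t, `|t - t0| < e -> V (circle Z0 r t) = -oo%E.
  pose f t := sqd (circle Z0 r t) (cexp z).
  have cf : {for t0, continuous f}.
    have c1 : {for t0, continuous (fun t => (circle Z0 r t).1 - (cexp z).1)}.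
      apply: cvgB; last exact: cvg_cst.
      by apply: (@continuous_comp _ _ _ (circle Z0 r) fst t0); [exact: continuous_circle|exact: cvg_fst].
    have c2 : {for t0, continuous (fun t => (circle Z0 r t).2 - (cexp z).2)}.
      apply: cvgB; last exact: cvg_cst.
      by apply: (@continuous_comp _ _ _ (circle Z0 r) snd t0); [exact: continuous_circle|exact: cvg_snd].
    rewrite (_ : f = fun t => ((circle Z0 r t).1 - (cexp z).1) * ((circle Z0 r t).1 - (cexp z).1) +
      ((circle Z0 r t).2 - (cexp z).2) * ((circle Z0 r t).2 - (cexp z).2)); last first.
      by apply/funext => t; rewrite /f /sqd !expr2.
    by apply: cvgD; apply: cvgM.
  have f0 : f t0 < Num.min (expR (l0 + 2 * z.1)) (expR z.1 ^+ 2).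
    by rewrite /f circ /sqd !subrr expr0n/= addr0 lt_min expR_gt0 exprn_gt0// expR_gt0.
  have nf : nbhs t0 [set t | f t < Num.min (expR (l0 + 2 * z.1)) (expR z.1 ^+ 2)] by exact: (cvgr_lt (f t0) cf _ f0).
  move: nf => /nbhs_ballP[e /= e0 He].
  by exists e => // t te; apply: Hnear; apply: He; rewrite /ball/= distrC.
have [C HC] : exists C : R, forall t, (V (circle Z0 r t) <= C%:E)%E.
  have [Vfin lV _] := sV.
  have [C HC] := usc_bounded (@compact_rect R (Z0.1 - r) (Z0.1 + r) (Z0.2 - r) (Z0.2 + r)) lV Vfin.
  exists C => t; apply: HC; rewrite /circle.
  have h1 := ler_wpM2l (ltW r0) (cos_max t); have h2 := ler_wpM2l (ltW r0) (sin_max t).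
  move: h1 h2; rewrite -{1 3}(gtr0_norm r0) -!normrM !mulr1 !ler_norml => /andP[? ?] /andP[? ?].
  by split; rewrite /= in_itv/=; apply/andP; lra.
have [VZC] := subharmonic_circle sV r0 HC.
have p0 : 0 < 2 * pi :> R by rewrite mulr_gt0 ?pi_gt0.
pose F t := maxe 0%E (C%:E - V (circle Z0 r t))%E.
have F0 t : (0 <= F t)%E by rewrite le_max lexx.
have mF : measurable_fun (setT : set (measurableTypeR R)) F.
  have [_ lV _] := sV; apply: measurable_maxe; first exact: measurable_cst.
  apply: emeasurable_funD; first exact: measurable_cst.
  by apply: lower_semicontinuous_measurable; exact: (lsc_comp (@continuous_circle _ Z0 r) lV).
pose h : R := Num.min (e / 2) 1.
have h0 : 0 < h by rewrite lt_min divr_gt0 ?ltr01.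
have h1 : h <= 1 by rewrite ge_min lexx orbT.
have he : h <= e / 2 by rewrite ge_min lexx.
(* As t0 lies in [0, 2 pi], an interval on its right in the first half, or on its left in the
   second, stays inside [0, 2 pi[. *)
have [a [b [ab aI bI]]] : exists a b : R, [/\ a < b, 0 <= a /\ b < 2 * pi &
    forall t, a <= t <= b -> `|t - t0| < e].
  have := @pi_ge2 R; move: hn; rewrite ler_norml => /andP[k1 k2] pi2.
  have [tp|tp] := leP t0 pi.
    exists t0, (t0 + h); split; [lra|split; lra|].
    by move=> t /andP[? ?]; rewrite ltr_norml; apply/andP; lra.
  exists (t0 - h), (t0 - h / 2); split; [lra|split; lra|].
  by move=> t /andP[? ?]; rewrite ltr_norml; apply/andP; lra.
have lb : (\int[mu]_(t in `[a, b]) F t <= \int[mu]_(t in `[0%R, (2 * pi)%R[) F t)%E.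
  apply: (@ge0_subset_integral _ _ _ mu (`[a, b]%classic : set R) (`[0%R, (2 * pi)%R[%classic : set R)).
  - exact: measurable_itv.
  - exact: measurable_itv.
  - exact: measurable_funTS.
  - by move=> t _.
  - move=> t; rewrite /= !in_itv/= => /andP[t2 t3]; apply/andP; lra.
have inf : (\int[mu]_(t in `[a, b]) F t = +oo)%E.
  rewrite (eq_integral (cst +oo%E)); last first.
    move=> t; rewrite inE/= in_itv/= => /bI/He => VE.
    by rewrite /F VE /=; apply/max_idPr; rewrite leey.
  rewrite integral_cst; last exact: measurable_itv.
  have mE : lebesgue_measure (`[a, b]%classic : set R) = (b - a)%:E.
    by rewrite lebesgue_measure_itv/= lte_fin ab.
  transitivity (+oo * (b - a)%:E)%E; first by congr (_ * _)%E.
  by rewrite gt0_mulye// lte_fin subr_gt0.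
move: lb; rewrite inf leye_eq => /eqP ->.
by case: (V Z0) VZC VZ0 => [v| |]//=; rewrite -EFinB -EFinM leye_eq.
Qed.

End complex_log.

(** * The maximum principle *)

Section barrier.
Variable R : realType.

Let lip1 (f f' : R -> R) : (forall x : R, is_derive x 1 f (f' x)) -> (forall x, `|f' x| <= 1) ->
  forall a b, `|f a - f b| <= `|a - b|.
Proof.
move=> df f1; have key a b : a <= b -> `|f b - f a| <= `|b - a|.
  move=> ab; have [|c _ ->] := MVT_segment ab (fun x _ => df x).
    apply: continuous_subspaceT => x; apply/differentiable_continuous/derivable1_diffP.
    by case: (df x).
  by rewrite normrM ler_piMl.
move=> a b; have [/key h|/ltW/key//] := leP a b.
by rewrite distrC (distrC a).
Qed.

(** Compares |e^v - e^w|, whose logarithm is harmonic and periodic, with the Euclidean distance that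
    defines capacity. The constants add up to 4, which is absorbed by e^2. *)
Lemma sqd_cexp_le (X : R) (v w : R * R) : v.1 <= X -> w.1 <= X ->
  sqd (cexp v) (cexp w) <= expR (2 * X + 2) * euclid_dist v w ^+ 2 /\
  sqd (cexp v) (cexp w) <= expR (2 * X + 2).
Proof.
have four : 4 <= expR 2 :> R.
  have := @expR_ge1Dx R 1; have -> : expR (2 : R) = expR 1 * expR 1 by rewrite -expRD -natr1.
  by nra.
move=> vX wX; rewrite expRD expRM_natl; have e0 := expR_gt0 X.
have ev : expR v.1 <= expR X by rewrite ler_expR.
have ew : expR w.1 <= expR X by rewrite ler_expR.
have ev0 := expR_gt0 v.1; have ew0 := expR_gt0 w.1.
have de : `|expR v.1 - expR w.1| <= expR X * `|v.1 - w.1|.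
  have key a b : b <= X -> a <= b -> `|expR b - expR a| <= expR X * `|b - a|.
    move=> bX ab; rewrite !ger0_norm ?subr_ge0 ?ler_expR//.
    have := @expR_ge1Dx R (a - b); have := expR_gt0 b.
    have -> : expR a = expR b * expR (a - b) by rewrite -expRD subrKC.
    have : expR b <= expR X by rewrite ler_expR.
    by move: (expR b) (expR (a - b)) (expR X) => p q r; nra.
  have [h|/ltW h] := leP v.1 w.1; last exact: key.
  by rewrite distrC (distrC v.1); exact: key.
have dc : `|cos v.2 - cos w.2| <= `|v.2 - w.2|.
  by apply: (lip1 (f' := fun x => - sin x)) => x; rewrite normrN sin_max.
have ds : `|sin v.2 - sin w.2| <= `|v.2 - w.2|.
  by apply: (lip1 (f' := fun x => cos x)) => x; rewrite cos_max.
have cv := cos_max v.2; have sv := sin_max v.2.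
rewrite euclid_dist_sqr /sqd /cexp/=; split; last first.
  have cw := cos_max w.2; have sw := sin_max w.2.
  have cs1 := cos2Dsin2 v.2; have cs2 := cos2Dsin2 w.2.
  move: (cos v.2) (sin v.2) (cos w.2) (sin w.2) (expR v.1) (expR w.1) (expR X) (expR 2) four cs1 cs2 ev ew ev0 ew0 e0 {de dc ds cv sv cw sw}.
  move=> a b a' b' p q r f four cs1 cs2 pr qr p0 q0 r0.
  have h : (p * a - q * a') ^+ 2 + (p * b - q * b') ^+ 2 <= 2 * (p ^+ 2 * (a ^+ 2 + b ^+ 2) + q ^+ 2 * (a' ^+ 2 + b' ^+ 2)).
    have := sqr_ge0 (p * a + q * a'); have := sqr_ge0 (p * b + q * b'); lra.
  apply: (le_trans h); rewrite cs1 cs2 !mulr1.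
  have : p ^+ 2 <= r ^+ 2 by rewrite ler_sqr ?nnegrE ?(ltW p0) ?(ltW r0).
  have : q ^+ 2 <= r ^+ 2 by rewrite ler_sqr ?nnegrE ?(ltW q0) ?(ltW r0).
  have := sqr_ge0 r; move: (p ^+ 2) (q ^+ 2) (r ^+ 2) => P Q S; nra.
have bound (f : R -> R) : `|f v.2| <= 1 -> `|f v.2 - f w.2| <= `|v.2 - w.2| ->
    (expR v.1 * f v.2 - expR w.1 * f w.2) ^+ 2 <= 2 * expR X ^+ 2 * ((v.1 - w.1) ^+ 2 + (v.2 - w.2) ^+ 2).
  move=> f1 fd.
  have -> : expR v.1 * f v.2 - expR w.1 * f w.2 = (expR v.1 - expR w.1) * f v.2 + expR w.1 * (f v.2 - f w.2) by ring.
  have h1 : ((expR v.1 - expR w.1) * f v.2) ^+ 2 <= expR X ^+ 2 * (v.1 - w.1) ^+ 2.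
    rewrite -exprMn -real_normK ?num_real// -[leRHS]real_normK ?num_real// ler_sqr ?nnegrE//.
    rewrite !normrM (gtr0_norm e0); apply: le_trans de; by rewrite ler_piMr.
  have h2 : (expR w.1 * (f v.2 - f w.2)) ^+ 2 <= expR X ^+ 2 * (v.2 - w.2) ^+ 2.
    rewrite -exprMn -real_normK ?num_real// -[leRHS]real_normK ?num_real// ler_sqr ?nnegrE//.
    rewrite !normrM (gtr0_norm e0) (gtr0_norm ew0); by apply: ler_pM => //; exact: ltW.
  move: h1 h2; set p := (_ - _) * f _; set q := expR w.1 * _ => h1 h2.
  have := sqr_ge0 (p - q); lra.
have := bound cos cv dc; have := bound sin sv ds.
have : 0 <= expR X ^+ 2 * ((v.1 - w.1) ^+ 2 + (v.2 - w.2) ^+ 2) by rewrite mulr_ge0 ?sqr_ge0// addr_ge0 ?sqr_ge0.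
move: (expR X ^+ 2) ((v.1 - w.1) ^+ 2 + _) => p D pD.
have : p * D * 4 <= p * D * expR 2 by rewrite ler_wpM2l.
move: (expR 2) => f h4; set x := (_ - _) ^+ 2; set y := (_ - _) ^+ 2 => hy hx.
by rewrite mulrAC; lra.
Qed.

Variable A : set (R * R).
Hypotheses (oA : open A) (pA : forall (n : int) p, A p -> A (p.1, p.2 + n%:~R * (2 * pi))).

Let pA' (n : int) p : A (p.1, p.2 + n%:~R * (2 * pi)) -> A p.
Proof.
move=> /(pA (- n)); rewrite /= -addrA -mulrDl -intrD subrr mul0r addr0.
by case: p.
Qed.

(** A point p with e^p too close to e^z is, up to a multiple of 2 pi i, in a neighbourhood of z
    inside A, and A is invariant under these translations. *)
Lemma sqd_away z : A z -> exists l : R, forall p, ~ A p -> expR l < sqd (cexp z) (cexp p).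
Proof.
move=> Az; have /near_ball[e e0 He] : nbhs z A by apply: open_nbhs_nbhs.
pose d := Num.min e 1.
have d0 : 0 < d by rewrite lt_min e0 ltr01.
have dpi : d < pi by apply: (@le_lt_trans _ _ 1); [rewrite ge_min lexx orbT|have := @pi_ge2 R; lra].
have de : d <= e by rewrite ge_min lexx.
have [l0 Hl0] := log_disc_lattice d0 dpi.
exists (l0 + 2 * z.1) => p nAp; rewrite ltNge; apply/negP => h.
have [|n [n1 n2]] := Hl0 z p.
  by move: h; rewrite /sqd -[X in X + _ <= _]sqrrN -[X in _ + X <= _]sqrrN !opprB.
by apply: nAp; apply: (@pA' n); apply: He => /=; lra.
Qed.

Lemma sqd_pos z p : A z -> ~ A p -> 0 < sqd (cexp z) (cexp p).
Proof. by move=> /sqd_away[l H] /H; apply: lt_trans; exact: expR_gt0. Qed.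

Lemma log_sum_harmonic (s : seq (R * R)) (L : R) : (forall p, p \in s -> ~ A p) ->
  let b w := \sum_(p <- s) (ln (sqd (cexp w) (cexp p)) - L) in
  Ck 2 A b /\ forall w, A w -> laplacian b w = 0.
Proof.
elim: s => [|p s IH] Hs b.
  rewrite (_ : b = fun=> 0); last by apply/funext => w; rewrite /b big_nil.
  by split; [exact: Ck_cst|move=> w _; exact: laplacian_cst].
have [|Cs Ls] := IH; first by move=> q qs; apply: Hs; rewrite inE qs orbT.
have nAp : ~ A p by apply: Hs; rewrite inE eqxx.
have Cl : Ck 2 A (fun w => ln (sqd (cexp w) (cexp p))).
  apply: (@Ck_subset _ _ [set w | 0 < sqd (cexp w) (cexp p)]); first by move=> w Aw; exact: sqd_pos.
  by apply: locally_sm_Ck; exact: smooth_ln_sqd.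
have C1 := Ck_add oA Cl (Ck_cst 2 A (- L)).
rewrite (_ : b = fun w => (ln (sqd (cexp w) (cexp p)) - L) + \sum_(p <- s) (ln (sqd (cexp w) (cexp p)) - L)); last first.
  by apply/funext => w; rewrite /b big_cons.
split; first exact: (Ck_add oA C1 Cs).
move=> w Aw; rewrite (laplacianD oA Aw C1 Cs) (laplacianD oA Aw Cl (Ck_cst 2 A (- L))).
by rewrite laplacian_cst Ls// laplacian_ln_sqd ?addr0// sqd_pos.
Qed.

(** b is the mean over a finite set s in K of ln |e^w - e^p|^2 - L, where L makes every term
    nonpositive for x <= X. The poles lie outside A. [Cb] depends on z0 and X but neither on N nor
    on K, so the coefficient of the barrier can be fixed before its depth. *)
Lemma barrier (z0 : R * R) (X : R) : A z0 -> exists2 Cb : R, 0 <= Cb & forall (N : R) (K : set (R * R)),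
  0 <= N -> compact K -> (forall p, K p -> ~ A p /\ p.1 <= X) ->
  (forall P : probability (plane_mT R) R, P K = 1%E -> log_energy P = +oo%E) ->
  exists b : R * R -> R, [/\ Ck 2 A b /\ (forall w, A w -> laplacian b w = 0),
    forall w, A w -> w.1 <= X -> b w <= 0,
    forall p, K p -> \forall w \near p, A w -> w.1 <= X -> b w <= - N,
    - Cb <= b z0 &
    forall w w', cexp w = cexp w' -> b w = b w'].
Proof.
move=> Az0; have [l Hl] := sqd_away Az0; pose L := 2 * X + 2.
exists (Num.max 0 (L - l)); first by rewrite le_max lexx.
move=> N K N0 cK KA KE; have [K0|/set0P K0] := eqVneq K set0.
  exists (fun=> 0); split => //.
  - by split; [exact: Ck_cst|move=> w _; exact: laplacian_cst].
  - by move=> p; rewrite K0.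
  - by rewrite oppr_le0 le_max lexx.
(* The additional 1 pays for passing from a point of K to its neighbours. *)
have [s [s0 sK sN]] := log_potential_large (N + 1) cK K0 KE.
have sA p : p \in s -> ~ A p by move=> /sK/KA[].
have sX p : p \in s -> p.1 <= X by move=> /sK/KA[].
have [Cs Ls] := log_sum_harmonic L sA.
set b := (fun w => \sum_(p <- s) _) in Cs Ls.
have n0 : 0 < (size s)%:R :> R by rewrite ltr0n lt0n size_eq0.
have n1 : 1 <= (size s)%:R :> R by rewrite ler1n lt0n size_eq0.
have sc (x : R) : \sum_(q <- s) x = (size s)%:R * x.
  by rewrite big_const_seq count_predT iter_addr_0 mulr_natl.
have ds w p : A w -> p \in s -> 0 < euclid_dist w p.
  move=> Aw ps; apply: euclid_dist_gt0; apply/eqP => e; exact: (sA p ps (eq_ind _ A Aw _ e)).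
have term w p : A w -> w.1 <= X -> p \in s ->
    ln (sqd (cexp w) (cexp p)) - L <= - 2 * Num.max 0 (- ln (euclid_dist w p)).
  move=> Aw wX ps; have [h1 h2] := sqd_cexp_le wX (sX _ ps).
  have S0 := sqd_pos Aw (sA _ ps); have D0 := ds _ _ Aw ps.
  have e2 : ln (sqd (cexp w) (cexp p)) <= L.
    by rewrite -[leRHS]expRK ler_ln ?posrE ?expR_gt0.
  have e1 : ln (sqd (cexp w) (cexp p)) <= L + 2 * ln (euclid_dist w p).
    rewrite -[L]expRK mulr_natl -lnXn// -lnM ?posrE ?expR_gt0 ?exprn_gt0//.
    by rewrite ler_ln ?posrE ?mulr_gt0 ?expR_gt0 ?exprn_gt0.
  by rewrite /Num.max; case: ifP => _; lra.
have sumle w : A w -> w.1 <= X -> b w <= - 2 * \sum_(p <- s) Num.max 0 (- ln (euclid_dist w p)).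
  move=> Aw wX; rewrite /b mulr_sumr !big_seq; apply: ler_sum => p ps; exact: term.
have max0 x : 0 <= Num.max 0 x :> R by rewrite le_max lexx.
exists (fun w => (size s)%:R^-1 * b w); split.
- split; first exact: (Ck_mul oA (Ck_cst 2 A _) Cs).
  by move=> w Aw; rewrite (laplacian_scale _ oA Aw Cs) Ls// mulr0.
- move=> w Aw wX; rewrite mulr_ge0_le0 ?invr_ge0 ?(ltW n0)//.
  apply: (le_trans (sumle _ Aw wX)); rewrite mulNr oppr_le0 mulr_ge0//.
  by apply: sumr_ge0 => p _; exact: max0.
- move=> p Kp.
  suff : \forall w \near p, A w -> w.1 <= X -> N * (size s)%:R <= \sum_(q <- s) Num.max 0 (- ln (euclid_dist w q)).
    apply: filterS => w H Aw wX; have := H Aw wX; have := sumle _ Aw wX.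
    rewrite ler_pdivrMl// mulrN mulrC => h1 h2.
    have : 0 <= N * (size s)%:R by rewrite mulr_ge0// ltW.
    by lra.
  have nd (r : R) : 0 < r -> \forall w \near p, euclid_dist w p < r.
    move=> r0; apply/near_ball; exists (r / 2); first by rewrite divr_gt0.
    by move=> w w1 w2; apply: (le_lt_trans (euclid_dist_le _ _)); lra.
  (* At a pole the single term of p is already large enough; elsewhere the potential is large at p
     and has to be carried over to nearby points. *)
  have [ps|nps] := boolP (p \in s).
    have r0 : 0 < expR (- (N * (size s)%:R)) by exact: expR_gt0.
    apply: filterS (nd _ r0) => w wd Aw wX.
    rewrite (big_rem p)//=; apply: ler_wpDr; first by apply: sumr_ge0 => q _; exact: max0.
    rewrite le_max; apply/orP; right.
    rewrite lerNr -[leRHS]expRK ler_ln ?posrE ?expR_gt0 ?(ltW wd)//; exact: ds.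
  have pN := (sN p Kp); have {}pN : (N + 1) * (size s)%:R <= \sum_(q <- s) Num.max 0 (- ln (euclid_dist p q)).
    by case: pN => //; rewrite (negbTE nps).
  (* If w is closer to p than q is, then |w - q| < 2 |p - q| <= e |p - q|, so each logarithm loses
     at most 1. *)
  have near1 : \forall w \near p, forall q, q \in s -> A w ->
      Num.max 0 (- ln (euclid_dist p q)) - 1 <= Num.max 0 (- ln (euclid_dist w q)).
    have pq q : q \in s -> 0 < euclid_dist p q.
      by move=> qs; apply: euclid_dist_gt0; apply: contraNneq nps => ->.
    have one q : q \in s -> \forall w \near p, A w ->
        Num.max 0 (- ln (euclid_dist p q)) - 1 <= Num.max 0 (- ln (euclid_dist w q)).
      move=> qs; apply: filterS (nd _ (pq q qs)) => w wd Aw.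
      have d1 := pq q qs; have d2 := ds w q Aw qs.
      have tri := euclid_dist_triangle w p q.
      have h : ln (euclid_dist w q) <= 1 + ln (euclid_dist p q).
        rewrite -{1}(expRK 1) -lnM ?posrE ?expR_gt0// ler_ln ?posrE ?mulr_gt0 ?expR_gt0//.
        by have := @expR_ge1Dx R 1; nra.
      have m1 : - ln (euclid_dist w q) <= Num.max 0 (- ln (euclid_dist w q)) by rewrite le_max lexx orbT.
      have := max0 (- ln (euclid_dist w q)).
      by move=> m0; rewrite lerBlDr ge_max; apply/andP; split; lra.
    have sub (t : seq (R * R)) : {subset t <= s} -> \forall w \near p, forall q, q \in t -> A w ->
        Num.max 0 (- ln (euclid_dist p q)) - 1 <= Num.max 0 (- ln (euclid_dist w q)).
      elim: t => [|q t IH] ts; first by apply/near_ball; exists 1 => // w _ _ q; rewrite in_nil.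
      have qs : q \in s by apply: ts; rewrite inE eqxx.
      have /near_ball[e1 e10 h1] := one q qs.
      have /near_ball[e2 e20 h2] := IH (fun q' h => ts q' (mem_behead (s := q :: t) h)).
      apply/near_ball; exists (Num.min e1 e2); first by rewrite lt_min e10 e20.
      move=> w; rewrite !lt_min => /andP[v1 v2] /andP[v3 v4] q'.
      by rewrite inE => /orP[/eqP ->|]; [exact: h1|exact: h2].
    exact: sub.
  apply: filterS near1 => w H Aw _.
  have : \sum_(q <- s) (Num.max 0 (- ln (euclid_dist p q)) - 1) <= \sum_(q <- s) Num.max 0 (- ln (euclid_dist w q)).
    by rewrite !big_seq; apply: ler_sum => q qs; exact: H.
  by rewrite sumrB sc mulr1; lra.
(* All poles stay at a fixed distance from e^z0, so every term is at least l - L and the bound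
   survives averaging whatever the number of poles. *)
- have : (size s)%:R * (l - L) <= b z0.
    rewrite /b -sc !big_seq; apply: ler_sum => p ps; rewrite lerD2r.
    rewrite -[leLHS]expRK ler_ln ?posrE ?expR_gt0 ?sqd_pos//; [|exact: sA].
    by apply/ltW/Hl; exact: sA.
  move=> h; rewrite mulrC ler_pdivlMr//; apply: le_trans h; rewrite mulrC ler_pM2l//.
  by rewrite lerNl opprB le_max lexx orbT.
- by move=> w w' e; rewrite /b e.
Qed.

End barrier.

Section small_boxes.
Variable R : realType.
Implicit Types d x y z : R.

Lemma small_lt d x : 0 < d -> 4 * d <= x -> d < x. Proof. by move=> ? ?; lra. Qed.

Lemma small_lt_pi d : 0 < d -> 4 * d <= 1 -> d < pi.
Proof. by move=> ? ?; have := @pi_ge2 R; lra. Qed.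

Lemma near_trans d x y z : 0 < d -> `|x - y| <= d -> `|y - z| < d -> `|x - z| < 4 * d.
Proof. by move=> d0 h1 h2; apply: (le_lt_trans (ler_distD y x z)); lra. Qed.

Lemma rect_window (v : R * R) d x1 x2 y z t : `|v.1 - z| < 4 * d -> 4 * d <= 1 -> x1 <= z -> z <= x2 ->
  `|t - y| <= pi -> rect (x1 - 1) (x2 + 1) (y - pi) (y + pi) (v.1, t).
Proof.
rewrite ltr_norml ler_norml => /andP[? ?] ? ? ? /andP[? ?].
by split; rewrite /= in_itv/=; apply/andP; lra.
Qed.

End small_boxes.

Section maximum_principle.
Variables (R : realType) (k th : R -> R) (c : R).
Local Notation beta := (fun x : R => c * (flat 0 (x + 1) * flat 0 (- x))).
Hypothesis dk : forall x : R, is_derive x 1 k (th x).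
Hypothesis dth : forall x : R, is_derive x 1 th (beta x).
Hypothesis c0 : 0 < c.
Hypothesis k_id : forall x : R, 0 <= x -> k x = x.
Hypothesis k_cst : forall x : R, x <= -1 -> k x = k (-1).
Variables (cm : R).
Hypotheses (cm0 : 0 < cm) (cmE : ((2 * pi)%:E * mass beta = cm%:E)%E).

Variables (A : set (R * R)) (rho s eps B : R) (Q : R * R -> R) (Vu Vw : R * R -> \bar R).
Hypotheses (oA : open A) (pA : forall (n : int) p, A p -> A (p.1, p.2 + n%:~R * (2 * pi))).
Hypotheses (s0 : 0 < s) (srho : s < rho) (eps0 : 0 < eps) (B0 : 0 <= B).
Hypotheses (CQ : Ck 2 A Q) (LQ : forall w, A w -> laplacian Q w = 0).
Hypothesis pQ : forall (n : int) p, Q (p.1, p.2 + n%:~R * (2 * pi)) = Q p.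
Hypothesis QB : forall w, A w -> Q w <= B * expR (s * w.1).
Hypotheses (sVw : subharmonic Vw) (lVu : lower_semicontinuous (fun v => - Vu v)%E) (Vufin : forall v, (Vu v < +oo)%E).
Hypothesis gap : forall w, (Vw (cexp w) + (eps * expR (rho * w.1))%:E <= Vu (cexp w))%E.
(** The centre w may vary near z, because the inequality will be used at an approximate maximum and
    not at the limit point z itself. *)
Hypothesis HVu : forall z, A z -> exists2 r : R, 0 < r & forall (w : R * R) (d l l' : R),
  `|w.1 - z.1| < r -> `|w.2 - z.2| < r -> 0 < d -> d < r -> fits w d l -> l' < l - 1 ->
  (\int[@area R]_(v in (box w d : set (plane_mT R))) (Vu (cexp v) * (wt c l w v - wt c l' w v)%:E) = 0)%E.
Hypothesis HK : forall (K : set (R * R)) (eta : R), 0 < eta -> compact K ->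
  (forall p, K p -> ~ A p /\ closure [set w | A w /\ eta <= Q w] p) ->
  forall P : probability (plane_mT R) R, P K = 1%E -> log_energy P = +oo%E.

Let VuA z : A z -> Vu (cexp z) != -oo%E.
Proof.
move=> Az; have [r r0 Hr] := HVu Az; pose d : R := Num.min (r / 2) 1.
have d0 : 0 < d by rewrite lt_min divr_gt0 ?ltr01.
have dpi : d < pi by apply: (@le_lt_trans _ _ 1); [rewrite ge_min lexx orbT|have := @pi_ge2 R; lra].
have dr : d < r by apply: (@le_lt_trans _ _ (r / 2)); [rewrite ge_min lexx|lra].
have [l0 Hl0] := log_disc d0 dpi.
have fl : fits z d (l0 + 2 * z.1) by move=> w; exact: Hl0.
apply: (harmonic_finite c0 cm0 cmE d0 dpi fl lVu Vufin) => l' ll'.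
by apply: Hr => //; rewrite subrr normr0.
Qed.

(** Instead of letting delta tend to 0, all parameters are fixed from a supposed Q z0 > 0: a quarter
    of it is spent on [eta], a quarter on delta (V_u - V_w) and at most an eighth on the barrier, so
    F z0 > 0. The positive supremum then excludes all places near which F is negative, and
    [local_gain] excludes the others. *)
Lemma max_principle z0 : A z0 -> Vw (cexp z0) != -oo%E -> Q z0 <= 0.
Proof.
move=> Az0 Vwz0; rewrite leNgt; apply/negP => q0.
have Vwfin : forall v, (Vw v < +oo)%E by case: sVw.
pose vu z := fine (Vu (cexp z)); pose vw z := fine (Vw (cexp z)).
have vuE z : A z -> Vu (cexp z) = (vu z)%:E.
  by move=> /VuA; rewrite /vu; have := Vufin (cexp z); case: (Vu (cexp z)).
have vwE z : Vw (cexp z) != -oo%E -> Vw (cexp z) = (vw z)%:E.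
  by rewrite /vw; have := Vwfin (cexp z); case: (Vw (cexp z)).
have gapR z : A z -> Vw (cexp z) != -oo%E -> vw z + eps * expR (rho * z.1) <= vu z.
  by move=> Az Vz; have := gap z; rewrite (vuE _ Az) (vwE _ Vz) -EFinD lee_fin.
pose g0 := vu z0 - vw z0.
have g00 : 0 < g0.
  have := gapR z0 Az0 Vwz0; have := mulr_gt0 eps0 (expR_gt0 (rho * z0.1)); rewrite /g0; lra.
pose eta := Q z0 / 4; pose del := Q z0 / (4 * g0).
have eta0 : 0 < eta by rewrite divr_gt0.
have del0 : 0 < del by rewrite divr_gt0// mulr_gt0.
have delg : del * g0 = eta by rewrite /del /eta; field; rewrite gt_eqF.
(* For x <= x1 the bound B e^(s x) on Q is at most eta / 2; this uses s > 0. *)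
pose y1 := ln (eta / (2 * (B + 1))) / s; pose x1 := Num.min z0.1 y1.
have B1 : 0 < B + 1 by have := B0; lra.
have low x : x <= x1 -> B * expR (s * x) <= eta / 2.
  move=> xx; have : expR (s * x) <= eta / (2 * (B + 1)).
    rewrite -[leRHS]lnK ?posrE ?divr_gt0 ?mulr_gt0// ler_expR [leLHS]mulrC -ler_pdivlMr//.
    by apply: (le_trans xx); rewrite ge_min lexx orbT.
  have e0 := expR_gt0 (s * x); rewrite ler_pdivlMr ?mulr_gt0//.
  by have := B0; nra.
(* For x >= x2 the gap del eps e^(rho x) dominates the bound B e^(s x); this uses s < rho. *)
pose y2 := ln ((B + 1) / (del * eps)) / (rho - s); pose x2 := Num.max z0.1 y2.
have de0 : 0 < del * eps by rewrite mulr_gt0.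
have rs : 0 < rho - s by rewrite subr_gt0.
have high x : x2 <= x -> B * expR (s * x) <= del * (eps * expR (rho * x)).
  move=> xx; have : (B + 1) / (del * eps) <= expR ((rho - s) * x).
    rewrite -[leLHS]lnK ?posrE ?divr_gt0// ler_expR [leRHS]mulrC -ler_pdivrMr//.
    by apply: le_trans xx; rewrite le_max lexx orbT.
  rewrite ler_pdivrMr// => h.
  have -> : expR (rho * x) = expR ((rho - s) * x) * expR (s * x).
    by rewrite -expRD -mulrDl subrK.
  rewrite (_ : del * _ = expR ((rho - s) * x) * (del * eps) * expR (s * x)); last by ring.
  by rewrite ler_wpM2r ?expR_ge0//; lra.
have x1z : x1 <= z0.1 by rewrite ge_min lexx.
have x2z : z0.1 <= x2 by rewrite le_max lexx.
pose X := x2 + 1.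
(* The quadratic term is thereby at most eta / 8 for x <= X, within what the constant - eta
   allows. *)
pose kap := eta / (8 * expR X ^+ 2).
have eX : 0 < expR X ^+ 2 by rewrite exprn_gt0// expR_gt0.
have kap0 : 0 < kap by rewrite divr_gt0// mulr_gt0.
have kapX x : x <= X -> kap * expR x ^+ 2 <= eta / 8.
  move=> xX; have : expR x ^+ 2 <= expR X ^+ 2 by rewrite ler_sqr ?nnegrE ?expR_ge0// ler_expR.
  move=> h; apply: (@le_trans _ _ (kap * expR X ^+ 2)); first by rewrite ler_pM2l.
  by rewrite /kap le_eqVlt; apply/orP; left; apply/eqP; field; rewrite gt_eqF// expR_gt0.
have [Cb Cb0 Hb] := barrier oA pA X Az0.
pose lam := Q z0 / (8 * (Cb + 1)).
have Cb1 : 0 < Cb + 1 by lra.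
have lam0 : 0 < lam by rewrite divr_gt0// mulr_gt0.
have lamC : lam * Cb <= Q z0 / 8.
  rewrite /lam mulrAC ler_pdivrMr ?mulr_gt0//.
  by have := mulr_ge0 (ltW q0) Cb0; lra.
(* With this depth, lam b outweighs the bound of Q on x <= X near K. *)
pose N := B * expR (s * X) / lam.
have N0 : 0 <= N by rewrite divr_ge0 ?(ltW lam0)// mulr_ge0 ?expR_ge0.
have lamN : lam * N = B * expR (s * X) by rewrite /N mulrC divfK// gt_eqF.
(* The margin 1 on either side of [x1, x2] keeps a small box about a limit point in the region where
   F is compared with its supremum. *)
pose Re := rect (x1 - 1) X (z0.2 - pi) (z0.2 + pi).
(* These are the points outside A near which Q is not known to drop below eta / 2. At the other
   points outside A the constant - eta makes F negative nearby. *)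
pose K := Re `&` (~` A `&` closure [set w | A w /\ eta / 2 <= Q w]).
have cK : compact K.
  apply: compact_closedI; first exact: compact_rect.
  by apply: closedI; [exact: open_closedC|exact: closed_closure].
have KA p : K p -> ~ A p /\ p.1 <= X.
  by move=> [[/= + _] [nA _]]; rewrite in_itv/= => /andP[].
have KE : forall P : probability (plane_mT R) R, P K = 1%E -> log_energy P = +oo%E.
  by apply: (@HK K (eta / 2)); [rewrite divr_gt0|exact: cK|move=> p [_ []]].
have [b [[Cbb Lb] bneg bK bz0 bper]] := Hb N K N0 cK KA KE.
pose H w := Q w + (lam * b w + - eta).
have Clb : Ck 2 A (fun w => lam * b w) by exact: (Ck_mul oA (Ck_cst 2 A lam) Cbb).
have Clbe := Ck_add oA Clb (Ck_cst 2 A (- eta)).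
have CH : Ck 2 A H by exact: (Ck_add oA CQ Clbe).
have LH w : A w -> laplacian H w = 0.
  move=> Aw; rewrite (laplacianD oA Aw CQ Clbe) (laplacianD oA Aw Clb (Ck_cst 2 A (- eta))).
  by rewrite (laplacian_scale lam oA Aw Cbb) Lb// LQ// laplacian_cst mulr0 !addr0.
pose F w := H w + kap * expR w.1 ^+ 2 - del * (vu w - vw w).
(* Where Vw = -oo the number [vw] is the default 0, so these points are kept out of the supremum;
   the inequality for [local_gain] is trivial there. *)
pose G := [set w | [/\ A w, Re w & Vw (cexp w) != -oo%E]].
have ReX w : Re w -> x1 - 1 <= w.1 <= X by move=> [/=]; rewrite in_itv.
have GX w : G w -> w.1 <= X by move=> [_ /ReX/andP[]].
have FQ w : G w -> F w <= Q w + lam * b w - eta + eta / 8 - del * (eps * expR (rho * w.1)).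
  move=> Gw; have := kapX _ (GX _ Gw); case: Gw => Aw _ Vz.
  have := gapR w Aw Vz; rewrite -(ler_pM2l del0) mulrDr /F /H mulrBr; lra.
have de w : 0 < del * (eps * expR (rho * w)) by rewrite mulr_gt0// mulr_gt0// expR_gt0.
have lb w : G w -> lam * b w <= 0.
  by move=> Gw; have /GX wX := Gw; case: Gw => Aw _ _; rewrite mulr_ge0_le0 ?(ltW lam0) ?bneg.
have Fside w : G w -> (w.1 <= x1) || (x2 <= w.1) -> F w < 0.
  move=> Gw /orP[h|h]; have := FQ w Gw; have := lb w Gw; have := de w.1; have := QB (let: And3 a _ _ := Gw in a).
    by have := low _ h; lra.
  by have := high _ h; lra.
have Gz0 : G z0.
  split => //; split; rewrite /= in_itv/=; apply/andP; rewrite /X; have := @pi_gt0 R; lra.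
have Fz0 : 0 < F z0.
  have : lam * - Cb <= lam * b z0 by rewrite ler_pM2l.
  have : 0 <= kap * expR z0.1 ^+ 2 by rewrite mulr_ge0 ?sqr_ge0// ltW.
  rewrite /F /H -/g0 delg /eta mulrN; lra.
pose FG := [set F w | w in G].
have FGs : has_sup FG.
  split; first by exists (F z0); exists z0.
  exists (B * expR (s * X)) => _ [w Gw <-].
  have := FQ w Gw; have := lb w Gw; have := de w.1; have := QB (let: And3 a _ _ := Gw in a).
  have : B * expR (s * w.1) <= B * expR (s * X).
    by rewrite ler_wpM2l// ler_expR ler_pM2l// GX.
  by lra.
pose m := sup FG.
have Fm w : G w -> F w <= m by move=> Gw; apply: ub_le_sup; [case: FGs|exists w].
have m0 : 0 < m by exact: lt_le_trans Fz0 (Fm _ Gz0).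
(* F is not semicontinuous, so z is only a cluster point of a maximizing sequence, and nothing is
   claimed about F at z. *)
have /boolp.choice[y Hy] : forall n : nat, exists w, G w /\ m - n.+1%:R^-1 < F w.
  move=> n; have [_ [w Gw <-] h] := @sup_adherent R FG n.+1%:R^-1 ltac:(by rewrite invr_gt0) FGs.
  by exists w.
have [|z [Rez cz]] := @compact_rect R (x1 - 1) X (z0.2 - pi) (z0.2 + pi) (y @ \oo) _.
  by exists 0%N => // n _; have [[]] := Hy n.
have often (W : set (R * R)) (e : R) : nbhs z W -> 0 < e -> exists w, [/\ W w, G w & m - e < F w].
  move=> nW e0; have ev : (y @ \oo) [set v | exists n, (Num.truncn e^-1 < n.+1)%N /\ v = y n].
    by exists (Num.truncn e^-1) => // n /= en; exists n.
  have [v [[n [en ->]] Wv]] := cz _ _ ev nW.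
  have [Gn Fn] := Hy n; exists (y n); split => //; apply: le_lt_trans Fn.
  rewrite lerD2l lerN2 -[leRHS]invrK lef_pV2 ?posrE ?invr_gt0//.
  by apply: ltW; apply: (lt_le_trans (truncnS_gt _)); rewrite ler_nat.
have nneg (W : set (R * R)) : nbhs z W -> (forall w, W w -> G w -> F w < 0) -> False.
  by move=> nW hW; have [w [Ww Gw]] := often W m nW m0; rewrite subrr => /(lt_trans (hW w Ww Gw)); rewrite ltxx.
have [Az|nAz] := pselect (A z); last first.
  have [Kz|nKz] := pselect (K z).
    apply: (nneg _ (bK z Kz)) => w /= hb Gw; have := FQ w Gw; have := de w.1.
    have wX := GX w Gw; case: Gw => Aw _ _; have := QB Aw.
    have : lam * b w <= lam * - N by rewrite ler_pM2l// hb.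
    have : B * expR (s * w.1) <= B * expR (s * X) by rewrite ler_wpM2l// ler_expR ler_pM2l.
    by rewrite mulrN lamN; lra.
  have : ~ closure [set w | A w /\ eta / 2 <= Q w] z by move=> h; apply: nKz.
  rewrite /closure/= => /existsNP[W /not_implyP[nW]] => hW.
  apply: (nneg W nW) => w Ww Gw; have := FQ w Gw; have := de w.1; have := lb w Gw.
  have : Q w < eta / 2.
    rewrite ltNge; apply/negP => h; apply: hW; exists w; split => //; split => //.
    by case: Gw.
  by lra.
have side (P : R -> Prop) : (\forall x \near z.1, P x) -> \forall w \near z, P w.1.
  by move=> h; exact: (@cvg_fst _ _ (nbhs z.1) (nbhs z.2) _ _ h).
have x1z' : x1 <= z.1.
  rewrite leNgt; apply/negP => h; apply: (nneg [set w | w.1 < x1]).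
    by apply: (side (fun x => x < x1)); exact: (open_near (@open_lt R x1)).
  by move=> w /= /ltW w1 Gw; apply: Fside => //; rewrite w1.
have x2z' : z.1 <= x2.
  rewrite leNgt; apply/negP => h; apply: (nneg [set w | x2 < w.1]).
    by apply: (side (fun x => x2 < x)); exact: (open_near (@open_gt R x2)).
  by move=> w /= /ltW w1 Gw; apply: Fside => //; rewrite w1 orbT.
have [r r0 Hr] := HVu Az.
have /near_ball[e e0 He] : nbhs z A by apply: open_nbhs_nbhs.
pose d : R := Num.min (Num.min e r) 1 / 4.
have min0 : 0 < Num.min (Num.min e r) 1 by rewrite !lt_min e0 r0 ltr01.
have d0 : 0 < d by rewrite divr_gt0.
have [de' dr d1] : [/\ 4 * d <= e, 4 * d <= r & 4 * d <= 1].
  rewrite /d mulrC divfK ?pnatr_eq0//; split; rewrite !ge_min lexx ?orbT//.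
have dpi := small_lt_pi d0 d1.
have [l0 Hl0] := log_disc d0 dpi.
(* All points of [Re] have x >= x1 - 1, so this disc fits about each of them close to z. The gain
   kap e^(l - 1) is thus known before the approximate maximum w is chosen. *)
pose l := l0 + 2 * (x1 - 1).
have [w [[w1 w2] Gw Fw]] : exists w, [/\ `|w.1 - z.1| < d /\ `|w.2 - z.2| < d, G w & m - kap * expR (l - 1) < F w].
  apply: (often [set w | `|w.1 - z.1| < d /\ `|w.2 - z.2| < d]); last by rewrite mulr_gt0// expR_gt0.
  by apply/near_ball; exists d.
have [Aw Rew Vww] := Gw.
have fl : fits w d l.
  move=> v vpi h; apply: Hl0 => //; apply: (le_trans h); rewrite ler_expR /l lerD2l ler_pM2l//.
  by have /andP[] := ReX w Rew.
have bw v : box w d v -> `|v.1 - z.1| < 4 * d /\ `|v.2 - z.2| < 4 * d.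
  by move=> /boxP[v1 v2]; split; [exact: near_trans d0 v1 w1|exact: near_trans d0 v2 w2].
have bA : box w d `<=` A by move=> v /bw[v1 v2]; apply: He; [exact: lt_le_trans v1 de'|exact: lt_le_trans v2 de'].
have ineq v : box w d v ->
    ((H v + kap * expR v.1 ^+ 2)%:E + del%:E * Vw (cexp v) <= m%:E + del%:E * Vu (cexp v))%E.
  move=> bv; have Av := bA v bv; rewrite (vuE _ Av).
  have [->|Vv] := eqVneq (Vw (cexp v)) -oo%E; first by rewrite gt0_muleNy ?lte_fin// addeNy leNye.
  rewrite (vwE _ Vv) -!EFinM -!EFinD lee_fin.
  (* The box may leave the angular window; a multiple of 2 pi i brings v back without changing F. *)
  have [n hn] := window z0.2 v.2; pose v' := (v.1, v.2 + n%:~R * (2 * pi)).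
  have cv : cexp v' = cexp v by exact: cexpD2pi.
  have Gv' : G v'.
    split; [exact: pA| |by rewrite cv].
    have [v1 _] := bw v bv; exact: (rect_window v1 d1 x1z' x2z' hn).
  have := Fm _ Gv'; rewrite /F /H /vu /vw cv /v' pQ (bper _ v cv) /= -/(vu v) -/(vw v); lra.
have Vu0 (l' : R) : l' < l - 1 ->
    (\int[@area R]_(v in (box w d : set (plane_mT R))) (Vu (cexp v) * (wt c l w v - wt c l' w v)%:E) = 0)%E.
  have rd := small_lt d0 dr.
  by move=> ll'; apply: Hr => //; [exact: lt_trans w1 rd|exact: lt_trans w2 rd].
have := local_gain dk dth c0 k_id k_cst cm0 cmE d0 dpi fl lVu Vufin Vu0 sVw oA bA CH LH del0 (ltW kap0) ineq.
rewrite (vuE _ Aw) (vwE _ Vww) -!EFinM -!EFinD lee_fin.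
by move: Fw; rewrite /F; lra.
Qed.

End maximum_principle.

(** * From the complex eigenfunction to real harmonic functions *)

Section complex_parts.
Variable R : realType.

Lemma complex_equation_parts (s a1 a2 a3 b1 b2 b3 : R) (Z : R[i]) :
  (a1 +i* b1)%C + (a2 +i* b2)%C + 2 * (s%:C)%C * (a3 +i* b3)%C + (s%:C)%C ^+ 2 * Z = 0 ->
  a1 + a2 + 2 * s * a3 + s ^+ 2 * complex.Re Z = 0 /\
  b1 + b2 + 2 * s * b3 + s ^+ 2 * complex.Im Z = 0.
Proof.
have -> : (2 : R[i]) = ((2 : R)%:C)%C by rewrite rmorph_nat.
rewrite -rmorphM -rmorphXn /=; case: Z => x y /eqP; rewrite eq_complex => /andP[/eqP/= h1 /eqP/= h2].
split; [rewrite -[RHS]h1|rewrite -[RHS]h2]; ring.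
Qed.

Lemma ler_normc (Z : R[i]) : `|complex.Re Z| <= Normc.normc Z /\ `|complex.Im Z| <= Normc.normc Z.
Proof.
case: Z => x y /=; split; rewrite -sqrtr_sqr ler_wsqrtr//.
  by rewrite lerDl sqr_ge0.
by rewrite lerDr sqr_ge0.
Qed.

End complex_parts.

Section eigenfunction.
Variables (R : realType) (T : R).
Local Notation tor := (torus (ln T)).
Local Notation pr := (@tproj R (ln T)).

Lemma tprojD2pi (n : int) (z : R * R) : pr (z.1, z.2 + n%:~R * (2 * pi)) = pr z.
Proof.
have L : lattice (ln T) (0, n%:~R * (2 * pi)) by exists 0, n; rewrite mul0r.
by have := tproj_add z L; rewrite /= addr0.
Qed.

(** The measure competes in the supremum that defines the capacity, so e^(- energy) <= 0, which only
    an infinite energy allows. *)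
Lemma zero_capacity_energy (E : set tor) (K : set (R * R)) (mu : probability (plane_mT R) R) :
  zero_capacity E -> compact K -> K `<=` pr @^-1` E -> mu K = 1%E -> log_energy mu = +oo%E.
Proof.
move=> ZE cK KE muK; have : (expeR (- log_energy mu) <= 0)%E.
  by rewrite -ZE; apply: ereal_sup_ubound; right; exists mu, K; split.
by case: (log_energy mu) => [r| |] //=; rewrite lee_fin leNgt expR_gt0.
Qed.

(** The strict inequality rules out the default value +oo of [xget], so the minimum is a point of
    the spectrum. *)
Lemma rho_dom_lt (M : set tor) (rho : R) : (rho_dom M < rho%:E)%E ->
  exists2 s, min_positive (Spec M) s & s < rho.
Proof.
rewrite /rho_dom; case: xgetP => [x _ [s ms <-]|_]; last by case/idP.
by rewrite lte_fin => ?; exists s.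
Qed.

(** Multiplication by e^(rho x) turns the constant eps on the torus into a gap growing like e^(rho
    x), faster than the bound on the eigenfunction. *)
Lemma cexp_gap (rho eps : R) (u w : tor -> \bar R) (Vu Vw : R * R -> \bar R) (z : R * R) :
  0 < eps -> (forall z, Vu z < +oo)%E -> (forall z, Vw z < +oo)%E ->
  u (pr z) = (Vu (cexp z) * (expR (- rho * z.1))%:E)%E ->
  w (pr z) = (Vw (cexp z) * (expR (- rho * z.1))%:E)%E ->
  (w (pr z) <= u (pr z) - eps%:E)%E ->
  (Vw (cexp z) + (eps * expR (rho * z.1))%:E <= Vu (cexp z))%E.
Proof.
move=> eps0 Vufin Vwfin -> ->.
have := Vufin (cexp z); have := Vwfin (cexp z); have e0 := expR_gt0 (- rho * z.1).
case: (Vw (cexp z)) => [y| |]// _; last by rewrite addNye leNye.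
case: (Vu (cexp z)) => [x| |]// _; last by rewrite mulNyr gtr0_sg// mul1e addNye -EFinM leeNy_eq.
rewrite -!EFinM -EFinB -EFinD !lee_fin mulNr expRN -lerBrDl => h.
have E0 := expR_gt0 (rho * z.1).
by have := h; rewrite -(ler_pM2r E0) mulrBl !divfK ?gt_eqF//; lra.
Qed.

Lemma eigenfunction_zero (rho s eps B : R) (u w : tor -> \bar R) (M E : set tor) (q : tor -> R[i]) :
  1 < T -> 0 < s -> s < rho -> 0 < eps ->
  subfunction rho u -> subfunction rho w -> (forall p, w p <= u p - eps%:E)%E ->
  open M -> M `<=` Hset rho u -> (forall p, M p -> Normc.normc (q p) <= B) ->
  Csolution (s%:C)%C q M -> zero_capacity E ->
  (forall p, boundary M p -> ~ E p -> Normc.normc (q x) @[x --> within M (nbhs p)] --> (0 : R)) ->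
  forall p, M p -> q p = 0.
Proof.
move=> T1 s0 srho eps0 [Vu [sVu _ _ uE]] [Vw [sVw Vwfin _ wE]] wu oM MH qB [Ca Cb eq] ZE lim p0 Mp0.
have [Vufin lVu _] := sVu; have Vwlt : forall z, (Vw z < +oo)%E by case: sVw.
have [k [th [c [dk dth c0 k_id k_cst]]]] := cut_off R.
have [cm cm0 cmE] := mass_fin c0.
have B0 : 0 <= B.
  apply: le_trans (qB p0 Mp0); have [h _] := ler_normc (q p0); exact: le_trans (normr_ge0 _) h.
pose A := pr @^-1` M.
have oA : open A by rewrite /A -open_tprojE.
have pA (n : int) p : A p -> A (p.1, p.2 + n%:~R * (2 * pi)) by rewrite /A/= tprojD2pi.
have gap z := cexp_gap eps0 Vufin Vwlt (uE z) (wE z) (wu (pr z)).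
have HVu z : A z -> exists2 r : R, 0 < r & forall (w : R * R) (d l l' : R),
    `|w.1 - z.1| < r -> `|w.2 - z.2| < r -> 0 < d -> d < r -> fits w d l -> l' < l - 1 ->
    (\int[@area R]_(v in (box w d : set (plane_mT R))) (Vu (cexp v) * (wt c l w v - wt c l' w v)%:E) = 0)%E.
  move=> Az; have [U [oU LU] Uz] := MH _ Az.
  have /near_ball[e e0 He] : nbhs z (pr @^-1` U).
    by apply: open_nbhs_nbhs; split; rewrite // -open_tprojE.
  have P0 : 0 < ln T by exact: ln_gt0.
  (* A centre within e / 3 and a box of half-width below 2 e / 3 stay in the preimage of U, and P /
     4 and 1 keep the box below half the periods. *)
  exists (Num.min (Num.min (e / 3) (ln T / 4)) 1).
    by rewrite !lt_min ltr01 !divr_gt0.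
  move=> v d l l'; rewrite !lt_min => /andP[/andP[v1 _] _] /andP[/andP[v2 _] _] d0 /andP[/andP[d1 d2] d3] fl ll.
  apply: (integral_log_bump T1 dk dth k_id k_cst lVu uE LU d0 _ _ _ fl ll).
  - by lra.
  - by have := @pi_ge2 R; lra.
  - move=> v' [h1 h2]; apply: He.
      by apply: (le_lt_trans (ler_distD v.1 _ _)); lra.
    by apply: (le_lt_trans (ler_distD v.2 _ _)); lra.
have main Q : Ck 2 A Q -> (forall z, A z -> laplacian Q z = 0) ->
    (forall (n : int) p, Q (p.1, p.2 + n%:~R * (2 * pi)) = Q p) ->
    (forall z, A z -> Q z <= expR (s * z.1) * Normc.normc (q (pr z))) ->
    forall z, A z -> Q z <= 0.
  move=> CQ LQ pQ Qq z Az.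
  have QB v : A v -> Q v <= B * expR (s * v.1).
    move=> Av; apply: (le_trans (Qq v Av)); rewrite mulrC ler_wpM2r ?expR_ge0//; exact: qB.
  (* A point of K outside the preimage of E would project to a boundary point at which q tends to 0,
     while Q >= eta at points of A arbitrarily close to it. So K lies over E. *)
  have HK (K : set (R * R)) (eta : R) : 0 < eta -> compact K ->
      (forall p, K p -> ~ A p /\ closure [set w | A w /\ eta <= Q w] p) ->
      forall P : probability (plane_mT R) R, P K = 1%E -> log_energy P = +oo%E.
    move=> eta0 cK KA P; apply: (zero_capacity_energy ZE cK) => p Kp.
    have [nAp clp] := KA p Kp; apply: contrapT => nE.
    have bp : boundary M (pr p).
      split; last by move=> /interior_subset.
      move=> W nW; have [v [[Av _] Wv]] := clp _ (continuous_tproj nW).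
      by exists (pr v).
    (* Within distance 1 of p the factor e^(s x) is at most e^(s (p.1 + 1)), so smallness of q gives
       smallness of Q. *)
    have e0 : 0 < eta / expR (s * (p.1 + 1)) by rewrite divr_gt0 ?expR_gt0.
    have := lim _ bp nE [set t | t < eta / expR (s * (p.1 + 1))].
    have n0 : nbhs (0 : R) [set t | t < eta / expR (s * (p.1 + 1))].
      by apply: open_nbhs_nbhs; split; [exact: open_lt|].
    move=> /(_ n0) nW; have /near_ball[e e1 He] := continuous_tproj nW.
    have nV : nbhs p [set v | `|v.1 - p.1| < Num.min e 1 /\ `|v.2 - p.2| < e].
      apply/near_ball; exists (Num.min e 1); first by rewrite lt_min e1 ltr01.
      by move=> v v1; rewrite lt_min => /andP[].
    have [v [[Av Qv] [+ v2]]] := clp _ nV; rewrite lt_min => /andP[v1 v3].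
    have := He v v1 v2 Av; rewrite /= ltr_pdivlMr ?expR_gt0// => h.
    have vp : expR (s * v.1) <= expR (s * (p.1 + 1)).
      by rewrite ler_expR ler_pM2l//; move: v3; rewrite ltr_norml => /andP[]; lra.
    have : expR (s * v.1) * Normc.normc (q (pr v)) <= expR (s * (p.1 + 1)) * Normc.normc (q (pr v)).
      by rewrite ler_wpM2r//; have [h' _] := ler_normc (q (pr v)); exact: le_trans (normr_ge0 _) h'.
    by have := Qq v Av; rewrite [X in _ <= X -> _]mulrC; move: h; rewrite /=; lra.
  have mp := max_principle dk dth c0 k_id k_cst cm0 cmE oA pA s0 srho eps0 B0 CQ LQ pQ QB sVw lVu Vufin gap HVu HK.
  (* If Q z > 0, then Q is positive on a neighbourhood, which contains a point with Vw finite,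
     contrary to [max_principle]. *)
  rewrite leNgt; apply/negP => Q0.
  have [cQ _] := CQ.
  have nQ : nbhs z (Q @^-1` [set t | 0 < t]).
    by apply: (cQ z Az); apply: open_nbhs_nbhs; split; [exact: open_gt|].
  have nA : nbhs z A by apply: open_nbhs_nbhs.
  have /near_ball[e1 e10 h1] := nQ; have /near_ball[e2 e20 h2] := nA.
  have m0 : 0 < Num.min e1 e2 by rewrite lt_min e10 e20.
  have [v []] := subharmonic_dense sVw Vwfin z m0.
  rewrite !lt_min => /andP[v1 v2] /andP[v3 v4] /(mp v (h2 v v2 v4)).
  by rewrite leNgt (h1 v v1 v3).
(* The bound on the modulus is symmetric, so the one-sided result applies to both Q and - Q. *)
have zero f : Ck 2 A f -> (forall z, A z -> Lop s f z = 0) ->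
    (forall (n : int) p, f (p.1, p.2 + n%:~R * (2 * pi)) = f p) ->
    (forall z, `|f z| <= Normc.normc (q (pr z))) -> forall z, A z -> f z = 0.
  move=> Cf Lf pf fq z Az; pose Q v := expR (s * v.1) * f v.
  have CQ : Ck 2 A Q by exact: Ck_exp_mul.
  have LQ v : A v -> laplacian Q v = 0 by move=> Av; rewrite (laplacian_exp s oA Av Cf) Lf// mulr0.
  have pQ (n : int) p : Q (p.1, p.2 + n%:~R * (2 * pi)) = Q p by rewrite /Q pf.
  have ez := expR_gt0 (s * z.1).
  apply/eqP; rewrite eq_le; apply/andP; split.
    have := main Q CQ LQ pQ _ z Az; rewrite /Q pmulr_rle0//; apply => v _.
    by rewrite ler_pM2l ?expR_gt0//; exact: le_trans (ler_norm _) (fq v).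
  have := main (fun v => -1 * Q v) (Ck_mul oA (Ck_cst 2 A (-1)) CQ).
  have L' v : A v -> laplacian (fun v => -1 * Q v) v = 0.
    by move=> Av; rewrite (laplacian_scale _ oA Av CQ) LQ// mulr0.
  move=> /(_ L'); have p' (n : int) p : -1 * Q (p.1, p.2 + n%:~R * (2 * pi)) = -1 * Q p by rewrite pQ.
  move=> /(_ p') main'; have : -1 * Q z <= 0.
    apply: main' => // v _; rewrite mulN1r /Q -mulrN ler_pM2l ?expR_gt0//.
    by apply: le_trans (fq v); rewrite -normrN ler_norm.
  by rewrite mulN1r oppr_le0 /Q pmulr_rge0.
have [z ez] := tproj_surj p0; rewrite -ez in Mp0 *.
have re : complex.Re (q (pr z)) = 0.
  apply: (zero (fun z => complex.Re (q (pr z))) Ca) => //.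
  - by move=> v Av; have [] := complex_equation_parts (eq v Av).
  - by move=> n p; rewrite tprojD2pi.
  - by move=> v; case: (ler_normc (q (pr v))).
have im : complex.Im (q (pr z)) = 0.
  apply: (zero (fun z => complex.Im (q (pr z))) Cb) => //.
  - by move=> v Av; have [] := complex_equation_parts (eq v Av).
  - by move=> n p; rewrite tprojD2pi.
  - by move=> v; case: (ler_normc (q (pr v))).
by move: re im; case: (q (pr z)) => a b /= -> ->.
Qed.

End eigenfunction.

Theorem theorem0p20 (R : realType) (T : R) (hT : 1 < T) (rho : R)
    (hrho : 0 < rho) (u : torus (ln T) -> \bar R) (hu : subfunction rho u)
    (hM : exists M : set (torus (ln T)),
        [/\ is_component M (Hset rho u), positive_capacity (boundary M) &
            (rho_dom M < rho%:E)%E]) :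
  minimal_subfunction rho u.
Proof.
split=> // eps eps0 [w [sw wu]]; have [M [cM _ /rho_dom_lt[s [s0 [q [[p Mp /eqP q0] [B qB] Cq [E ZE lim]]] _] srho]]] := hM.
have oH : open (Hset rho u) by apply: bigcup_open => U [].
have oM := open_component oH cM.
have MH : M `<=` Hset rho u by case: cM => p' _ ->; exact: connected_component_sub.
by apply: q0; exact: (eigenfunction_zero hT s0 srho eps0 hu sw wu oM MH qB Cq ZE lim).
Qed.
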